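(* Let $K$ be an algebraically closed field of characteristic zero and let $f_1,\ldots,f_n$ be $R_+$-primary homogeneous polynomials in $R=K[X,Y,Z]$ such that their syzygy bundle $\mathcal{S}:=\mathrm{Syz}(f_1,\ldots,f_n)$ is semistable on $\mathbb{P}^2=\mathrm{Proj}\,R$. Then the following holds: (1) If the restriction of $\mathcal{S}$ splits on a generic line $L\subset\mathbb{P}^2$ as $$\mathcal{S}|_L \cong \bigoplus_{i=1}^{s}\mathcal{O}_L(a+1)\oplus\bigoplus_{i=s+1}^{n-1}\mathcal{O}_L(a)$$ (for some $a\in\mathbb{Z}$ and $0\le s\le n-1$), then $A=R/(f_1,\ldots,f_n)$ has the Weak Lefschetz property. (2) If the restriction of $\mathcal{S}$ splits on a generic line $L\subset\mathbb{P}^2$ as $$\mathcal{S}|_L\cong\mathcal{O}_L(a_1)\oplus\cdots\oplus\mathcal{O}_L(a_{n-1})$$ with $a_1\geq a_2\geq\cdots\geq a_{n-1}$ and $a_1-a_{n-1}\geq 2$, then $A=R/(f_1,\ldots,f_n)$ does not have the Weak Lefschetz property.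
   Context: Homogeneous polynomials $f_1,\ldots,f_n\in R=K[X,Y,Z]$ of degrees $d_1,\ldots,d_n$ are called $R_+$-primary if the ideal they generate is primary to the irrelevant ideal $R_+=(X,Y,Z)$, i.e. its radical is $R_+$. Their syzygy bundle $\mathrm{Syz}(f_1,\ldots,f_n)$ is the vector bundle of rank $n-1$ on $\mathbb{P}^2=\mathrm{Proj}\,R$ which is the kernel of the surjection $\bigoplus_{i=1}^n\mathcal{O}_{\mathbb{P}^2}(-d_i)\to\mathcal{O}_{\mathbb{P}^2}$ given by $(f_1,\ldots,f_n)$. A torsion-free coherent sheaf $\mathcal{E}$ on $\mathbb{P}^2$ is semistable (in the sense of Mumford and Takemoto) if for every nonzero coherent subsheaf $\mathcal{F}\subset\mathcal{E}$ one has $\deg(\mathcal{F})/\mathrm{rk}(\mathcal{F})\le\deg(\mathcal{E})/\mathrm{rk}(\mathcal{E})$, where $\deg(\mathcal{F})$ is the integer $k$ with $(\bigwedge^{\mathrm{rk}(\mathcal{F})}\mathcal{F})^{**}\cong\mathcal{O}_{\mathbb{P}^2}(k)$. The graded $K$-algebra $A=R/(f_1,\ldots,f_n)=K\oplus A_1\oplus\cdots\oplus A_s$ is Artinian (the top degree here is unrelated to the index $s$ in the claim). It has the Weak Lefschetz property if for every general linear form $\ell\in R_1$ (i.e. for all $\ell$ in some nonempty Zariski-open subset of $R_1$) the multiplication maps $A_m\to A_{m+1}$, $x\mapsto\ell x$, have maximal rank (are injective or surjective) for every $m$ from $0$ to the top degree minus $1$. A property holds on a generic line if it holds for all lines $L=V_+(\ell)\subset\mathbb{P}^2$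 in a nonempty Zariski-open subset of the dual projective plane of lines. *)

(* Defs.v *)
From HB Require Import structures.
From mathcomp Require Import all_boot all_order all_algebra.
From mathcomp Require Import mpoly.

Set Implicit Arguments.
Unset Strict Implicit.
Unset Printing Implicit Defensive.

Import GRing.Theory.
Local Open Scope ring_scope.

(* Varieties and sheaves are classical: K is algebraically closed, so P^2 and
   its lines are replaced by their closed points, and open sets, regular
   functions and (reduced) coherent sheaves are those of Hartshorne I.3.
   A subset of P^2 is represented by its cone minus the origin in K^3. *)

Definition pt (K : closedFieldType) : Type := {ffun 'I_3 -> K}.

Definition P2 (K : closedFieldType) (p : pt K) : Prop := p != 0.

(* U is open in X, for X a subset of P^2 with the induced topology. *)
Definition zopen (K : closedFieldType) (X U : pt K -> Prop) : Prop :=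
  exists2 G : {mpoly K[3]} -> Prop,
    (forall g, G g -> exists e : nat, g \is e.-homog) &
    (forall p, U p <-> X p /\ exists2 g, G g & g.@[p] != 0).

(* Zariski-open subsets of the affine space K^3. *)
Definition aopen (K : closedFieldType) (W : pt K -> Prop) : Prop :=
  exists G : {mpoly K[3]} -> Prop,
    forall a, W a <-> exists2 g, G g & g.@[a] != 0.

Definition linform (K : closedFieldType) (a : pt K) : {mpoly K[3]} :=
  \sum_(i < 3) a i *: 'X_i.

Definition line (K : closedFieldType) (a : pt K) (p : pt K) : Prop :=
  P2 p /\ (linform a).@[p] = 0.

(* The open sets of the dual plane are those of P2, in the coordinates a of
   the line V_+(linform a). *)
Definition on_generic_line (K : closedFieldType)
    (Q : (pt K -> Prop) -> Prop) : Prop :=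
  exists W : pt K -> Prop,
    [/\ zopen (@P2 K) W, exists a, W a & forall a, W a -> Q (line a)].

(* phi is a section of O(k) on X: a function on the cone over X which is
   locally a quotient of homogeneous polynomials of degree difference k. *)
Definition regular (K : closedFieldType) (k : int) (X : pt K -> Prop)
    (phi : pt K -> K) : Prop :=
  forall p, X p -> exists U : pt K -> Prop, exists g h : {mpoly K[3]},
    exists eg eh : nat,
    [/\ zopen (@P2 K) U, U p,
        (g \is eg.-homog /\ h \is eh.-homog),
        eg%:Z = eh%:Z + k &
        forall q, X q -> U q -> h.@[q] != 0 /\ phi q = g.@[q] / h.@[q] ].

(* A sheaf of O-modules whose sections over U are the elements of a carrier
   satisfying sec U, taken modulo eqs U; the restriction maps are induced by
   the identity of the carrier (e.g. functions defined everywhere, of which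
   only the values on U count). *)
Record sheaf (K : closedFieldType) := Sheaf {
  car : Type;
  sec : (pt K -> Prop) -> car -> Prop;
  eqs : (pt K -> Prop) -> car -> car -> Prop;
  szero : car;
  sadd : car -> car -> car;
  sscale : (pt K -> K) -> car -> car
}.

Definition fun_sheaf (K : closedFieldType)
    (F : (pt K -> Prop) -> (pt K -> K) -> Prop) : sheaf K :=
  @Sheaf K (pt K -> K) F
    (fun U s t => forall p, U p -> s p = t p)
    (fun=> 0) (fun s t p => s p + t p) (fun c s p => c p * s p).

Definition row_sheaf (K : closedFieldType) (m : nat)
    (F : (pt K -> Prop) -> (pt K -> 'rV[K]_m) -> Prop) : sheaf K :=
  @Sheaf K (pt K -> 'rV[K]_m) F
    (fun U s t => forall p, U p -> s p = t p)
    (fun=> 0) (fun s t p => s p + t p) (fun c s p => c p *: s p).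

Definition Otw (K : closedFieldType) (k : int) : sheaf K :=
  fun_sheaf (@regular K k).

(* The direct sum of the O(b i). *)
Definition Osum (K : closedFieldType) (m : nat) (b : 'I_m -> int) : sheaf K :=
  row_sheaf (fun U s => forall i, regular (b i) U (fun p => s p 0 i)).

(* phi is a morphism A|X -> B|X of sheaves of O_X-modules. *)
Definition is_hom (K : closedFieldType) (X : pt K -> Prop) (A B : sheaf K)
    (phi : (pt K -> Prop) -> car A -> car B) : Prop :=
  forall U, zopen X U ->
  [/\ forall s, sec U s -> sec U (phi U s),
      forall s t, sec U s -> sec U t -> eqs U s t ->
        eqs U (phi U s) (phi U t),
      forall s t, sec U s -> sec U t ->
        eqs U (phi U (sadd s t)) (sadd (phi U s) (phi U t)),
      forall c s, regular 0 U c -> sec U s ->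
        eqs U (phi U (sscale c s)) (sscale c (phi U s)) &
      forall V s, zopen U V -> sec U s -> eqs V (phi V s) (phi U s)].

Definition isom (K : closedFieldType) (X : pt K -> Prop) (A B : sheaf K) :
    Prop :=
  exists (phi : (pt K -> Prop) -> car A -> car B)
         (psi : (pt K -> Prop) -> car B -> car A),
  [/\ is_hom X phi, is_hom X psi,
      forall U s, zopen X U -> sec U s -> eqs U (psi U (phi U s)) s &
      forall U t, zopen X U -> sec U t -> eqs U (phi U (psi U t)) t].

(* The sheaf Hom(A, O). *)
Definition sheaf_dual (K : closedFieldType) (A : sheaf K) : sheaf K :=
  @Sheaf K ((pt K -> Prop) -> car A -> pt K -> K)
    (fun U phi => @is_hom K U A (Otw K 0) phi)
    (fun U phi psi => forall V s, zopen U V -> sec V s ->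
       forall p, V p -> phi V s p = psi V s p)
    (fun _ _ => fun=> 0)
    (fun phi psi V s p => phi V s p + psi V s p)
    (fun c phi V s p => c p * phi V s p).

(* phi is an alternating O-multilinear form A^r -> O over U. *)
Definition is_alt (K : closedFieldType) (r : nat) (A : sheaf K)
    (U : pt K -> Prop)
    (phi : (pt K -> Prop) -> ('I_r -> car A) -> pt K -> K) : Prop :=
  forall V (s : 'I_r -> car A), zopen U V -> (forall i, sec V (s i)) ->
  [/\ regular 0 V (phi V s),
      forall W, zopen V W -> forall p, W p -> phi W s p = phi V s p,
      forall i, @is_hom K V A (Otw K 0)
        (fun W t => phi W (fun j => if j == i then t else s j)) &
      forall i j, i != j -> eqs V (s i) (s j) ->
        forall p, V p -> phi V s p = 0].

(* The dual of the r-th exterior power of A: by the universal property of the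
   exterior power (and of sheafification), Hom(Lambda^r A, O) is the sheaf of
   alternating r-forms on A. *)
Definition ext_dual (K : closedFieldType) (r : nat) (A : sheaf K) : sheaf K :=
  @Sheaf K ((pt K -> Prop) -> ('I_r -> car A) -> pt K -> K)
    (fun U phi => is_alt U phi)
    (fun U phi psi => forall V s, zopen U V -> (forall i, sec V (s i)) ->
       forall p, V p -> phi V s p = psi V s p)
    (fun _ _ => fun=> 0)
    (fun phi psi V s p => phi V s p + psi V s p)
    (fun c phi V s p => c p * phi V s p).

(* The rank of a torsion-free coherent sheaf on P^2: it is free of rank r on
   some nonempty open set. *)
Definition has_rank (K : closedFieldType) (A : sheaf K) (r : nat) : Prop :=
  exists U : pt K -> Prop,
    [/\ zopen (@P2 K) U, exists p, U p &
        isom U A (@Osum K r (fun=> 0))].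

(* (Lambda^rk A)^** is isomorphic to O(k). *)
Definition has_degree (K : closedFieldType) (A : sheaf K) (k : int) : Prop :=
  exists2 r, has_rank A r & isom (@P2 K) (sheaf_dual (ext_dual r A)) (Otw K k).

Definition subsheaf (K : closedFieldType) (E : sheaf K)
    (F : (pt K -> Prop) -> car E -> Prop) : sheaf K :=
  @Sheaf K (car E) F (@eqs K E) (@szero K E) (@sadd K E) (@sscale K E).

Definition is_subsheaf (K : closedFieldType) (E : sheaf K)
    (F : (pt K -> Prop) -> car E -> Prop) : Prop :=
  (forall U, zopen (@P2 K) U ->
   [/\ forall s, F U s -> sec U s,
       F U (szero E),
       forall s t, F U s -> F U t -> F U (sadd s t),
       forall c s, regular 0 U c -> F U s -> F U (sscale c s) &
       forall V s, zopen U V -> F U s -> F V s])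
  /\ (* F is closed under gluing, and is compatible with equality of sections *)
  (forall U s, zopen (@P2 K) U -> sec U s ->
     (forall p, U p -> exists V t,
        [/\ zopen U V, V p, F V t & eqs V s t]) -> F U s).

(* On the noetherian scheme P^2, a subsheaf of a coherent sheaf is coherent
   if and only if it is of finite type. *)
Definition finite_type (K : closedFieldType) (A : sheaf K) : Prop :=
  forall p, P2 p -> exists (V : pt K -> Prop) (m : nat) (s : 'I_m -> car A),
    [/\ zopen (@P2 K) V, V p, forall j, sec V (s j) &
        forall W t q, zopen V W -> sec W t -> W q ->
          exists (W' : pt K -> Prop) (c : 'I_m -> pt K -> K),
          [/\ zopen W W', W' q, forall j, regular 0 W' (c j) &
              eqs W' t (\big[@sadd K A/szero A]_(j < m) sscale (c j) (s j))]].

Definition coherent_subsheaf (K : closedFieldType) (E : sheaf K)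
    (F : (pt K -> Prop) -> car E -> Prop) : Prop :=
  is_subsheaf F /\ finite_type (subsheaf F).

Definition nonzero_sheaf (K : closedFieldType) (A : sheaf K) : Prop :=
  exists U s, [/\ zopen (@P2 K) U, @sec K A U s & ~ eqs U s (szero A)].

(* Mumford-Takemoto semistability of a torsion-free coherent sheaf on P^2. *)
Definition semistable (K : closedFieldType) (E : sheaf K) : Prop :=
  forall F : (pt K -> Prop) -> car E -> Prop,
    coherent_subsheaf F -> nonzero_sheaf (subsheaf F) ->
  forall (rF rE : nat) (dF dE : int),
    has_rank (subsheaf F) rF -> has_degree (subsheaf F) dF ->
    has_rank E rE -> has_degree E dE ->
    dF%:~R / rF%:R <= dE%:~R / rE%:R :> rat.

(* Sections of the kernel of (f_1, .., f_n) from the sum of the O(- d_i) to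
   O. *)
Definition syz_sec (K : closedFieldType) (n : nat) (f : 'I_n -> {mpoly K[3]})
    (d : 'I_n -> nat) (U : pt K -> Prop) (s : pt K -> 'rV[K]_n) : Prop :=
  @sec K (Osum K (fun i => - (d i)%:Z)) U s /\
  forall p, U p -> \sum_(i < n) (f i).@[p] * s p 0 i = 0.

Definition Syz (K : closedFieldType) (n : nat) (f : 'I_n -> {mpoly K[3]})
    (d : 'I_n -> nat) : sheaf K :=
  row_sheaf (syz_sec f d).

(* Syz(f) restricted to a closed subset L of P^2. As the f i have no common
   zero, Syz(f) is locally a direct summand of the sum of the O(- d_i); its
   restriction to L is therefore the subsheaf of the sum of the O_L(- d_i)
   whose sections are locally the restrictions to L of sections of Syz(f). *)
Definition Syz_restr (K : closedFieldType) (n : nat)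
    (f : 'I_n -> {mpoly K[3]}) (d : 'I_n -> nat) : sheaf K :=
  row_sheaf (fun (V : pt K -> Prop) (s : pt K -> 'rV[K]_n) =>
    forall p, V p -> exists (U : pt K -> Prop) (t : pt K -> 'rV[K]_n),
      [/\ zopen (@P2 K) U, U p, syz_sec f d U t &
          forall q, V q -> U q -> s q = t q]).

(* Membership in the ideal generated by f. *)
Definition in_ideal (K : closedFieldType) (n : nat)
    (f : 'I_n -> {mpoly K[3]}) (g : {mpoly K[3]}) : Prop :=
  exists c : 'I_n -> {mpoly K[3]}, g = \sum_(i < n) c i * f i.

(* The radical of (f_1, .., f_n) is (X, Y, Z). *)
Definition Rplus_primary (K : closedFieldType) (n : nat)
    (f : 'I_n -> {mpoly K[3]}) : Prop :=
  forall g : {mpoly K[3]},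
    (exists m : nat, in_ideal f (g ^+ m)) <->
    in_ideal (fun i : 'I_3 => 'X_i) g.

(* The elements of A_m, for A = K[X,Y,Z] / (f_1, .., f_n), are represented by
   homogeneous polynomials of degree m. *)

Definition top_degree (K : closedFieldType) (n : nat)
    (f : 'I_n -> {mpoly K[3]}) (s : nat) : Prop :=
  (exists2 x : {mpoly K[3]}, x \is s.-homog & ~ in_ideal f x) /\
  forall (m : nat) (x : {mpoly K[3]}),
    (s < m)%N -> x \is m.-homog -> in_ideal f x.

Definition mul_injective (K : closedFieldType) (n : nat)
    (f : 'I_n -> {mpoly K[3]}) (l : {mpoly K[3]}) (m : nat) : Prop :=
  forall x y : {mpoly K[3]}, x \is m.-homog -> y \is m.-homog ->
    in_ideal f (l * x - l * y) -> in_ideal f (x - y).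

Definition mul_surjective (K : closedFieldType) (n : nat)
    (f : 'I_n -> {mpoly K[3]}) (l : {mpoly K[3]}) (m : nat) : Prop :=
  forall y : {mpoly K[3]}, y \is m.+1.-homog ->
    exists2 x : {mpoly K[3]}, x \is m.-homog & in_ideal f (l * x - y).

Definition weak_lefschetz (K : closedFieldType) (n : nat)
    (f : 'I_n -> {mpoly K[3]}) : Prop :=
  exists W : pt K -> Prop,
    [/\ aopen W, exists a, W a &
        forall a, W a -> forall s m, top_degree f s -> (m < s)%N ->
          mul_injective f (linform a) m \/ mul_surjective f (linform a) m].

(* Main.v *)
(* Let L = V(l) and let b_1, ..., b_(n-1) be the splitting type of S on L.  The
   images on L of the summands O(b_j) form a homogeneous basis of the syzygies of
   the f_i modulo l, so counting dimensions in K[s, t] gives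
     dim (A/lA)_m = (m+1) - sum_i (m+1-d_i)^+ + sum_j (m+1+b_j)^+ ,
   and sum_j b_j = - sum_i d_i for large m.

   (1) If all m+1+b_j are negative, there are no syzygies of degree m+1 modulo l
   and multiplication by l on A_m is injective; if they are all at least -1, the
   formula gives (A/lA)_(m+1) = 0.  This does not use semistability.

   (2) Put mu = - a_1.  There is a syzygy of degree mu modulo l, but none on P^2,
   since it would generate a subsheaf O(a_1) of S, and a_1 exceeds the slope of S.
   Hence multiplication A_(mu-1) -> A_mu is not injective.  If it were surjective,
   (A/lA)_mu = (A/lA)_(mu+1) = 0, and the formula in these two degrees computes
   the number and the sum of the d_i <= mu+1.  The Koszul syzygies of the
   corresponding f_i, which have no common zero on L, generate a subsheaf of S of
   degree minus the sum of these d_i, and this subsheaf destabilizes S. *)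

From HB Require Import structures.
Require Import Defs.
From mathcomp Require Import all_boot all_order all_algebra.
From mathcomp Require Import perm mpoly zify ring.
From Stdlib Require Import Classical ClassicalEpsilon FunctionalExtensionality.

Set Implicit Arguments.
Unset Strict Implicit.
Unset Printing Implicit Defensive.

Import GRing.Theory.
Local Open Scope ring_scope.

(** * Open sets and regular functions *)

(** Degree is defined through (Lambda^r F)^**, so for each destabilizing subsheaf an isomorphism
    with O(k) has to be exhibited, although the Koszul subsheaf need not be locally free. A [framed]
    sheaf isolates what suffices: a generic basis, a volume factor, and tuples of sections with
    polynomial volume. An alternating form divided by the volume form then extends by Hartogs, which
    is reduced to division of binary forms and descent along the equation of a line. For Koszul
    syzygies the volume comes from Cramer's rule: the maximal minors of r+1 syzygies of r+2 forms
    are proportional to these forms, and the common factor has degree - sum d_i.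

    The splitting on a line is an isomorphism of ungraded sheaves; graded syzygies are recovered by
    transporting the sections X_c^(b_j) e_j over the charts.

    In (2) the two degrees suffice because mu + b_j <= 0: the truncated terms in degree mu count the
    j with b_j = a_1, and their increments to degree mu+1 count the j with b_j >= a_1 - 1. The gap
    of 2 makes the second number less than n-1, so the chosen subfamily is proper. *)

Lemma meval_dhomog_scale (K : comNzRingType) n (g : {mpoly K[n]}) e
    (v : 'I_n -> K) (c : K) :
  g \is e.-homog -> g.@[fun i => c * v i] = c ^+ e * g.@[v].
Proof.
move=> /dhomogP gh; rewrite !mevalE big_distrr /=.
rewrite !big_seq; apply: eq_bigr => m mg.
rewrite (eq_bigr (fun i => c ^+ m i * v i ^+ m i)); last first.
  by move=> i _; rewrite exprMn.
rewrite big_split /= prodrXr -mdegE gh //; ring.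
Qed.

(** Kronecker substitution: X_i is sent to t^(N^i) with N above every exponent of g. Distinct
    monomials of g stay distinct, so the result is a nonzero polynomial in t, and it has a nonroot
    in the infinite field K. *)
Lemma mpoly_neq0_eval (K : closedFieldType) (g : {mpoly K[3]}) :
  g != 0 -> exists p : pt K, g.@[p] != 0.
Proof.
move=> g0; pose N := (msize g).+1.
pose wt (m : 'X_{1..3}) := (\sum_(i < 3) m i * N ^ i)%N.
have lt_N m i : m \in msupp g -> (m i < N)%N.
  move=> /msize_mdeg_lt; rewrite mdegE (bigD1 i) //= /N; lia.
(* The exponents are the base-N digits of the weight and are read off modulo N. *)
have wt_inj : {in msupp g &, injective wt}.
  move=> m1 m2 h1 h2; rewrite /wt !big_ord_recr !big_ord0 /= => E.
  have P k := lt_N _ k h1; have Q k := lt_N _ k h2.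
  set u0 := widen_ord _ _ in E; set u1 := widen_ord _ _ in E.
  set u2 := ord_max in E.
  move: E (P u0) (P u1) (Q u0) (Q u1); rewrite expn0 expn1 !muln1 add0n => E.
  have mN (x y z : nat) : (x + y * N + z * N ^ 2 = (z * N + y) * N + x)%N by ring.
  move=> lx ly lx' ly'; move: E; rewrite !mN => E.
  have e0 : m1 u0 = m2 u0.
    by have := congr1 (modn^~ N) E; rewrite !modnMDl !modn_small.
  have e1' : (m1 u2 * N + m1 u1 = m2 u2 * N + m2 u1)%N.
    by move: E; rewrite e0 => /addIn /eqP; rewrite eqn_mul2r => /orP [|/eqP //]; lia.
  have e1 : m1 u1 = m2 u1.
    by have := congr1 (modn^~ N) e1'; rewrite !modnMDl !modn_small.
  have e2 : m1 u2 = m2 u2.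
    by move: e1'; rewrite e1 => /addIn /eqP; rewrite eqn_mul2r => /orP [|/eqP //]; lia.
  apply/mnmP => i; case: i => [[|[|[|//]]]] Hi.
  - by have -> : Ordinal Hi = u0 by apply: val_inj.
  - by have -> : Ordinal Hi = u1 by apply: val_inj.
  - by have -> : Ordinal Hi = u2 by apply: val_inj.
pose q : {poly K} := \sum_(m <- msupp g) g@_m *: 'X^(wt m).
have q0 : q != 0.
  apply: contraNneq g0 => q0.
  rewrite -mleadc_eq0 -/(mleadc _); set m0 := mlead g.
  case: (boolP (g == 0)) => [/eqP g0|g0]; first by rewrite g0 mcoeff0.
  have m0s : m0 \in msupp g by exact: mlead_supp.
  have := congr1 (fun p : {poly K} => p`_(wt m0)) q0.
  rewrite coef0 coef_sum (bigD1_seq m0) ?msupp_uniq //= coefZ coefXn eqxx mulr1.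
  rewrite big_seq_cond big1 ?addr0 => [->//|m /andP [ms nm]].
  rewrite coefZ coefXn; case: eqP => [E|]; last by rewrite mulr0.
  by rewrite (wt_inj _ _ m0s ms E) eqxx in nm.
have [t] := closed_nonrootP _ q0.
rewrite /root => qt; exists [ffun i : 'I_3 => t ^+ (N ^ i)].
apply: contraNneq qt => gt; apply/eqP; rewrite -gt mevalE horner_sum.
apply: eq_bigr => m _; rewrite hornerZ hornerXn; congr (_ * _).
rewrite /wt -prodrXr; apply: eq_bigr => i _.
by rewrite ffunE -exprM mulnC.
Qed.

Definition chart (K : closedFieldType) (V : pt K -> Prop) (h : {mpoly K[3]})
    (p : pt K) : Prop := V p /\ h.@[p] != 0.

(** Integer degrees, with only 0 in negative degree, let twists such as m - d i be handled without
    truncated subtraction. *)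
Definition zhomog (K : closedFieldType) (k : int) (g : {mpoly K[3]}) : Prop :=
  match k with Posz e => g \is e.-homog | Negz _ => g = 0 end.

Section Opens.
Variable K : closedFieldType.
Implicit Types (X Y U V W : pt K -> Prop) (p q : pt K) (g h : {mpoly K[3]}).

Lemma zopen_sub X U p : zopen X U -> U p -> X p.
Proof. by case=> G _ HU /HU []. Qed.

Lemma zopen_refl X : zopen X X.
Proof.
exists (eq 1) => [_ <-|p]; first by exists 0%N; apply: dhomog1.
by split=> [|[]//]; split=> //; exists 1 => //; rewrite meval1 oner_neq0.
Qed.

Lemma zopen_chart X h e : h \is e.-homog -> zopen X (chart X h).
Proof.
move=> hh; exists (eq h) => [_ <-|p]; first by exists e.
split=> [[Xp hp]|[Xp [_ <- hp]]]; split=> //; by exists h.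
Qed.

Lemma zopen_trans X U V : zopen X U -> zopen U V -> zopen X V.
Proof.
case=> G Gh HU [G' Gh' HV].
exists (fun g => exists g1 g2, [/\ G g1, G' g2 & g = g1 * g2]).
  move=> _ [g1 [g2 [/Gh [e1 h1] /Gh' [e2 h2] ->]]].
  by exists (e1 + e2)%N; apply: dhomogM.
move=> p; split=> [/HV [/HU [Xp [g1 G1 g1p]] [g2 G2 g2p]]|].
  split=> //; exists (g1 * g2); first by exists g1, g2.
  by rewrite mevalM mulf_neq0.
case=> Xp [_ [g1 [g2 [G1 G2 ->]]]]; rewrite mevalM mulf_eq0 negb_or.
case/andP=> n1 n2; apply/HV; split; last by exists g2.
by apply/HU; split=> //; exists g1.
Qed.

Lemma zopen_narrow X Y U :
  zopen X U -> (forall p, U p -> Y p) -> (forall p, Y p -> X p) -> zopen Y U.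
Proof.
case=> G Gh HU sUY sYX; exists G => // p; split=> [Up|[Yp gp]].
  by split; [exact: sUY | case/HU: Up].
by apply/HU; split=> //; apply: sYX.
Qed.

Lemma zopen_cap X Y U :
  zopen X U -> (forall p, Y p -> X p) -> zopen Y (fun p => Y p /\ U p).
Proof.
case=> G Gh HU sYX; exists G => // p; split=> [[Yp /HU [_ gp]]//|[Yp gp]].
by split=> //; apply/HU; split=> //; apply: sYX.
Qed.

Lemma zopen_basic X U p : zopen X U -> U p ->
  exists e h, [/\ h \is e.-homog, h.@[p] != 0 &
                  forall q, X q -> h.@[q] != 0 -> U q].
Proof.
case=> G Gh HU /HU [Xp [h Gg hp]]; have [e he] := Gh _ Gg.
by exists e, h; split=> // q Xq hq; apply/HU; split=> //; exists h.
Qed.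

Lemma dhomogXi (i : 'I_3) : ('X_i : {mpoly K[3]}) \is 1.-homog.
Proof. by rewrite dhomogX; apply/eqP; exact: mdeg1. Qed.

Lemma dhomogXn (i : 'I_3) e : ('X_i ^+ e : {mpoly K[3]}) \is e.-homog.
Proof. by have := dhomogMn e (dhomogXi i); rewrite mul1n. Qed.

Lemma mpolyX_neq0 (c : 'I_3) : 'X_c != 0 :> {mpoly K[3]}.
Proof.
apply/eqP => X0; have := congr1 (fun g => g.@[fun=> 1]) X0.
by rewrite mevalXU meval0 => /eqP; rewrite oner_eq0.
Qed.

Lemma linform_homog (a : pt K) : linform a \is 1.-homog.
Proof. by apply: rpred_sum => i _; apply: dhomogZ; apply: dhomogXi. Qed.

Lemma P2_coord p : P2 p -> exists c, p c != 0.
Proof.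
move=> p0; apply: NNPP => H; case/negP: p0; apply/eqP/ffunP => c.
rewrite ffunE; apply/eqP; apply: contraT => pc; by case: H; exists c.
Qed.

Lemma coord_P2 p c : p c != 0 -> P2 p.
Proof. by apply: contraNneq => ->; rewrite ffunE. Qed.

(* K[X,Y,Z] is a domain and K is infinite, so a nonempty open set is dense. *)
Lemma mpoly_eq_open V p h g1 g2 : zopen (@P2 K) V -> V p -> h != 0 ->
  (forall q, V q -> h.@[q] != 0 -> g1.@[q] = g2.@[q]) -> g1 = g2.
Proof.
move=> oV Vp h0 E; have [e [w [_ wp Hw]]] := zopen_basic oV Vp.
(* The factor ['X_ord0] ensures that a point where the product does not vanish differs from the
   origin, hence lies in [P2]. *)
have Z : h * w * 'X_ord0 * (g1 - g2) = 0.
  apply/eqP; apply: contraT => /mpoly_neq0_eval [q].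
  rewrite !mevalM mevalB mevalXU !mulf_eq0 !negb_or.
  case/andP => /andP [/andP [hq wq] /coord_P2 Pq].
  by rewrite E ?subrr ?eqxx //; apply: Hw.
have w0 : w != 0 by apply: contraNneq wp => ->; rewrite meval0.
move/eqP: Z; rewrite !mulf_eq0 !(negPf h0, negPf w0, negPf (mpolyX_neq0 _)) /=.
by rewrite subr_eq0 => /eqP.
Qed.

Lemma zhomog0 k : zhomog k (0 : {mpoly K[3]}).
Proof. by case: k => k //=; apply: dhomog0. Qed.

Lemma zhomogM k l g h : zhomog k g -> zhomog l h -> zhomog (k + l) (g * h).
Proof.
case: k l => [k|k] [l|l] hg hh; first exact: dhomogM.
- by rewrite [h]hh mulr0; exact: zhomog0.
- by rewrite [g]hg mul0r; exact: zhomog0.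
- by rewrite [g]hg mul0r; exact: zhomog0.
Qed.

Lemma zhomogD k g h : zhomog k g -> zhomog k h -> zhomog k (g + h).
Proof. by case: k => k /=; [exact: dhomogD | move=> -> ->; rewrite addr0]. Qed.

Lemma zhomogN k g : zhomog k g -> zhomog k (- g).
Proof. by case: k => k /=; [rewrite dhomogN | move=> ->; rewrite oppr0]. Qed.

Lemma zhomogZ k c g : zhomog k g -> zhomog k (c *: g).
Proof. by case: k => k /=; [exact: dhomogZ | move=> ->; rewrite scaler0]. Qed.

Lemma zhomog_sum k (I : finType) (P : pred I) (G : I -> {mpoly K[3]}) :
  (forall i, P i -> zhomog k (G i)) -> zhomog k (\sum_(i | P i) G i).
Proof.
move=> H; elim/big_ind: _ => //; first exact: zhomog0.
by move=> x y; apply: zhomogD.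
Qed.

Lemma zhomogE k g : zhomog k g -> g != 0 -> exists2 e : nat, k = e & g \is e.-homog.
Proof. by case: k => k /=; [exists k | move=> ->; rewrite eqxx]. Qed.

End Opens.

Section Regular.
Variable K : closedFieldType.
Implicit Types (X Y U V W : pt K -> Prop) (p q : pt K) (g h : {mpoly K[3]}).
Implicit Types (u v : pt K -> K) (k l : int).

Lemma regularI k X u : (forall p, X p -> P2 p) ->
  (forall p, X p -> exists eg eh g h,
     [/\ g \is eg.-homog /\ h \is eh.-homog, eg%:Z = eh%:Z + k, h.@[p] != 0 &
         forall q, X q -> h.@[q] != 0 -> u q = g.@[q] / h.@[q]]) ->
  regular k X u.
Proof.
move=> XP H p Xp; have [eg [eh [g [h [[hg hh] E hp Hq]]]]] := H p Xp.
exists (chart (@P2 K) h), g, h, eg, eh; split=> //.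
- exact: zopen_chart hh.
- by split=> //; apply: XP.
- by move=> q Xq [_ hq]; split=> //; apply: Hq.
Qed.

(** The neighbourhood is shrunk to a basic open set {w <> 0}, and w is multiplied into numerator and
    denominator. The nonvanishing of one polynomial then describes both the neighbourhood and the
    domain of the fraction. *)
Lemma regularE k X u p : (forall p, X p -> P2 p) -> regular k X u -> X p ->
  exists eg eh g h,
     [/\ g \is eg.-homog /\ h \is eh.-homog, eg%:Z = eh%:Z + k, h.@[p] != 0 &
         forall q, X q -> h.@[q] != 0 -> u q = g.@[q] / h.@[q]].
Proof.
move=> XP H Xp; have [U [g [h [eg [eh [oU Up [hg hh] E Hq]]]]]] := H p Xp.
have [e [w [hw wp Hw]]] := zopen_basic oU Up.
exists (eg + e)%N, (eh + e)%N, (g * w), (h * w); split.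
- by split; apply: dhomogM.
- by rewrite !PoszD E; ring.
- by rewrite mevalM mulf_neq0 //; case: (Hq p Xp Up).
- move=> q Xq; rewrite !mevalM mulf_eq0 negb_or => /andP [hq wq].
  have [_ ->] := Hq q Xq (Hw q (XP q Xq) wq).
  by rewrite invfM mulrACA divff // mulr1.
Qed.

Lemma regular_sub k X Y u :
  (forall p, Y p -> X p) -> regular k X u -> regular k Y u.
Proof.
move=> sYX H p Yp; have [U [g [h [eg [eh [oU Up hgh E Hq]]]]]] := H p (sYX p Yp).
by exists U, g, h, eg, eh; split=> // q Yq Uq; apply: Hq => //; apply: sYX.
Qed.

Lemma regular_zopen k X Y u : zopen X Y -> regular k X u -> regular k Y u.
Proof. by move=> oY; apply: regular_sub => p; apply: zopen_sub. Qed.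

Lemma eq_regular k X u v :
  (forall p, X p -> u p = v p) -> regular k X u -> regular k X v.
Proof.
move=> E H p Xp; have [U [g [h [eg [eh [oU Up hgh Ed Hq]]]]]] := H p Xp.
exists U, g, h, eg, eh; split=> // q Xq Uq; have [hq Eq] := Hq q Xq Uq.
by rewrite -E.
Qed.

Lemma regular_local k X u : (forall p, X p -> P2 p) ->
  (forall p, X p -> exists U, [/\ zopen X U, U p & regular k U u]) ->
  regular k X u.
Proof.
move=> XP H p Xp; have [U [oU Up rU]] := H p Xp.
have [e [w [hw wp Hw]]] := zopen_basic oU Up.
have [V [g [h [eg [eh [oV Vp [hg hh] Ed Hq]]]]]] := rU p Up.
exists (chart V w), g, h, eg, eh; split=> //.
- by apply: zopen_trans oV _; apply: zopen_chart hw.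
- by move=> q Xq [Vq wq]; apply: Hq => //; apply: Hw.
Qed.

Lemma regular_poly k X g : (forall p, X p -> P2 p) -> zhomog k g ->
  regular k X (fun p => g.@[p]).
Proof.
move=> XP; case: k => [e|e] /= hg; apply: regularI => // p Xp.
  exists e, 0%N, g, 1; rewrite hg dhomog1; split=> //.
  - by rewrite meval1 oner_neq0.
  - by move=> q _ _; rewrite meval1 divr1.
(* In negative degree - (e+1) the zero section is written as 0 / X_c^(e+1). *)
have [c pc] := P2_coord (XP p Xp).
exists 0%N, e.+1, 0, ('X_c ^+ e.+1); split=> //.
- by split; [exact: dhomog0 | exact: dhomogXn].
- by rewrite NegzE subrr.
- by rewrite rmorphXn /= mevalXU expf_neq0.
- by move=> q _ _; rewrite hg meval0 mul0r.
Qed.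

Lemma regular0 k X : (forall p, X p -> P2 p) -> regular k X (fun=> 0).
Proof.
move=> XP; apply: eq_regular (regular_poly XP (zhomog0 K k)) => p _.
by rewrite meval0.
Qed.

Lemma regular_const X c : (forall p, X p -> P2 p) -> regular 0 X (fun=> c).
Proof.
move=> XP; have h : zhomog 0 (c *: 1 : {mpoly K[3]}).
  by apply: (@zhomogZ _ 0); apply: dhomog1.
apply: eq_regular (regular_poly XP h) => p _.
by rewrite mevalZ meval1 mulr1.
Qed.

Lemma regularD k X u v : (forall p, X p -> P2 p) ->
  regular k X u -> regular k X v -> regular k X (fun p => u p + v p).
Proof.
move=> XP ru rv; apply: regularI => // p Xp.
have [eg [eh [g [h [[hg hh] E hp Hq]]]]] := regularE XP ru Xp.
have [eg' [eh' [g' [h' [[hg' hh'] E' hp' Hq']]]]] := regularE XP rv Xp.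
exists (eg + eh')%N, (eh + eh')%N, (g * h' + g' * h), (h * h'); split.
- split; last exact: dhomogM.
  apply: dhomogD; first exact: dhomogM.
  have -> : (eg + eh' = eg' + eh)%N.
    by apply/eqP; rewrite -eqz_nat !PoszD E E'; apply/eqP; ring.
  exact: dhomogM.
- by rewrite !PoszD E; ring.
- by rewrite mevalM mulf_neq0.
- move=> q Xq; rewrite mevalM mulf_eq0 negb_or => /andP [hq hq'].
  by rewrite Hq // Hq' // mevalD !mevalM addf_div.
Qed.

Lemma regularM k l X u v : (forall p, X p -> P2 p) ->
  regular k X u -> regular l X v -> regular (k + l) X (fun p => u p * v p).
Proof.
move=> XP ru rv; apply: regularI => // p Xp.
have [eg [eh [g [h [[hg hh] E hp Hq]]]]] := regularE XP ru Xp.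
have [eg' [eh' [g' [h' [[hg' hh'] E' hp' Hq']]]]] := regularE XP rv Xp.
exists (eg + eg')%N, (eh + eh')%N, (g * g'), (h * h'); split.
- by split; apply: dhomogM.
- by rewrite !PoszD E E'; ring.
- by rewrite mevalM mulf_neq0.
- move=> q Xq; rewrite mevalM mulf_eq0 negb_or => /andP [hq hq'].
  by rewrite Hq // Hq' // !mevalM mulf_div.
Qed.

Lemma regularM_deg m k l X u v : m = k + l -> (forall p, X p -> P2 p) ->
  regular k X u -> regular l X v -> regular m X (fun p => u p * v p).
Proof. by move=> ->; apply: regularM. Qed.

Lemma regularZ k X c u : (forall p, X p -> P2 p) ->
  regular k X u -> regular k X (fun p => c * u p).
Proof.
move=> XP; apply: regularM_deg (regular_const c XP) => //; by rewrite add0r.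
Qed.

Lemma regularN k X u : (forall p, X p -> P2 p) ->
  regular k X u -> regular k X (fun p => - u p).
Proof.
move=> XP /(regularZ (-1) XP); apply: eq_regular => p _; exact: mulN1r.
Qed.

Lemma regularV k X u : (forall p, X p -> P2 p) ->
  (forall p, X p -> u p != 0) -> regular k X u ->
  regular (- k) X (fun p => (u p)^-1).
Proof.
move=> XP u0 ru; apply: regularI => // p Xp.
have [eg [eh [g [h [[hg hh] E hp Hq]]]]] := regularE XP ru Xp.
exists (eh + eh)%N, (eg + eh)%N, (h * h), (g * h); split.
- by split; apply: dhomogM.
- by rewrite !PoszD E; ring.
- rewrite mevalM mulf_neq0 //; apply: contraNneq (u0 p Xp) => g0.
  by rewrite Hq // g0 mul0r.
- move=> q Xq; rewrite mevalM mulf_eq0 negb_or => /andP [gq hq].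
  by rewrite Hq // !mevalM invf_div -mulf_div divff // mulr1.
Qed.

Lemma regular_sum k X (I : finType) (P : pred I) (F : I -> pt K -> K) :
  (forall p, X p -> P2 p) -> (forall i, P i -> regular k X (F i)) ->
  regular k X (fun p => \sum_(i | P i) F i p).
Proof.
move=> XP H.
suff [G [rG EG]] : exists G, regular k X G /\
    forall p, G p = \sum_(i | P i) F i p.
  by apply: eq_regular rG => p _.
have : forall r : seq I, exists G, regular k X G /\
    forall p, G p = \sum_(i <- r | P i) F i p.
  elim=> [|i r [G [rG EG]]].
    by exists (fun=> 0); split; [exact: regular0 | move=> p; rewrite big_nil].
  case Pi: (P i).
    exists (fun p => F i p + G p); split; first by apply: regularD => //; apply: H.
    by move=> p; rewrite big_cons Pi EG.
  by exists G; split=> // p; rewrite big_cons Pi EG.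
by move=> /(_ (index_enum I)).
Qed.

Lemma regular_prod X (I : finType) (k : I -> int) (F : I -> pt K -> K) :
  (forall p, X p -> P2 p) -> (forall i, regular (k i) X (F i)) ->
  regular (\sum_i k i) X (fun p => \prod_i F i p).
Proof.
move=> XP H.
suff : forall r : seq I, exists G, regular (\sum_(i <- r) k i) X G /\
    forall p, G p = \prod_(i <- r) F i p.
  by move=> /(_ (index_enum I)) [G [rG EG]]; apply: eq_regular rG => p _.
elim=> [|i r [G [rG EG]]].
  exists (fun=> 1); rewrite big_nil; split; first exact: regular_const.
  by move=> p; rewrite big_nil.
exists (fun p => F i p * G p); split; first by rewrite big_cons; apply: regularM.
by move=> p; rewrite big_cons EG.
Qed.

(** With row degrees [a] and column degrees [b], every term of the Leibniz expansion has the same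
    degree. *)
Lemma regular_det m X (a b : 'I_m -> int) (M : pt K -> 'M[K]_m) :
  (forall p, X p -> P2 p) ->
  (forall i j, regular (a i + b j) X (fun p => M p i j)) ->
  regular (\sum_i a i + \sum_j b j) X (fun p => \det (M p)).
Proof.
move=> XP H; apply: regular_sum => // s _.
have -> : \sum_i a i + \sum_j b j = \sum_i (a i + b (s i)).
  by rewrite big_split /= [\sum_j b j](reindex_inj (@perm_inj _ s)).
apply: regularZ => //.
exact: (@regular_prod X _ (fun i => a i + b (s i)) (fun i p => M p i (s i))).
Qed.

(** These powers trivialize O(k) on the chart of the c-th coordinate; all passages between twists go
    through them. *)
Lemma regular_coordX X (c : 'I_3) k :
  (forall p, X p -> p c != 0) -> regular k X (fun p => p c ^ k).
Proof.
move=> Xc; have XP p : X p -> P2 p by move/Xc/coord_P2.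
have rX e : regular e%:Z X (fun p => p c ^+ e).
  have h : zhomog e%:Z ('X_c ^+ e : {mpoly K[3]}) by exact: dhomogXn.
  apply: eq_regular (regular_poly XP h) => p _.
  by rewrite rmorphXn /= mevalXU.
case: k => e; first exact: rX.
by rewrite NegzE; apply: regularV => // p Xp; rewrite expf_neq0 // Xc.
Qed.

(** Identity theorem: cross-multiplying local fractions gives a polynomial identity valid on a
    nonempty open set, hence everywhere. *)
Lemma regular_dense k V u v h : zopen (@P2 K) V ->
  regular k V u -> regular k V v -> h != 0 -> 
  (forall p, V p -> h.@[p] != 0 -> u p = v p) -> forall p, V p -> u p = v p.
Proof.
move=> oV ru rv h0 E p Vp; have VP q : V q -> P2 q by apply: zopen_sub oV.
have [eg [eh [g1 [h1 [_ _ hp Hq]]]]] := regularE VP ru Vp.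
have [eg' [eh' [g2 [h2 [_ _ hp' Hq']]]]] := regularE VP rv Vp.
have h10 : h1 != 0 by apply: contraNneq hp => ->; rewrite meval0.
have h20 : h2 != 0 by apply: contraNneq hp' => ->; rewrite meval0.
have Z : g1 * h2 = g2 * h1.
  apply: (mpoly_eq_open oV Vp (mulf_neq0 (mulf_neq0 h0 h10) h20)) => q Vq.
  rewrite !mevalM !mulf_eq0 !negb_or => /andP [/andP [hq h1q] h2q].
  by have := E q Vq hq; rewrite Hq // Hq' // => /eqP; rewrite eqr_div // => /eqP.
by rewrite Hq // Hq' //; apply/eqP; rewrite eqr_div // -!mevalM Z.
Qed.

End Regular.

Section Glue.
Variable K : closedFieldType.
Implicit Types (X Y U V W : pt K -> Prop) (p q : pt K) (h : {mpoly K[3]}).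
Implicit Types (u v g : pt K -> K) (k l : int).

Definition extends k V h u := exists g, regular k V g /\
  forall p, V p -> h.@[p] != 0 -> g p = u p.

(** Local extensions agree on overlaps by density of {h <> 0}, so a value chosen independently at
    each point is automatically the value of every local extension there. *)
Lemma extends_local k V h u : zopen (@P2 K) V -> h != 0 ->
  (forall p, V p -> exists U, [/\ zopen V U, U p & extends k U h u]) ->
  extends k V h u.
Proof.
move=> oV h0 H; have VP p : V p -> P2 p by apply: zopen_sub oV.
pose loc p x := exists U g, [/\ zopen V U, U p, regular k U g,
  forall q, U q -> h.@[q] != 0 -> g q = u q & x = g p].
have locex p : V p -> exists x, loc p x.
  by move=> /H [U [oU Up [g [rg Eg]]]]; exists (g p), U, g.
pose G p := epsilon (inhabits (0 : K)) (loc p).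
have GE U g p : zopen V U -> regular k U g ->
    (forall q, U q -> h.@[q] != 0 -> g q = u q) -> U p -> G p = g p.
  move=> oU rg Eg Up.
  have : loc p (G p) by apply: epsilon_spec; apply: locex; apply: zopen_sub oU Up.
  case=> U' [g' [oU' Up' rg' Eg' ->]].
  pose W q := U q /\ U' q.
  have oW : zopen (@P2 K) W.
    apply: (zopen_trans oV); apply: (zopen_trans oU).
    by apply: (zopen_cap oU') => q; apply: zopen_sub.
  apply: (@regular_dense _ k W g' g h) => //.
  - by apply: regular_sub rg' => q [].
  - by apply: regular_sub rg => q [].
  - by move=> q [Uq Uq'] hq; rewrite Eg' // Eg.
exists G; split.
  apply: regular_local => // p /H [U [oU Up [g [rg Eg]]]].
  exists U; split=> //; apply: (eq_regular _ (rg)) => q Uq; rewrite (GE U g) //.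
move=> p Vp hp; have [U [oU Up [g [rg Eg]]]] := H p Vp.
by rewrite (GE U g) // Eg.
Qed.

End Glue.

(** * Lines and the Hartogs extension *)

(** Dehomogenized division on P^1: the H i are forms of degrees [delta i] without common zero,
    neither at a finite t nor, by the condition on the coefficient of index [delta i], at infinity.
    The quotients P i / H i all agree and are then a form of degree e. *)
Lemma common_quotient_poly (K : closedFieldType) (A : finType)
    (H P : A -> {poly K}) (delta : A -> nat) (e : int) :
  (forall i, size (H i) <= (delta i).+1)%N ->
  (forall i, P i = 0 \/ (size (P i))%:Z <= e + (delta i)%:Z + 1) ->
  (forall t, exists i, (H i).[t] != 0) ->
  (exists i, (H i)`_(delta i) != 0) ->
  (forall i j, P i * H j = P j * H i) ->
  exists q : {poly K}, (q = 0 \/ (size q)%:Z <= e + 1) /\ forall i, P i = H i * q.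
Proof.
move=> sH sP Hroot [i0 Hi0] E.
have H0 : H i0 != 0 by apply: contraNneq Hi0 => ->; rewrite coef0.
set a := P i0 %/ gcdp (P i0) (H i0); set b := H i0 %/ gcdp (P i0) (H i0).
set g := gcdp (P i0) (H i0).
have Pa : P i0 = a * g by rewrite divpK // dvdp_gcdl.
have Hb : H i0 = b * g by rewrite divpK // dvdp_gcdr.
have g0 : g != 0 by apply: contraNneq H0 => g0; rewrite Hb g0 mulr0.
have cab : coprimep b a by rewrite coprimep_sym coprimep_div_gcd // H0 orbT.
(* The reduced denominator b of P i0 / H i0 divides every H i, so a root of b would be a common
   root; hence b is constant. *)
have bH i : b %| H i.
  rewrite -(Gauss_dvdpr _ cab); apply/dvdpP; exists (P i).
  by apply: (mulIf g0); rewrite -mulrA [H i * g]mulrC mulrA -Pa E Hb mulrA.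
have : ~~ (size b != 1).
  apply/closed_rootP => -[t bt]; have [i /eqP []] := Hroot t.
  by have /dvdpP [q ->] := bH i; rewrite hornerM (rootP bt) mulr0.
rewrite negbK => /size_poly1P [c c0 Eb].
exists (c^-1 *: a).
have EP i : P i = H i * (c^-1 *: a).
  apply: (mulIf H0); rewrite E Hb Pa Eb -scalerAr -!mul_polyC.
  have -> : a * g * H i = (c%:P * c^-1%:P) * (a * g * H i).
    by rewrite -polyCM divff // mul1r.
  ring.
split=> //; case: (eqVneq (c^-1 *: a) 0) => [|q0]; [by left | right].
have := sP i0; rewrite EP => -[/eqP|].
  by rewrite mulf_eq0 (negPf q0) (negPf H0).
(* At i0 the degree is attained exactly, which turns the bound on P i0 into the bound on the
   quotient. *)
rewrite size_mul //; have sHi : size (H i0) = (delta i0).+1.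
  by apply/eqP; rewrite eqn_leq sH ltnNge; apply: contraNN Hi0 => /leq_sizeP ->.
have ar (n d : nat) :
    (0 < n)%N -> ((d.+1 + n).-1)%:Z <= e + d%:Z + 1 -> n%:Z <= e + 1 by lia.
by move: (q0); rewrite sHi -size_poly_gt0; apply: ar.
Qed.

Lemma pihomogM (K : comNzRingType) n (f c : {mpoly K[n]}) d m :
  f \is d.-homog ->
  pihomog mdeg m (f * c) = if (d <= m)%N then f * pihomog mdeg (m - d) c else 0.
Proof.
move=> fd; rewrite {1}(pihomog_partitionE (leqnn (mmeasure mdeg c))).
rewrite big_distrr /= raddf_sum /=.
have T k : pihomog mdeg m (f * pihomog mdeg k c) =
    if (d + k == m)%N then f * pihomog mdeg k c else 0.
  have h : f * pihomog mdeg k c \is (d + k).-homog.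
    by apply: dhomogM fd _; apply: pihomogP.
  case: eqP => [<-|/eqP N]; first by rewrite pihomog_dE.
  by rewrite (pihomog_ne0 N h).
under eq_bigr do rewrite T; rewrite -big_mkcond /=.
case: leqP => dm; last by rewrite big1 // => i /eqP; lia.
rewrite [pihomog mdeg (m - d) c](_ : _ =
  \sum_(i < mmeasure mdeg c | (d + i == m)%N) pihomog mdeg i c) ?big_distrr //.
transitivity (pihomog mdeg (m - d) (\sum_(i < mmeasure mdeg c) pihomog mdeg i c)).
  by congr pihomog; apply: pihomog_partitionE.
rewrite raddf_sum /= [RHS]big_mkcond.
apply: eq_bigr => i _; case: eqP => [<-|/eqP N].
  by rewrite addKn pihomog_id.
rewrite (pihomog_ne0 (d := i)) //; last exact: pihomogP.
by apply: contra N => /eqP ->; rewrite subnKC.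
Qed.

Lemma mpoly_alg_ind (K : comNzRingType) n (D : {mpoly K[n]} -> Prop) :
  D 0 -> (forall x y, D x -> D y -> D (x + y)) ->
  (forall x y, D x -> D y -> D (x * y)) ->
  (forall c, D c%:MP) -> (forall i, D 'X_i) -> forall g, D g.
Proof.
move=> D0 DD DM DC DX; elim/mpolyind => // k m g _ _ Dg.
apply: DD Dg; rewrite -mul_mpolyC; apply: (DM) => //; rewrite mpolyXE_id.
elim/big_ind: _ => [||i _]; [exact: (DC 1) | exact: DM |].
elim: (m i) => [|l IH]; first exact: (DC 1).
by rewrite exprS; apply: DM.
Qed.

Lemma horner_mmap (K : comNzRingType) n (h : 'I_n -> {poly K})
    (g : {mpoly K[n]}) t :
  (mmap polyC h g).[t] = g.@[fun k => (h k).[t]].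
Proof.
rewrite /mmap mevalE horner_sum; apply: eq_bigr => m _.
rewrite hornerM hornerC /mmap1 horner_prod; congr (_ * _).
by apply: eq_bigr => i _; rewrite horner_exp.
Qed.

Lemma meval_mmap (K : comNzRingType) n m (h : 'I_n -> {mpoly K[m]})
    (g : {mpoly K[n]}) v :
  (mmap (@mpolyC m K) h g).@[v] = g.@[fun k => (h k).@[v]].
Proof.
rewrite [RHS]mevalE [mmap _ _ g]/mmap raddf_sum; apply: eq_bigr => x _ /=.
rewrite mevalM mevalC /mmap1 rmorph_prod; congr (_ * _).
by apply: eq_bigr => i _; rewrite rmorphXn.
Qed.

Section Line.
Variables (K : closedFieldType) (a : pt K) (c : 'I_3).
Hypothesis ac : a c != 0.
Implicit Types (p q : pt K) (g h : {mpoly K[3]}).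

Let i0 := lift c (0 : 'I_2).
Let i1 := lift c (1 : 'I_2).

(* The line is parametrized by its coordinates other than c. *)
Definition lcoord (S : lmodType K) (x y : S) (k : 'I_3) : S :=
  if unlift c k is Some m then if m == 0 :> 'I_2 then x else y
  else - (a i0 / a c) *: x - (a i1 / a c) *: y.

Definition lpt (s t : K) : pt K := [ffun k => @lcoord K^o s t k].

Definition lrestr : {rmorphism {mpoly K[3]} -> {poly K}} :=
  mmap polyC (lcoord 1 'X).

Lemma lcoord_i0 (S : lmodType K) (x y : S) : lcoord x y i0 = x.
Proof. by rewrite /lcoord liftK. Qed.

Lemma lcoord_i1 (S : lmodType K) (x y : S) : lcoord x y i1 = y.
Proof. by rewrite /lcoord liftK. Qed.

Lemma lcoord_c (S : lmodType K) (x y : S) :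
  lcoord x y c = - (a i0 / a c) *: x - (a i1 / a c) *: y.
Proof. by rewrite /lcoord unlift_none. Qed.

Lemma i01P k : [\/ k = c, k = i0 | k = i1].
Proof.
case: (unliftP c k) => [m|] ->; last by constructor 1.
case: m => [[|[|//]] Hm]; [constructor 2 | constructor 3];
  by congr lift; apply: val_inj.
Qed.

Lemma linform_eval p : (linform a).@[p] = a c * p c + a i0 * p i0 + a i1 * p i1.
Proof.
rewrite /linform raddf_sum /= (eq_bigr (fun i => a i * p i)); last first.
  by move=> i _; rewrite mevalZ mevalXU.
rewrite (bigD1_ord c) //= 2!big_ord_recl big_ord0 addr0 addrA.
by congr (_ + _ * _ + a _ * p _); congr lift; apply: val_inj.
Qed.

Lemma linformE : linform a = a c *: 'X_c + a i0 *: 'X_i0 + a i1 *: 'X_i1.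
Proof.
rewrite /linform (bigD1_ord c) //= 2!big_ord_recl big_ord0 addr0 addrA.
by congr (_ + _ *: _ + a _ *: 'X_ _); congr lift; apply: val_inj.
Qed.

Lemma linform_neq0 : linform a != 0.
Proof.
have : (linform a).@[fun k => (k == c)%:R] != 0.
  rewrite linformE !mevalD !mevalZ !mevalXU eqxx.
  by rewrite ![_ == c]eq_sym !(negPf (neq_lift _ _)) !mulr0 !addr0 mulr1.
by apply: contraNneq => ->; rewrite meval0.
Qed.

Lemma lpt_line s t : (s != 0) || (t != 0) -> line a (lpt s t).
Proof.
move=> st; split.
  case/orP: st => ?; [apply: (@coord_P2 _ _ i0) | apply: (@coord_P2 _ _ i1)];
    by rewrite ffunE ?lcoord_i0 ?lcoord_i1.
rewrite linform_eval !ffunE lcoord_i0 lcoord_i1 lcoord_c /GRing.scale /=.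
by field.
Qed.

Lemma line_lpt p : line a p -> p = lpt (p i0) (p i1).
Proof.
case=> _; rewrite linform_eval => E; apply/ffunP => k; rewrite ffunE.
case: (i01P k) => ->; rewrite ?lcoord_i0 ?lcoord_i1 //.
rewrite lcoord_c /GRing.scale /=; apply: (mulfI ac).
have -> : a c * p c = - (a i0 * p i0 + a i1 * p i1).
  by apply/eqP; rewrite -subr_eq0 opprK addrA E.
by field.
Qed.

Lemma lrestr_eval g t : (lrestr g).[t] = g.@[lpt 1 t].
Proof.
rewrite horner_mmap; apply: meval_eq => k; rewrite ffunE.
case: (i01P k) => ->; rewrite ?lcoord_i0 ?lcoord_i1 ?hornerC ?hornerX //.
by rewrite !lcoord_c !hornerE /GRing.scale /= !mulr1.
Qed.

(** In the coordinate t of the points [lpt 1 t] the point [lpt 0 1] lies at infinity; the value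
    there survives as the coefficient of t^e. The predicate Q is multiplicative, so only the three
    coordinates need checking. *)
Lemma lrestr_size_coef e g : g \is e.-homog ->
  (size (lrestr g) <= e.+1)%N /\ (lrestr g)`_e = g.@[lpt 0 1].
Proof.
pose Q e (p : {poly K}) x := (size p <= e.+1)%N /\ p`_e = x.
have QM (d e' : nat) (p q : {poly K}) (x y : K) :
    Q d p x -> Q e' q y -> Q (d + e')%N (p * q) (x * y).
  case=> sp <- [sq <-]; split.
    by apply: leq_trans (size_polyMleq _ _) _; lia.
  rewrite coefM; have hd : (d < (d + e').+1)%N by lia.
  rewrite (bigD1 (Ordinal hd)) //= addKn big1 ?addr0 // => k nk.
  have {}nk : (k : nat) != d by apply: contraNneq nk => E; apply/eqP/val_inj.
  case: (ltnP k d) => kd.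
    by rewrite [q`__]nth_default ?mulr0 //; apply: leq_trans sq _; lia.
  by rewrite [p`__]nth_default ?mul0r //; apply: leq_trans sp _; lia.
have Q1 : Q 0%N 1 1 by split; rewrite ?size_poly1 // coef1.
have QX (d : nat) (p : {poly K}) (x : K) (m : nat) : Q d p x -> Q (m * d)%N (p ^+ m) (x ^+ m).
  move=> H; elim: m => [|m IH]; first exact: Q1.
  by rewrite !exprS mulSn; apply: QM.
have Qk k : Q 1%N (lcoord 1 'X k) (lpt 0 1 k).
  rewrite ffunE; case: (i01P k) => ->; rewrite ?lcoord_i0 ?lcoord_i1.
  - rewrite !lcoord_c /GRing.scale /= mulr0 mulr1 add0r; split.
      apply: leq_trans (size_polyD _ _) _; rewrite geq_max size_polyN.
      by rewrite !(leq_trans (size_scale_leq _ _)) ?size_poly1 ?size_polyX.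
    by rewrite coefB !coefZ coef1 coefX mulr0 mulr1 add0r.
  - by split; rewrite ?size_poly1 // coef1.
  - by split; rewrite ?size_polyX // coefX.
move=> /dhomogP gh; rewrite /lrestr /mmap mevalE.
suff : Q e (\sum_(m <- msupp g) (g@_m)%:P * mmap1 (lcoord 1 'X) m)
           (\sum_(m <- msupp g) g@_m * \prod_(i < 3) lpt 0 1 i ^+ m i) by [].
rewrite !big_seq; elim/big_rec2: _ => [|m x p /gh <- [sp ep]].
  by split; rewrite ?size_poly0 // coef0.
suff [s1 e1] : Q (mdeg m) (mmap1 (lcoord 1 'X) m) (\prod_(i < 3) lpt 0 1 i ^+ m i).
  split; last by rewrite coefD coefCM e1 ep.
  apply: leq_trans (size_polyD _ _) _; rewrite geq_max sp andbT.
  by rewrite mul_polyC (leq_trans (size_scale_leq _ _)).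
rewrite mdegE /mmap1.
elim/big_rec3: _ => // i y p' d _ Qd.
by apply: QM => //; rewrite -[X in Q X _ _]muln1; apply: QX.
Qed.

Lemma lrestr_lift (G : {poly K}) e : (size G <= e.+1)%N ->
  exists2 g, g \is e.-homog & lrestr g = G.
Proof.
move=> sG; exists (\sum_(k < e.+1) G`_k *: ('X_i0 ^+ (e - k) * 'X_i1 ^+ k)).
  apply: rpred_sum => k _; apply: dhomogZ.
  have := dhomogM (dhomogXn K i0 (e - k)) (dhomogXn K i1 k).
  by rewrite subnK // -ltnS.
rewrite raddf_sum /= [RHS](_ : _ = \poly_(k < e.+1) G`_k); last first.
  apply/polyP => k; rewrite coef_poly; case: ltnP => // ek.
  by rewrite nth_default //; apply: leq_trans ek.
rewrite poly_def; apply: eq_bigr => k _.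
rewrite /lrestr mmapZ rmorphM !rmorphXn /= -/(lrestr 'X_i0) -/(lrestr 'X_i1).
rewrite /lrestr !mmapX !mmap1U lcoord_i0 lcoord_i1.
by rewrite expr1n mul1r mul_polyC.
Qed.

Lemma lrestr_liftz (G : {poly K}) k : G = 0 \/ (size G)%:Z <= k + 1 ->
  exists2 g, zhomog k g & lrestr g = G.
Proof.
case=> [->|]; first by exists 0; [exact: zhomog0 | rewrite rmorph0].
case: k => e H; first by apply: lrestr_lift; lia.
exists 0; first exact: zhomog0.
by rewrite rmorph0; apply/esym/eqP; rewrite -size_poly_eq0; lia.
Qed.

Lemma lrestr_sizez k g : zhomog k g ->
  lrestr g = 0 \/ (size (lrestr g))%:Z <= k + 1.
Proof.
case: k => e H; last by left; rewrite [g]H rmorph0.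
by right; have [] := lrestr_size_coef H; lia.
Qed.

(** Substituting the parametrization of the line is the identity modulo its equation. This property
    passes to sums and products, so it is checked on generators and no division algorithm is
    used. *)
Lemma dvd_linform_sub g : exists g',
  g - mmap (@mpolyC 3 K) (lcoord 'X_i0 'X_i1) g = linform a * g'.
Proof.
pose sg : {rmorphism {mpoly K[3]} -> {mpoly K[3]}} :=
  mmap (@mpolyC 3 K) (lcoord 'X_i0 'X_i1).
change (exists g', g - sg g = linform a * g').
elim/mpoly_alg_ind: g => [|x y [x' Ex] [y' Ey]|x y [x' Ex] [y' Ey]|k|k].
- by exists 0; rewrite rmorph0 subrr mulr0.
- by exists (x' + y'); rewrite rmorphD mulrDr -Ex -Ey; ring.
- exists (x' * y + sg x * y').
  rewrite rmorphM mulrDr mulrA -Ex.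
  rewrite [sg x * y']mulrC mulrA -Ey; ring.
- by exists 0; rewrite [sg _]mmapC subrr mulr0.
rewrite [sg _]mmapX mmap1U.
case: (i01P k) => ->; rewrite ?lcoord_i0 ?lcoord_i1.
- exists ((a c)^-1%:MP); rewrite lcoord_c linformE [RHS]mulrC mul_mpolyC.
  rewrite !scalerDr !scalerA mulVf // scale1r ![(a c)^-1 * _]mulrC.
  by rewrite opprB scaleNr opprK [_ *: 'X_i1 + _]addrC addrA.
- by exists 0; rewrite subrr mulr0.
- by exists 0; rewrite subrr mulr0.
Qed.

Lemma lrestr_eq0 k g : zhomog k g -> lrestr g = 0 ->
  exists2 g', zhomog (k - 1) g' & g = linform a * g'.
Proof.
case: k => [e|e] gh r0; last first.
  by exists 0; [exact: zhomog0 | rewrite [g]gh mulr0].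
set sg := mmap (@mpolyC 3 K) (lcoord 'X_i0 'X_i1) g.
(* The factor ['X_i0] restricts evaluation to points whose image on the line is a multiple of some
   [lpt 1 t], where the vanishing of [lrestr g] applies. *)
have sg0 : 'X_i0 * sg = 0.
  apply/eqP; apply: contraT => /mpoly_neq0_eval [p].
  rewrite mevalM mevalXU mulf_eq0 negb_or => /andP [p0] /eqP []; rewrite meval_mmap.
  have -> : g.@[fun k => (lcoord 'X_i0 'X_i1 k).@[p]] =
      g.@[fun k => p i0 * lpt 1 (p i1 / p i0) k].
    apply: meval_eq => k; rewrite ffunE.
    case: (i01P k) => ->; rewrite ?lcoord_i0 ?lcoord_i1 ?mevalXU ?mulr1 //.
      rewrite !lcoord_c mevalB !mevalZ !mevalXU /GRing.scale /=; field.
      by rewrite p0 ac.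
    by rewrite mulrC divfK.
  by rewrite (meval_dhomog_scale _ _ gh) -lrestr_eval r0 horner0 mulr0.
have {}sg0 : sg = 0.
  by move/eqP: sg0; rewrite mulf_eq0 (negPf (mpolyX_neq0 K _)) => /eqP.
have [g' E] := dvd_linform_sub g; rewrite -/sg sg0 subr0 in E.
(* The cofactor g' need not be homogeneous; its component of degree e - 1 is taken instead. *)
have lh := linform_homog a.
have := @pihomogM _ _ _ g' _ e lh; rewrite -E pihomog_dE //.
case: e gh => [|e] gh Eg; rewrite /= in Eg; first by exists 0; [exact: zhomog0 | rewrite mulr0].
rewrite subn1 /= in Eg; exists (pihomog mdeg e g') => //.
rewrite (_ : e.+1%:Z - 1 = e); last by lia.
exact: pihomogP.
Qed.

Lemma line_lrestr k g : zhomog k g ->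
  (lrestr g = 0 <-> forall p, line a p -> g.@[p] = 0).
Proof.
move=> gh; split=> [/(lrestr_eq0 gh) [g' _ ->] p [_ lp]|H].
  by rewrite mevalM lp mul0r.
apply/eqP; apply: contraT => /closed_nonrootP [t] /eqP [].
by rewrite lrestr_eval H //; apply: lpt_line; rewrite oner_eq0.
Qed.

(* Homogeneous polynomials without common zero on a line generate an ideal of
   depth at least two; the induction divides by the equation of the line. *)
Lemma common_quotient_line (A : finType) (h P : A -> {mpoly K[3]})
    (delta : A -> nat) (e : int) :
  (forall i, h i \is (delta i).-homog) ->
  (forall i, zhomog (e + (delta i)%:Z) (P i)) ->
  (forall p, line a p -> exists i, (h i).@[p] != 0) ->
  (forall i j, P i * h j = P j * h i) ->
  exists2 w, zhomog e w & forall i, P i = h i * w.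
Proof.
move=> hh hP hz.
(* Measure of the descent: once every e + delta i is negative, all P i are zero. *)
have [N] : exists N : nat, e + (\max_i delta i)%:Z < N%:Z.
  by exists (absz (e + (\max_i delta i)%:Z)).+1; lia.
elim: N e P hP => [|N IH] e P hP eN E.
  exists 0; first exact: zhomog0.
  move=> i; rewrite mulr0; have := hP i.
  have : e + (delta i)%:Z < 0.
    have := leq_bigmax (F := delta) i; move: (\max_i _) eN => M; lia.
  by case: (e + _).
have [|||||q [sq Eq]] := @common_quotient_poly K A (fun i => lrestr (h i))
    (fun i => lrestr (P i)) delta e.
- by move=> i; case: (lrestr_size_coef (hh i)).
- by move=> i; apply: lrestr_sizez.
- move=> t; have [|i hi] := hz (lpt 1 t); first by apply: lpt_line; rewrite oner_eq0.
  by exists i; rewrite lrestr_eval.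
- have [|i hi] := hz (lpt 0 1); first by apply: lpt_line; rewrite oner_eq0 orbT.
  by exists i; have [_ ->] := lrestr_size_coef (hh i).
- by move=> i j; rewrite -!rmorphM E.
have [w0 hw0 Ew0] := lrestr_liftz sq.
(* After subtraction of a lift w0 of the quotient on the line, the family is divisible by the
   equation of the line; the cofactors satisfy the same cross relations with e lowered by one. *)
have D i : exists P', zhomog (e + (delta i)%:Z - 1) P' /\
    P i - h i * w0 = linform a * P'.
  have [||P' hP' EP'] := @lrestr_eq0 (e + (delta i)%:Z) (P i - h i * w0).
  - apply: zhomogD => //; apply: zhomogN; rewrite addrC.
    by apply: zhomogM => //; apply: hh.
  - by rewrite rmorphB rmorphM /= Ew0 Eq subrr.
  - by exists P'.
have [P' HP'] : exists P', forall i, zhomog (e + (delta i)%:Z - 1) (P' i) /\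
    P i - h i * w0 = linform a * P' i.
  exists (fun i => epsilon (inhabits 0) (fun P' => zhomog (e + (delta i)%:Z - 1) P' /\
    P i - h i * w0 = linform a * P')) => i.
  exact: epsilon_spec (D i).
have [|||w hw Ew] := IH (e - 1) P'.
- by move=> i; have [H _] := HP' i; rewrite addrAC.
- by lia.
- move=> i j; apply: (mulfI linform_neq0); rewrite !mulrA.
  have [_ <-] := HP' i; have [_ <-] := HP' j.
  by rewrite !mulrBl E; congr (_ - _); ring.
exists (w0 + linform a * w).
  apply: zhomogD => //; have -> : e = 1 + (e - 1) by lia.
  by apply: zhomogM => //; apply: linform_homog.
move=> i; have [_ H] := HP' i; move/eqP: H; rewrite subr_eq => /eqP ->.
by rewrite Ew; ring.
Qed.

End Line.

Lemma dhomog_bigprod (K : closedFieldType) (A : finType) (P : pred A)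
    (Q : A -> {mpoly K[3]}) (d : A -> nat) :
  (forall i, P i -> Q i \is (d i).-homog) ->
  \prod_(i | P i) Q i \is (\sum_(i | P i) d i)%N.-homog.
Proof.
move=> H; elim/big_rec2: _ => [|i e q Pi hq]; first exact: dhomog1.
by apply: dhomogM => //; apply: H.
Qed.

Definition nozero_on_line (K : closedFieldType) (A : finType)
    (h : A -> {mpoly K[3]}) : Prop :=
  exists2 a : pt K, P2 a & forall p, line a p -> exists i, (h i).@[p] != 0.

(* Hartogs: a quotient u i / h i extends across the common zeros of the h i,
   which have codimension two. *)
Lemma extends_quotient (K : closedFieldType) (A : finType)
    (h : A -> {mpoly K[3]}) (delta : A -> nat) (e : int) (V : pt K -> Prop)
    (u : A -> pt K -> K) (hD : {mpoly K[3]}) (g0 : pt K -> K) :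
  zopen (@P2 K) V -> hD != 0 ->
  (forall i, h i \is (delta i).-homog) -> nozero_on_line h ->
  (forall i, regular (e + (delta i)%:Z) V (u i)) ->
  (forall i p, V p -> hD.@[p] != 0 -> u i p = (h i).@[p] * g0 p) ->
  (forall p, V p -> hD.@[p] != 0 -> exists i, (h i).@[p] != 0) ->
  extends e V hD g0.
Proof.
move=> oV hD0 hh [a a0 hz] ru Eu hnz.
have [c ac] := P2_coord a0.
have VP p : V p -> P2 p by apply: zopen_sub oV.
apply: extends_local => // p Vp.
have [eP /fin_all_exists [eQ /fin_all_exists [P /fin_all_exists [Q HPQ]]]] :=
  fin_all_exists (fun i => regularE VP (ru i) Vp).
(* A common denominator near p: u i = PP i / QQ. *)
pose QQ := \prod_i Q i; pose eQQ := (\sum_i eQ i)%N.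
pose PP i := P i * \prod_(j | j != i) Q j.
have hQQ : QQ \is eQQ.-homog.
  by apply: dhomog_bigprod => i _; case: (HPQ i) => -[].
have oU : zopen V (chart V QQ) by apply: zopen_chart hQQ.
have QQp : QQ.@[p] != 0.
  by rewrite rmorph_prod; apply/prodf_neq0 => i _; case: (HPQ i).
have hPP i : zhomog (eQQ%:Z + e + (delta i)%:Z) (PP i).
  have [[hP hQ] E _ _] := HPQ i.
  have -> : eQQ%:Z + e + (delta i)%:Z =
      (eP i + \sum_(j | j != i) eQ j)%N%:Z.
    by rewrite /eQQ (bigD1 i) //= !PoszD E; ring.
  by apply: dhomogM => //; apply: dhomog_bigprod => j _; case: (HPQ j) => -[].
have EQ i : QQ = Q i * \prod_(j | j != i) Q j by rewrite /QQ (bigD1 i).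
have Euq i q : V q -> QQ.@[q] != 0 -> u i q = (PP i).@[q] / QQ.@[q].
  have [_ _ _ Eq] := HPQ i; move=> Vq; rewrite (EQ i) !mevalM mulf_eq0 negb_or.
  case/andP=> Qq Rq; rewrite Eq //; field.
  by rewrite Qq Rq.
have cross i j : PP i * h j = PP j * h i.
  apply: (mpoly_eq_open (zopen_trans oV oU) (conj Vp QQp) hD0) => q [Vq QQq] hq.
  have F k : (PP k).@[q] = (h k).@[q] * g0 q * QQ.@[q].
    by rewrite -Eu // Euq // divfK.
  by rewrite (mevalM _ (PP i)) (mevalM _ (PP j)) !F; ring.
have [w hw Ew] := common_quotient_line ac hh hPP hz cross.
exists (chart V QQ); split=> //.
exists (fun q => w.@[q] * (QQ.@[q])^-1); split.
  have UP q : chart V QQ q -> P2 q by case=> /VP.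
  have EE : e = (eQQ%:Z + e) + - eQQ%:Z by ring.
  apply: (regularM_deg EE UP); first exact: regular_poly.
  by apply: regularV => // [q []//|]; apply: regular_poly.
move=> q [Vq QQq] hq; have [i hi] := hnz q Vq hq.
apply: (mulfI hi); rewrite -Eu // Euq // Ew mevalM; ring.
Qed.

(** * Rank and degree of a framed subsheaf *)

Definition upd (S : Type) (r : nat) (s : 'I_r -> S) (i : 'I_r) (x : S) :=
  fun j : 'I_r => if j == i then x else s j.

(** * Alternating maps in coordinates *)

Section AlternatingDet.
Variables (K : fieldType) (S : Type) (sec : S -> Prop) (r : nat).
Variables (c : S -> 'I_r -> K) (b : 'I_r -> S).
Implicit Types (s : 'I_r -> S) (f g : ('I_r -> S) -> K).
Hypothesis sec_b : forall j, sec (b j).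
Hypothesis c_b : forall j k, c (b j) k = (k == j)%:R.
Hypothesis c_sum : forall i j, exists2 x, sec x &
  forall k, c x k = (k == i)%:R + (k == j)%:R.

Definition slot_expand f := forall s i x, (forall j, sec (s j)) -> sec x ->
  f (upd s i x) = \sum_j c x j * f (upd s i (b j)).

Definition slot_alternate f := forall s i j,
  (forall j, sec (s j)) -> i != j -> s i = s j -> f s = 0.

Lemma updE s i : upd s i (s i) = s.
Proof. by apply: functional_extensionality => j; rewrite /upd; case: eqP => [->|]. Qed.

Lemma sec_upd s i x : (forall j, sec (s j)) -> sec x -> forall j, sec (upd s i x j).
Proof. by move=> Hs Hx j; rewrite /upd; case: eqP. Qed.

Lemma updC s i j x y : i != j -> upd (upd s i x) j y = upd (upd s j y) i x.
Proof.
move=> ij; apply: functional_extensionality => k; rewrite /upd.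
by case: (eqVneq k j) => [->|//]; rewrite eq_sym (negPf ij).
Qed.

(** Polarization: the element x with the coordinates of b u + b v is placed in both slots, where f
    vanishes, and both slots are expanded. As [sec] is a bare predicate, [c_sum] supplies this
    sum. *)
Lemma slot_swap f s u v (i j : 'I_r) : slot_expand f -> slot_alternate f ->
  (forall k, sec (s k)) -> i != j ->
  f (upd (upd s i (b v)) j (b u)) = - f (upd (upd s i (b u)) j (b v)).
Proof.
move=> fE fA Hs ij; have [x Hx cx] := c_sum u v.
have sumE (F : 'I_r -> K) : \sum_k c x k * F k = F u + F v.
  rewrite (eq_bigr (fun k => (k == u)%:R * F k + (k == v)%:R * F k)); last first.
    by move=> k _; rewrite cx mulrDl.
  rewrite big_split /= (bigD1 u) //= eqxx mul1r big1 ?addr0; last first.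
    by move=> k /negPf ->; rewrite mul0r.
  rewrite (bigD1 v) //= eqxx mul1r big1 ?addr0 //.
  by move=> k /negPf ->; rewrite mul0r.
have Z y : sec y -> f (upd (upd s i y) j y) = 0.
  move=> Hy; apply: (fA _ i j) => //; first by do 2! apply: sec_upd => //.
  by rewrite /upd !eqxx (negPf ij).
have E := Z x Hx; rewrite fE // in E; last exact: sec_upd.
rewrite sumE !(updC _ _ _ ij) !fE ?sumE // in E; try exact: sec_upd.
rewrite -!(updC _ _ _ ij) !Z // add0r addr0 in E.
by apply/eqP; rewrite -addr_eq0 ?E // addrC E.
Qed.

Lemma slot_alternate_eq0 f : slot_expand f -> slot_alternate f -> f b = 0 ->
  forall s, (forall j, sec (s j)) -> f s = 0.
Proof.
move=> fE fA fb.
have fperm (sg : 'S_r) : f (fun i => b (sg i)) = 0.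
  have [ts -> _] := prod_tpermP sg.
  elim: ts => [|[i j] ts IH] /=.
    rewrite big_nil (_ : (fun _ => _) = b) //.
    by apply: functional_extensionality => i; rewrite perm1.
  rewrite big_cons /=; set sg' := \big[_/_]_(_ <- _) _ in IH *.
  case: (eqVneq i j) => [->|ij].
    rewrite (_ : (fun _ => _) = (fun i => b (sg' i))) //.
    by apply: functional_extensionality => k; rewrite permM tperm1 perm1.
  pose s' k := b (sg' k).
  have -> : (fun k => b ((tperm i j * sg')%g k)) =
      upd (upd s' i (b (sg' j))) j (b (sg' i)).
    apply: functional_extensionality => k; rewrite permM /upd /s'.
    case: (eqVneq k j) => [->|kj]; first by rewrite tpermR.
    case: (eqVneq k i) => [->|ki]; first by rewrite tpermL.
    by rewrite tpermD // eq_sym.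
  rewrite slot_swap //; last by move=> k; exact: sec_b.
  by rewrite [upd s' i _](updE s' i) [upd s' j _](updE s' j) IH oppr0.
have fmap (p : 'I_r -> 'I_r) : f (fun i => b (p i)) = 0.
  case: (boolP (injectiveb (finfun p))) => [/injectiveP ip|].
    have ip' : injective p by move=> x y E; apply: ip; rewrite !ffunE.
    rewrite -(fperm (perm ip')); congr f.
    by apply: functional_extensionality => i; rewrite permE.
  case/injectivePn => i [j ji]; rewrite !ffunE => E.
  by apply: (fA _ i j) => //; rewrite 1?eq_sym ?E.
(* Slots are expanded one at a time: those of index at least k already hold basis elements. *)
suff H k : forall s, (forall j, sec (s j)) ->
    (forall i : 'I_r, (k <= i)%N -> exists p, s i = b p) -> f s = 0.
  move=> s Hs; apply: (H r) => // i; by rewrite leqNgt ltn_ord.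
elim: k => [|k IH] s Hs Hk.
  have [p Ep] := fin_all_exists (fun i => Hk i isT).
  by rewrite (_ : s = fun i => b (p i)) //; apply: functional_extensionality.
case: (ltnP k r) => kr; last first.
  by apply: IH => // i ki; have := ltn_ord i; lia.
pose i := Ordinal kr; rewrite -(updE s i) fE // big1 // => j _.
rewrite IH ?mulr0 //; first exact: sec_upd.
move=> l kl; rewrite /upd; case: (eqVneq l i) => [_|li]; first by exists j.
by apply: Hk; rewrite ltn_neqAle kl andbT eq_sym; apply: contra li => /eqP E; apply/eqP/val_inj.
Qed.

(** The difference of the two sides is again alternating and expands in each slot, and it vanishes
    on the basis, hence everywhere. *)
Lemma alternating_det f s : slot_expand f -> slot_alternate f ->
  (forall j, sec (s j)) -> f s = \det (\matrix_(i, j) c (s i) j) * f b.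
Proof.
move=> fE fA Hs; apply/eqP; rewrite -subr_eq0; apply/eqP.
pose M s : 'M[K]_r := \matrix_(i, j) c (s i) j.
apply: (@slot_alternate_eq0 (fun s => f s - \det (M s) * f b)) => //.
- move=> s' i x Hs' Hx; rewrite fE //.
  under [RHS]eq_bigr do rewrite mulrBr mulrA.
  rewrite sumrB -mulr_suml; congr (_ - _ * _).
  have cof y j : cofactor (M (upd s' i y)) i j = cofactor (M (upd s' i x)) i j.
    rewrite /cofactor; congr (_ * \det _); apply/matrixP => k l.
    by rewrite !mxE /upd eq_sym !(negPf (neq_lift _ _)).
  have Mi y j : M (upd s' i y) i j = c y j by rewrite mxE /upd eqxx.
  rewrite (expand_det_row _ i); apply: eq_bigr => j _; rewrite Mi; congr (_ * _).
  rewrite (expand_det_row _ i) (bigD1 j) //= Mi c_b eqxx mul1r.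
  by rewrite cof big1 ?addr0 // => k kj; rewrite Mi c_b (negPf kj) mul0r.
- move=> s' i j Hs' ij Eij; rewrite (fA _ i j) // sub0r.
  rewrite (determinant_alternate ij) ?mul0r ?oppr0 //.
  by move=> k; rewrite !mxE Eij.
- rewrite (_ : M b = 1%:M) ?det1 ?mul1r ?subrr //.
  by apply/matrixP => i j; rewrite !mxE c_b eq_sym.
Qed.

End AlternatingDet.

Lemma det_scale_rows (K : comNzRingType) r (x : 'I_r -> K) (M : 'M[K]_r) :
  \det (\matrix_(i, j) (x i * M i j)) = \prod_i x i * \det M.
Proof.
rewrite -[\prod_i x i](_ : \det (diag_mx (\row_i x i)) = _); last first.
  by rewrite det_diag; apply: eq_bigr => i _; rewrite mxE.
rewrite -det_mulmx; congr (\det _); apply/matrixP => i j.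
by rewrite mul_diag_mx !mxE.
Qed.

Lemma det_scale_cols (K : comNzRingType) r (y : 'I_r -> K) (M : 'M[K]_r) :
  \det (\matrix_(i, j) (M i j * y j)) = \det M * \prod_j y j.
Proof.
rewrite -det_tr mulrC -[\det M]det_tr -det_scale_rows; congr (\det _).
by apply/matrixP => i j; rewrite !mxE mulrC.
Qed.

Section Coords.
Variables (K : fieldType) (n r : nat).

(** The pseudo-inverse gives the true coordinates when B is row free and x lies in its row space; it
    is linear in x in all cases, so linearity carries no side condition. *)
Definition fcoord (B : 'M[K]_(r, n)) (x : 'rV[K]_n) (j : 'I_r) : K :=
  (x *m pinvmx B) 0 j.

Lemma fcoordD B x y j : fcoord B (x + y) j = fcoord B x j + fcoord B y j.
Proof. by rewrite /fcoord mulmxDl mxE. Qed.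

Lemma fcoordZ B c x j : fcoord B (c *: x) j = c * fcoord B x j.
Proof. by rewrite /fcoord -scalemxAl mxE. Qed.

Lemma fcoord_row B i j : row_free B -> fcoord B (row i B) j = (i == j)%:R.
Proof. by move=> fB; rewrite /fcoord -row_mul mulmxVp // !mxE. Qed.

Lemma fcoordK B x : (x <= B)%MS -> \sum_j fcoord B x j *: row j B = x.
Proof.
move=> xB; rewrite -[RHS](mulmxKpV xB) mulmx_sum_row.
by apply: eq_bigr.
Qed.

Lemma fcoord_sum B (y : 'I_r -> K) j : row_free B ->
  fcoord B (\sum_i y i *: row i B) j = y j.
Proof.
move=> fB; rewrite /fcoord mulmx_suml summxE (bigD1 j) //= big1 ?addr0.
  by rewrite -[_ 0 j]/(fcoord B (y j *: row j B) j) fcoordZ fcoord_row // eqxx mulr1.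
move=> i /negPf ij; rewrite -[_ 0 j]/(fcoord B (y i *: row i B) j).
by rewrite fcoordZ fcoord_row // ij mulr0.
Qed.

End Coords.

(** Its determinant is the coordinate of s_1 /\ ... /\ s_r in the frame B. *)
Definition stack (K : closedFieldType) n r (B : pt K -> 'M[K]_(r, n))
    (s : 'I_r -> pt K -> 'rV[K]_n) (p : pt K) : 'M[K]_r :=
  \matrix_(i, j) fcoord (B p) (s i p) j.

Record row_subsheaf (K : closedFieldType) n
    (F : (pt K -> Prop) -> (pt K -> 'rV[K]_n) -> Prop) : Prop := RowSubsheaf {
  rs_sub : forall U V s, zopen (@P2 K) U -> zopen U V -> F U s -> F V s;
  rs_eq : forall U s t, zopen (@P2 K) U -> (forall p, U p -> s p = t p) ->
    F U s -> F U t;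
  rs_zero : forall U, zopen (@P2 K) U -> F U (fun=> 0);
  rs_add : forall U s t, zopen (@P2 K) U -> F U s -> F U t ->
    F U (fun p => s p + t p);
  rs_scale : forall U c s, zopen (@P2 K) U -> regular 0 U c -> F U s ->
    F U (fun p => c p *: s p)
}.

(* On the open set {den <> 0}, F is free with basis the rows of fmat, which are
   sections of the twists F(fdeg j), and vol times the determinant in this basis
   extends to a form on F with values in O(k).  On the test tuples this form
   takes homogeneous values tval without common zero on some line, so it
   generates Hom(Lambda^r F, O(k)) outside a finite set of points: by Hartogs,
   (Lambda^r F)^** is O(k), even where F is not locally free. *)
Record framed (K : closedFieldType) n
    (F : (pt K -> Prop) -> (pt K -> 'rV[K]_n) -> Prop) (r : nat) (k : int) :=
  Framed {
  den : {mpoly K[3]};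
  fdeg : 'I_r -> int;
  fmat : pt K -> 'M[K]_(r, n);
  vol : pt K -> K;
  tidx : finType;
  tdeg : tidx -> 'I_r -> int;
  test : tidx -> 'I_r -> pt K -> 'rV[K]_n;
  tval : tidx -> {mpoly K[3]};
  tvdeg : tidx -> nat;
  den_homog : exists e, den \is e.-homog;
  den_neq0 : den != 0;
  fmat_free : forall p : pt K, den.@[p] != 0 -> row_free (fmat p);
  fmat_sec : forall c V j, zopen (@P2 K) V -> (forall p, V p -> p c != 0) ->
    F V (fun p => p c ^ (- fdeg j) *: row j (fmat p));
  fmat_gen : forall V s, zopen (@P2 K) V -> F V s ->
    (forall p, V p -> den.@[p] != 0 -> (s p <= fmat p)%MS) /\
    (forall j, regular (- fdeg j) (chart V den) (fun p => fcoord (fmat p) (s p) j));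
  vol_neq0 : forall p : pt K, den.@[p] != 0 -> vol p != 0;
  vol_extends : forall V s, zopen (@P2 K) V -> (forall i, F V (s i)) ->
    extends k V den (fun p => \det (stack fmat s p) * vol p);
  test_sec : forall c V a i, zopen (@P2 K) V -> (forall p, V p -> p c != 0) ->
    F V (fun p => p c ^ (- tdeg a i) *: test a i p);
  test_val : forall a p, P2 p -> den.@[p] != 0 ->
    \det (stack fmat (test a) p) * vol p = (tval a).@[p];
  tval_homog : forall a, tval a \is (tvdeg a).-homog;
  tvdegE : forall a, (tvdeg a)%:Z = \sum_i tdeg a i + k;
  tval_line : nozero_on_line tval;
  tval_den : forall p, P2 p -> den.@[p] != 0 -> exists a, (tval a).@[p] != 0
}.

Arguments tdeg {K n F r k} f _ _.
Arguments test {K n F r k} f _ _ _.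
Arguments tval {K n F r k} f _.
Arguments tvdeg {K n F r k} f _.
Arguments tval_homog {K n F r k} f _.
Arguments tvdegE {K n F r k} f _.
Arguments test_val {K n F r k} f _ _ _ _.
Arguments test_sec {K n F r k} f _ _ _ _ _ _.

(** Membership and value are proved together, since additivity of [ev] is known only on sections and
    so needs the partial sums to be sections. *)
Lemma section_sum (K : closedFieldType) n (U : pt K -> Prop)
    (F : (pt K -> Prop) -> (pt K -> 'rV[K]_n) -> Prop)
    (M : lmodType K) (ev : (pt K -> 'rV[K]_n) -> M) p r
    (c : 'I_r -> pt K -> K) (s : 'I_r -> pt K -> 'rV[K]_n) :
  F U (fun=> 0) ->
  (forall s t, F U s -> F U t -> F U (fun q => s q + t q)) ->
  (forall c s, regular 0 U c -> F U s -> F U (fun q => c q *: s q)) ->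
  ev (fun=> 0) = 0 ->
  (forall s t, F U s -> F U t -> ev (fun q => s q + t q) = ev s + ev t) ->
  (forall c s, regular 0 U c -> F U s -> ev (fun q => c q *: s q) = c p *: ev s) ->
  (forall j, regular 0 U (c j)) -> (forall j, F U (s j)) ->
  F U (fun q => \sum_j c j q *: s j q) /\
  ev (fun q => \sum_j c j q *: s j q) = \sum_j c j p *: ev (s j).
Proof.
move=> F0 FD FZ e0 eD eZ rc Fs.
elim: (index_enum _) => [|j l [IH1 IH2]].
  rewrite (_ : (fun q => _) = fun=> 0) ?big_nil //.
  by apply: functional_extensionality => q; rewrite big_nil.
rewrite (_ : (fun q => _) =
    fun q => c j q *: s j q + \sum_(i <- l) c i q *: s i q); last first.
  by apply: functional_extensionality => q; rewrite big_cons.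
have H := FZ _ _ (rc j) (Fs j); split; first exact: FD.
by rewrite eD // eZ // IH2 big_cons.
Qed.

(** * Alternating forms on a framed sheaf as multiples of the volume form *)

Section FramedAlt.
Variables (K : closedFieldType) (n r : nat) (k : int).
Variable F : (pt K -> Prop) -> (pt K -> 'rV[K]_n) -> Prop.
Hypothesis rs : row_subsheaf F.
Variable D : framed F r k.
Implicit Types (U V W : pt K -> Prop) (p q : pt K).
Implicit Types (s t : 'I_r -> pt K -> 'rV[K]_n).
Implicit Types phi : (pt K -> Prop) -> ('I_r -> pt K -> 'rV[K]_n) -> pt K -> K.

Let B := fmat D.
Let h := den D.
Let A := row_sheaf F.

Definition twist_row (c : 'I_3) (m : int) (x : pt K -> 'rV[K]_n) : pt K -> 'rV[K]_n :=
  fun p => p c ^ (- m) *: x p.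

Definition fbasis c j : pt K -> 'rV[K]_n := twist_row c (fdeg D j) (fun p => row j (B p)).

Lemma zopen_den U : zopen U (chart U h).
Proof. by have [e he] := den_homog D; apply: zopen_chart he. Qed.

Lemma zopenX U (c : 'I_3) : zopen U (chart U 'X_c).
Proof. exact: zopen_chart (dhomogXi _ c). Qed.

Lemma chartX U (c : 'I_3) p : chart U 'X_c p -> p c != 0.
Proof. by case=> _; rewrite mevalXU. Qed.

Lemma coord_fbasis c j p i : h.@[p] != 0 ->
  fcoord (B p) (fbasis c j p) i = p c ^ (- fdeg D j) * (j == i)%:R.
Proof. by move=> hp; rewrite fcoordZ fcoord_row //; apply: fmat_free. Qed.

Lemma alt_expand V phi (c : 'I_3) s i x p : zopen (@P2 K) V ->
  (forall q, V q -> q c != 0) -> (forall q, V q -> h.@[q] != 0) ->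
  is_alt (A := A) V phi -> (forall j, F V (s j)) -> F V x -> V p ->
  phi V (upd s i x) p =
    \sum_j (fcoord (B p) (x p) j * p c ^ fdeg D j) * phi V (upd s i (fbasis c j)) p.
Proof.
move=> oV Vc Vh aV Fs Fx Vp.
have VP q : V q -> P2 q by apply: zopen_sub oV.
have [_ _ /(_ i) H _] := aV V s (zopen_refl V) Fs.
have [_ ev_eq ev_add ev_scale _] := H V (zopen_refl V).
pose ev (y : pt K -> 'rV[K]_n) : K^o := phi V (upd s i y) p.
have evD y z : F V y -> F V z -> ev (fun q => y q + z q) = ev y + ev z.
  by move=> Fy Fz; apply: (ev_add y z).
have evZ b y : regular 0 V b -> F V y -> ev (fun q => b q *: y q) = b p *: ev y.
  by move=> rb Fy; apply: (ev_scale b y).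
have ev0 : ev (fun=> 0) = 0.
  have -> : (fun=> 0) = (fun q : pt K => (0 : K) *: (0 : 'rV[K]_n)) :> (pt K -> 'rV[K]_n).
    by apply: functional_extensionality => q; rewrite scale0r.
  rewrite (evZ (fun=> 0) (fun=> 0)) ?scale0r //; first exact: regular0.
  exact: rs_zero rs _ oV.
have [xB rB] := fmat_gen D oV Fx.
pose b j q := fcoord (B q) (x q) j * q c ^ fdeg D j.
have rb j : regular 0 V (b j).
  apply: (regularM_deg (k := - fdeg D j) (l := fdeg D j)) => //; first by rewrite addNr.
    by apply: regular_sub (rB j) => q Vq; split=> //; apply: Vh.
  exact: regular_coordX.
have Fb j : F V (fbasis c j) by apply: fmat_sec.
have Ex q : V q -> x q = \sum_j b j q *: fbasis c j q.
  move=> Vq; rewrite -{1}[x q](fcoordK (xB q Vq (Vh q Vq))).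
  apply: eq_bigr => j _; rewrite /fbasis /twist_row scalerA /b -mulrA.
  by rewrite -expfzDr ?Vc // addrN expr0z mulr1.
have [FS ES] := section_sum (p := p) (rs_zero rs oV)
  (fun _ _ => rs_add rs oV) (fun _ _ => rs_scale rs oV) ev0 evD evZ rb Fb.
by rewrite -[RHS]/(\sum_j b j p *: ev (fbasis c j)) -ES; apply: (ev_eq x).
Qed.

Lemma alt_chart V phi (c : 'I_3) s p : zopen (@P2 K) V ->
  (forall q, V q -> q c != 0) -> (forall q, V q -> h.@[q] != 0) ->
  is_alt (A := A) V phi -> (forall j, F V (s j)) -> V p ->
  phi V s p = \det (stack B s p) * (\prod_j p c ^ fdeg D j * phi V (fbasis c) p).
Proof.
move=> oV Vc Vh aV Fs Vp.
pose co (x : pt K -> 'rV[K]_n) j := fcoord (B p) (x p) j * p c ^ fdeg D j.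
have Fb j : F V (fbasis c j) by apply: fmat_sec.
have cob j i : co (fbasis c j) i = (i == j)%:R.
  rewrite /co coord_fbasis ?Vh // [i == j]eq_sym.
  case: eqP => [->|_]; last by rewrite mulr0 mul0r.
  by rewrite mulr1 -expfzDr ?Vc // addNr expr0z.
rewrite (@alternating_det K _ (F V) r co (fbasis c) Fb cob _ (fun s => phi V s p)) //.
- rewrite mulrA; congr (_ * _); rewrite -det_scale_cols; congr (\det _).
  by apply/matrixP => i j; rewrite !mxE.
- move=> i j; exists (fun q => fbasis c i q + fbasis c j q); first exact: rs_add.
  by move=> l; rewrite /co fcoordD mulrDl -!/(co _ _) !cob.
- by move=> s' i x Fs' Fx; apply: alt_expand.
- move=> s' i j Fs' ij E; have [_ _ _ H] := aV V s' (zopen_refl V) Fs'.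
  by apply: (H i j ij) => // q _; rewrite E.
Qed.

Lemma is_alt_sub U V phi : zopen U V -> is_alt (A := A) U phi -> is_alt (A := A) V phi.
Proof.
move=> oV aU W s oW Fs; exact: aU (zopen_trans oV oW) Fs.
Qed.

(** At a point off den = 0 an alternating form is one scalar v: it is computed on a chart where the
    frame, untwisted by powers of a coordinate, is a basis, and it depends on neither the sections
    nor the open set. *)
Lemma alt_value U phi p : zopen (@P2 K) U -> is_alt (A := A) U phi -> U p ->
  h.@[p] != 0 -> exists v, forall W s, zopen U W -> W p ->
    (forall i, F W (s i)) -> phi W s p = \det (stack B s p) * v.
Proof.
move=> oU aU Up hp.
have [c pc] := P2_coord (zopen_sub oU Up).
pose U0 := chart (chart U h) 'X_c.
have oU0 : zopen U U0 by apply: zopen_trans (zopen_den U) (zopenX _ c).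
have U0p : U0 p by split=> //; rewrite mevalXU.
exists (\prod_j p c ^ fdeg D j * phi U0 (fbasis c) p) => W s oW Wp Fs.
pose W0 q := W q /\ U0 q.
have oW0 : zopen W W0 by apply: (zopen_cap oU0) => q; apply: zopen_sub.
have oW0' : zopen U0 W0.
  have := zopen_trans oW oW0 => /zopen_narrow; apply; first by move=> q [].
  by move=> q; apply: zopen_sub oU0.
have oPW := zopen_trans oU oW; have oPW0 := zopen_trans oPW oW0.
have [_ /(_ W0 oW0 p (conj Wp U0p)) <- _ _] := aU W s oW Fs.
have Vc q : W0 q -> q c != 0 by case=> _ /chartX.
rewrite (alt_chart (c := c) oPW0) //.
- congr (_ * (_ * _)).
  have Fb j : F U0 (fbasis c j).
    apply: fmat_sec; first exact: zopen_trans oU oU0.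
    by move=> q /chartX.
  by have [_ /(_ W0 oW0' p (conj Wp U0p)) <- _ _] := aU U0 (fbasis c) oU0 Fb.
- by move=> q [_ [[_ ]]].
- apply: is_alt_sub aU; exact: zopen_trans oW oW0.
- by move=> j; apply: rs_sub rs _ _ _ oPW oW0 (Fs j).
Qed.

(** The volume form with values in O(k). Its choice on each V is harmless, because den <> 0 is dense
    and determines it. *)
Definition vform V s : pt K -> K := epsilon (inhabits (fun=> 0)) (fun g =>
  regular k V g /\
  forall p, V p -> h.@[p] != 0 -> g p = \det (stack B s p) * vol D p).

Lemma vformP V s : zopen (@P2 K) V -> (forall i, F V (s i)) ->
  regular k V (vform V s) /\
  forall p, V p -> h.@[p] != 0 -> vform V s p = \det (stack B s p) * vol D p.
Proof.
move=> oV Fs; exact: (epsilon_spec _ _ (vol_extends D oV Fs)).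
Qed.

Definition quot V phi : pt K -> K := epsilon (inhabits (fun=> 0)) (fun g =>
  regular (- k) V g /\
  forall p, V p -> h.@[p] != 0 -> forall W s, zopen V W -> W p ->
    (forall i, F W (s i)) -> phi W s p = g p * (\det (stack B s p) * vol D p)).

Lemma stack_twist c (m : 'I_r -> int) s p :
  \det (stack B (fun i => twist_row c (m i) (s i)) p) =
  (\prod_i p c ^ (- m i)) * \det (stack B s p).
Proof.
rewrite -det_scale_rows; congr (\det _); apply/matrixP => i j.
by rewrite !mxE fcoordZ.
Qed.

Lemma prod_expz (x : K) (m : 'I_r -> int) : x != 0 ->
  \prod_i x ^ m i = x ^ (\sum_i m i).
Proof.
move=> x0; elim/big_rec2: _ => [|i y z _ ->]; first by rewrite expr0z.
by rewrite expfzDr.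
Qed.

(** Off den = 0 the factor is the scalar of phi divided by [vol]. Evaluating phi on the test tuples
    shows that its products with the [tval] are regular, so Hartogs extends it. *)
Lemma quotP V phi : zopen (@P2 K) V -> is_alt (A := A) V phi ->
  regular (- k) V (quot V phi) /\
  forall p, V p -> h.@[p] != 0 -> forall W s, zopen V W -> W p ->
    (forall i, F W (s i)) ->
    phi W s p = quot V phi p * (\det (stack B s p) * vol D p).
Proof.
move=> oV aV; pose good g := regular (- k) V g /\
  forall p, V p -> h.@[p] != 0 -> forall W s, zopen V W -> W p ->
    (forall i, F W (s i)) -> phi W s p = g p * (\det (stack B s p) * vol D p).
suff ex_good : exists g, good g by exact: (epsilon_spec _ good ex_good).
pose isval p v := forall W s, zopen V W -> W p ->
  (forall i, F W (s i)) -> phi W s p = \det (stack B s p) * v.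
pose val p := epsilon (inhabits 0) (isval p).
have valP p : V p -> h.@[p] != 0 -> isval p (val p).
  move=> Vp hp; exact: epsilon_spec (alt_value oV aV Vp hp).
suff [g [rg Eg]] : extends (- k) V h (fun p => val p / vol D p).
  exists g; split=> // p Vp hp W s oW Wp Fs; rewrite (valP p Vp hp W s) //.
  rewrite Eg //; field; exact: vol_neq0.
apply: extends_local => // [|p Vp]; first exact: den_neq0.
have [c pc] := P2_coord (zopen_sub oV Vp).
pose W := chart V 'X_c; have oW : zopen V W := zopenX V c.
have oPW := zopen_trans oV oW; have WP q : W q -> P2 q by apply: zopen_sub oPW.
exists W; split=> //; first by split=> //; rewrite mevalXU.
have Wc q : W q -> q c != 0 := @chartX V c q.
(* The test sections live in twists of F; powers of X_c make them sections, and the factor X_c^(sum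
   of tdeg) in u restores the degree. *)
pose tau (a : tidx D) i := twist_row c (tdeg D a i) (test D a i).
have Ft a i : F W (tau a i) by apply: test_sec.
apply: (extends_quotient (h := tval D) (delta := tvdeg D)
  (u := fun a q => q c ^ (\sum_i tdeg D a i) * phi W (tau a) q)) => //.
- exact: den_neq0.
- exact: tval_homog.
- exact: tval_line.
- move=> a; apply: (regularM_deg (k := \sum_i tdeg D a i) (l := 0)) => //.
  + by rewrite tvdegE; ring.
  + exact: regular_coordX.
  + by have [] := aV W (tau a) oW (Ft a).
- move=> a q Wq hq; have Vq : V q by case: Wq.
  rewrite (valP q Vq hq W (tau a)) // stack_twist -(test_val D a q (WP q Wq) hq).
  rewrite prod_expz ?Wc // sumrN !mulrA -expfzDr ?Wc // addrN expr0z mul1r.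
  by field; apply: vol_neq0.
- by move=> q Wq hq; apply: tval_den => //; apply: WP.
Qed.

(** The untwisted frame is a tuple of nonzero volume, so its image under phi determines the factor
    off den = 0, and density does the rest. *)
Lemma quot_unique V phi g : zopen (@P2 K) V -> is_alt (A := A) V phi ->
  regular (- k) V g ->
  (forall p, V p -> h.@[p] != 0 -> forall W s, zopen V W -> W p ->
    (forall i, F W (s i)) -> phi W s p = g p * (\det (stack B s p) * vol D p)) ->
  forall p, V p -> quot V phi p = g p.
Proof.
move=> oV aV rg Eg; have [rq Eq] := quotP oV aV.
apply: (regular_dense (h := h) oV rq rg (den_neq0 D)) => p Vp hp.
have [c pc] := P2_coord (zopen_sub oV Vp).
have Fb j : F (chart V 'X_c) (fbasis c j).
  apply: fmat_sec; first exact: zopen_trans oV (zopenX V c).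
  by move=> q /chartX.
have Wp : chart V 'X_c p by split=> //; rewrite mevalXU.
have E1 := Eq p Vp hp _ _ (zopenX V c) Wp Fb.
have E2 := Eg p Vp hp _ _ (zopenX V c) Wp Fb.
move: E1; rewrite E2 stack_twist => /esym; apply: mulIf.
apply: mulf_neq0; last exact: vol_neq0.
apply: mulf_neq0.
  by apply/prodf_neq0 => i _; rewrite expfz_neq0.
rewrite (_ : stack _ _ _ = 1%:M) ?det1 ?oner_neq0 //.
apply/matrixP => i j; rewrite !mxE fcoord_row // ?eq_sym //.
exact: fmat_free.
Qed.

Lemma quotE V phi W s p : zopen (@P2 K) V -> is_alt (A := A) V phi ->
  zopen V W -> (forall i, F W (s i)) -> W p ->
  phi W s p = quot V phi p * vform W s p.
Proof.
move=> oV aV oW Fs Wp; have [rq Eq] := quotP oV aV.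
have oPW := zopen_trans oV oW; have [rv Ev] := vformP oPW Fs.
have [rphi _ _ _] := aV W s oW Fs.
have WP q : W q -> P2 q by apply: zopen_sub oPW.
have rr : regular 0 W (fun q => quot V phi q * vform W s q).
  apply: (regularM_deg (k := - k) (l := k)) => //; first by rewrite addNr.
  exact: regular_zopen oW rq.
apply: (regular_dense (h := h) oPW rphi rr (den_neq0 D)) => // q Wq hq.
by rewrite (Eq q (zopen_sub oW Wq) hq W s) // Ev.
Qed.

End FramedAlt.

(** * The dual of the sheaf of alternating forms *)

Section FramedDegree.
Variables (K : closedFieldType) (n r : nat) (k : int).
Variable F : (pt K -> Prop) -> (pt K -> 'rV[K]_n) -> Prop.
Hypothesis rs : row_subsheaf F.
Variable D : framed F r k.
Implicit Types (U V W : pt K -> Prop) (p q : pt K).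
Implicit Types (s t : 'I_r -> pt K -> 'rV[K]_n).
Implicit Types phi : (pt K -> Prop) -> ('I_r -> pt K -> 'rV[K]_n) -> pt K -> K.

Let B := fmat D.
Let h := den D.
Let A := row_sheaf F.

Lemma vform_unique V s g : zopen (@P2 K) V -> (forall i, F V (s i)) ->
  regular k V g ->
  (forall p, V p -> h.@[p] != 0 -> g p = \det (stack B s p) * vol D p) ->
  forall p, V p -> vform D V s p = g p.
Proof.
move=> oV Fs rg Eg; have [rv Ev] := vformP D oV Fs.
apply: (regular_dense (h := h) oV rv rg (den_neq0 D)) => p Vp hp.
by rewrite Ev // Eg.
Qed.

Lemma vform_sub V W s p : zopen (@P2 K) V -> zopen V W -> (forall i, F V (s i)) ->
  W p -> vform D W s p = vform D V s p.
Proof.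
move=> oV oW Fs; have [rv Ev] := vformP D oV Fs; have oPW := zopen_trans oV oW.
apply: vform_unique => //.
- by move=> i; apply: rs_sub rs _ _ _ oV oW (Fs i).
- exact: regular_zopen oW rv.
- by move=> q Wq hq; apply: Ev => //; apply: zopen_sub oW Wq.
Qed.

Lemma det_stack_lin s i (a b : pt K -> K) (x y : pt K -> 'rV[K]_n) p :
  \det (stack B (upd s i (fun q => a q *: x q + b q *: y q)) p) =
  a p * \det (stack B (upd s i x) p) + b p * \det (stack B (upd s i y) p).
Proof.
apply: (determinant_multilinear (i0 := i)).
- by apply/rowP => j; rewrite !mxE /upd !eqxx fcoordD !fcoordZ.
- by apply/matrixP => j l; rewrite !mxE /upd !(eq_sym _ i) !(negPf (neq_lift _ _)).
- by apply/matrixP => j l; rewrite !mxE /upd !(eq_sym _ i) !(negPf (neq_lift _ _)).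
Qed.

Lemma vform_lin V s i (a b : pt K -> K) (x y : pt K -> 'rV[K]_n) p :
  zopen (@P2 K) V -> (forall j, F V (s j)) -> F V x -> F V y ->
  regular 0 V a -> regular 0 V b -> V p ->
  vform D V (upd s i (fun q => a q *: x q + b q *: y q)) p =
  a p * vform D V (upd s i x) p + b p * vform D V (upd s i y) p.
Proof.
move=> oV Fs Fx Fy ra rb; have VP q : V q -> P2 q by apply: zopen_sub oV.
have [rx Ex] := vformP D oV (sec_upd i Fs Fx).
have [ry Ey] := vformP D oV (sec_upd i Fs Fy).
apply: (vform_unique (g := fun p =>
  a p * vform D V (upd s i x) p + b p * vform D V (upd s i y) p)) => //.
- by apply: sec_upd => //; apply: rs_add => //; apply: rs_scale.
- by apply: regularD => //; apply: (regularM_deg (k := 0) (l := k)) => //; rewrite add0r.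
- by move=> q Vq hq; rewrite Ex // Ey // det_stack_lin; ring.
Qed.

Lemma vform_eq V s t p : zopen (@P2 K) V -> (forall j, F V (s j)) ->
  (forall j, F V (t j)) -> (forall j q, V q -> s j q = t j q) -> V p ->
  vform D V s p = vform D V t p.
Proof.
move=> oV Fs Ft E; have [rt Et] := vformP D oV Ft.
apply: vform_unique => // q Vq hq; rewrite Et //; congr (\det _ * _).
by apply/matrixP => i j; rewrite !mxE E.
Qed.

Lemma vform_alternate V s i j p : zopen (@P2 K) V -> (forall j, F V (s j)) ->
  i != j -> (forall q, V q -> s i q = s j q) -> V p -> vform D V s p = 0.
Proof.
move=> oV Fs ij E; have VP q : V q -> P2 q by apply: zopen_sub oV.
apply: (vform_unique (g := fun=> 0)) => //; first exact: regular0.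
move=> q Vq hq; rewrite (determinant_alternate ij) ?mul0r // => l.
by rewrite !mxE E.
Qed.

(** Elements of [ext_dual] are O-valued, while [vform] takes values in O(k); on the chart of X_c the
    factor X_c^(- k) makes it a generator. *)
Definition vform_tw (c : 'I_3) : (pt K -> Prop) -> ('I_r -> pt K -> 'rV[K]_n) -> pt K -> K :=
  fun V s p => p c ^ (- k) * vform D V s p.

Lemma vform_tw_alt c V : zopen (@P2 K) V -> (forall p, V p -> p c != 0) ->
  is_alt (A := A) V (vform_tw c).
Proof.
move=> oV Vc W s oW Fs; have oPW := zopen_trans oV oW.
have reg W' t : zopen V W' -> (forall j, F W' (t j)) -> regular 0 W' (vform_tw c W' t).
  move=> oW' Ft; have oPW' := zopen_trans oV oW'.
  have [rv _] := vformP D oPW' Ft.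
  apply: (regularM_deg (k := - k) (l := k)) => //; first by rewrite addNr.
    by move=> q; apply: zopen_sub oPW'.
  by apply: regular_coordX => q /(zopen_sub oW'); apply: Vc.
split; first exact: reg.
- by move=> W' oW' p Wp; rewrite /vform_tw (vform_sub oPW).
- move=> i U oU; have oPU := zopen_trans oPW oU; have oVU := zopen_trans oW oU.
  have UP q : U q -> P2 q by apply: zopen_sub oPU.
  have Fs' j : F U (s j) by apply: rs_sub rs _ _ _ oPW oU (Fs j).
  split.
  + by move=> x Fx; apply: (reg U (upd s i x) oVU); apply: sec_upd.
  + move=> x y Fx Fy E p Up; congr (_ * _); apply: vform_eq => //; try exact: sec_upd.
    by move=> j q Uq; case: eqP => // _; apply: E.
  + move=> x y Fx Fy p Up; rewrite /= /vform_tw -mulrDr; congr (_ * _).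
    have r1 := regular_const 1 UP.
    have := vform_lin i oPU Fs' Fx Fy r1 r1 Up; rewrite !mul1r => <-.
    congr (vform D U (upd s i _) p).
    by apply: functional_extensionality => q; rewrite !scale1r.
  + move=> a x ra Fx p Up; rewrite /= /vform_tw mulrCA; congr (_ * _).
    have r0 := regular_const 0 UP.
    have := vform_lin i oPU Fs' Fx Fx ra r0 Up; rewrite mul0r addr0 => <-.
    congr (vform D U (upd s i _) p).
    by apply: functional_extensionality => q; rewrite scale0r addr0.
  + move=> V' x oV' Fx p V'p; congr (_ * _); apply: (vform_sub oPU oV') => //.
    exact: sec_upd.
- move=> i j ij E p Wp; rewrite /vform_tw (vform_alternate oPW Fs ij) ?mulr0 //.
Qed.

Lemma quot_vform_tw c V p : zopen (@P2 K) V -> (forall p, V p -> p c != 0) ->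
  V p -> quot D V (vform_tw c) p = p c ^ (- k).
Proof.
move=> oV Vc; have aV := vform_tw_alt oV Vc.
apply: (quot_unique (g := fun q => q c ^ (- k)) rs oV aV); first exact: regular_coordX.
move=> q Vq hq W s oW Wq Fs.
by have [_ Ev] := vformP D (zopen_trans oV oW) Fs; rewrite /vform_tw Ev.
Qed.

Lemma quot_sub V W phi p : zopen (@P2 K) V -> zopen V W ->
  is_alt (A := A) V phi -> W p -> quot D W phi p = quot D V phi p.
Proof.
move=> oV oW aV; have [rq Eq] := quotP rs D oV aV.
apply: (quot_unique rs (zopen_trans oV oW)); first exact: is_alt_sub oW aV.
  exact: regular_zopen oW rq.
move=> q Wq hq W' s oW' W'q Fs; apply: Eq => //; first exact: zopen_sub oW Wq.
exact: zopen_trans oW oW'.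
Qed.

Lemma is_altZ V a phi : zopen (@P2 K) V -> regular 0 V a ->
  is_alt (A := A) V phi -> is_alt (A := A) V (fun W s p => a p * phi W s p).
Proof.
move=> oV ra aV W s oW Fs; have [H1 H2 H3 H4] := aV W s oW Fs.
have WP q : W q -> P2 q by apply: zopen_sub (zopen_trans oV oW).
split.
- apply: (regularM_deg (k := 0) (l := 0)) => //; exact: regular_zopen oW ra.
- by move=> W' oW' q W'q /=; rewrite H2.
- move=> i U oU; have [K1 K2 K3 K4 K5] := H3 i U oU.
  have ra' := regular_zopen (zopen_trans oW oU) ra.
  have UP q : U q -> P2 q by move=> /(zopen_sub oU) /WP.
  split.
  + move=> x Fx; apply: (regularM_deg (k := 0) (l := 0)) => //; exact: K1.
  + by move=> x y Fx Fy E q Uq; congr (_ * _); apply: (K2 x y).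
  + move=> x y Fx Fy q Uq /=; rewrite -mulrDr; congr (_ * _); exact: (K3 x y).
  + move=> b x rb Fx q Uq /=; rewrite mulrCA; congr (_ * _); exact: (K4 b x).
  + move=> U' x oU' Fx q Uq; congr (_ * _); exact: (K5 U' x).
- by move=> i j ij E q Wq; rewrite (H4 i j) ?mulr0.
Qed.

Lemma is_altD V phi psi : zopen (@P2 K) V ->
  is_alt (A := A) V phi -> is_alt (A := A) V psi ->
  is_alt (A := A) V (fun W s p => phi W s p + psi W s p).
Proof.
move=> oV aV bV W s oW Fs; have [H1 H2 H3 H4] := aV W s oW Fs.
have [H1' H2' H3' H4'] := bV W s oW Fs.
have WP q : W q -> P2 q by apply: zopen_sub (zopen_trans oV oW).
split.
- exact: regularD.
- by move=> W' oW' q W'q /=; rewrite H2 // H2'.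
- move=> i U oU; have [K1 K2 K3 K4 K5] := H3 i U oU.
  have [L1 L2 L3 L4 L5] := H3' i U oU.
  have UP q : U q -> P2 q by move=> /(zopen_sub oU) /WP.
  split.
  + by move=> x Fx; apply: regularD => //; [apply: K1 | apply: L1].
  + by move=> x y Fx Fy E q Uq; congr (_ + _); [apply: (K2 x y) | apply: (L2 x y)].
  + move=> x y Fx Fy q Uq; rewrite /= addrACA.
    congr (_ + _); [exact: (K3 x y) | exact: (L3 x y)].
  + move=> b x rb Fx q Uq; rewrite /= mulrDr.
    congr (_ + _); [exact: (K4 b x) | exact: (L4 b x)].
  + by move=> U' x oU' Fx q Uq; congr (_ + _); [apply: (K5 U' x) | apply: (L5 U' x)].
- by move=> i j ij E q Wq; rewrite (H4 i j) // (H4' i j) // addr0.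
Qed.

(* Alternating forms on F are the multiples of vform by sections of O(- k). *)
Lemma framed_has_degree_iso :
  isom (@P2 K) (sheaf_dual (ext_dual r A)) (Otw K k).
Proof.
pose E := ext_dual r A.
pose cc p : 'I_3 := odflt ord0 [pick c | p c != 0].
have ccP p : P2 p -> p (cc p) != 0.
  move=> /P2_coord [c pc]; rewrite /cc; case: pickP => [//|/(_ c)].
  by rewrite pc.
(* A functional Phi is sent to its value on the volume form, computed in a chart containing p;
   conversely u acts on phi by multiplying [quot] of phi. *)
pose al U (Phi : car (sheaf_dual E)) p :=
  p (cc p) ^ k * Phi (chart U 'X_(cc p)) (vform_tw (cc p)) p.
pose be U (u : pt K -> K) : car (sheaf_dual E) :=
  fun V phi p => u p * quot D V phi p.
have altc U c : zopen (@P2 K) U -> sec (s := E) (chart U 'X_c) (vform_tw c).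
  move=> oU; apply: vform_tw_alt; last by move=> p; apply: chartX.
  exact: zopen_trans oU (zopenX U c).
(* On a chart phi is [quot] times X_c^k times [vform_tw c], so O-linearity expresses Phi through its
   value on this one form. *)
have PhiE U (Phi : car (sheaf_dual E)) V phi p c : zopen (@P2 K) U ->
    sec (s := sheaf_dual E) U Phi -> zopen U V -> sec (s := E) V phi -> V p ->
    p c != 0 ->
    Phi V phi p = quot D V phi p * p c ^ k * Phi (chart V 'X_c) (vform_tw c) p.
  move=> oU HPhi oV aV Vp pc; have oPV := zopen_trans oU oV.
  pose W := chart V 'X_c; have oW : zopen V W by apply: zopenX.
  have oPW := zopen_trans oPV oW.
  have Wp : W p by split=> //; rewrite mevalXU.
  have Wc q : W q -> q c != 0 := @chartX _ V c q.
  have [_ _ _ _ /(_ W phi oW aV p Wp) <-] := HPhi V oV.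
  have [_ Heq _ Hsc _] := HPhi W (zopen_trans oV oW).
  have aW : sec (s := E) W phi by apply: is_alt_sub oW aV.
  have aWc : sec (s := E) W (vform_tw c) by apply: altc.
  have rq : regular 0 W (fun q => quot D V phi q * q c ^ k).
    have [rq _] := quotP rs D oPV aV.
    apply: (regularM_deg (k := - k) (l := k)); first by rewrite addNr.
    - by move=> q; apply: zopen_sub oPW.
    - exact: regular_zopen oW rq.
    - exact: regular_coordX.
  have H := Hsc _ _ rq aWc p Wp; rewrite /= in H; rewrite -H.
  apply: Heq => //.
    exact: is_altZ oPW rq aWc.
  move=> V' s oV' Fs q V'q /=; rewrite /vform_tw.
  rewrite (quotE rs D oPV aV (zopen_trans oW oV')) // -!mulrA; congr (_ * _).
  have qc : q c != 0 by apply/Wc/(zopen_sub oV').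
  by rewrite mulrA -(expfzDr _ _ qc) addrN expr0z mul1r.
(* Independence of the coordinate chosen in [al]: applying the previous formula to the form of the
   other chart contributes exactly the ratio of the two powers. *)
have alE U (Phi : car (sheaf_dual E)) p c : zopen (@P2 K) U ->
    sec (s := sheaf_dual E) U Phi -> U p -> p c != 0 ->
    al U Phi p = p c ^ k * Phi (chart U 'X_c) (vform_tw c) p.
  move=> oU HPhi Up pc; have Pp := zopen_sub oU Up; rewrite /al.
  move: (cc p) (ccP p Pp) => c' pc'.
  have oW := zopenX U c'; have Wp : chart U 'X_c' p by split=> //; rewrite mevalXU.
  rewrite (PhiE U Phi _ _ p c oU HPhi oW (altc U c' oU) Wp pc).
  rewrite quot_vform_tw //; [|exact: zopen_trans oU oW|by move=> q; apply: chartX].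
  rewrite !mulrA -expfzDr // addrN expr0z mul1r; congr (_ * _).
  have oW2 : zopen (chart U 'X_c) (chart (chart U 'X_c') 'X_c).
    have := zopen_trans oW (zopenX (chart U 'X_c') c) => /zopen_narrow; apply.
      by move=> q [[Uq _] cq].
    by move=> q [].
  have [_ _ _ _ H] := HPhi _ (zopenX U c).
  by apply: H => //; [apply: altc | split=> //; rewrite mevalXU].
exists al, be; split.
- move=> U oU; have UP q : U q -> P2 q by apply: zopen_sub oU.
  split.
  + move=> Phi HPhi; apply: regular_local => // p Up.
    have [c pc] := P2_coord (UP p Up).
    exists (chart U 'X_c); split; [exact: zopenX | by split=> //; rewrite mevalXU |].
    have [H1 _ _ _ _] := HPhi _ (zopenX U c).
    have WP q : chart U 'X_c q -> P2 q by case=> /UP.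
    have rr := regularM WP (regular_coordX k (@chartX _ U c)) (H1 _ (altc U c oU)).
    rewrite addr0 in rr; apply: (eq_regular _ rr) => q Wq.
    by rewrite (alE U Phi q c) //; [case: Wq | apply: chartX Wq].
  + move=> Phi Psi _ _ EE p Up; congr (_ * _).
    by apply: EE; [apply: zopenX | apply: altc | split; rewrite ?mevalXU //; apply/ccP/UP].
  + by move=> Phi Psi _ _ p Up; rewrite /= /al mulrDr.
  + by move=> a Phi _ _ p Up; rewrite /= /al mulrCA.
  + move=> V Phi oV HPhi p Vp; congr (_ * _).
    have Up := zopen_sub oV Vp.
    have [_ _ _ _ H] := HPhi _ (zopenX U (cc p)).
    apply: H; [|exact: altc|by split; rewrite ?mevalXU //; apply/ccP/UP].
    have := zopen_trans oV (zopenX V (cc p)) => /zopen_narrow; apply.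
      by move=> q [/(zopen_sub oV) Uq cq].
    by move=> q [].
- move=> U oU; split.
  + move=> u ru V oV; have oPV := zopen_trans oU oV.
    have VP q : V q -> P2 q by apply: zopen_sub oPV.
    split.
    * move=> phi aV; have [rq _] := quotP rs D oPV aV.
      apply: (regularM_deg (k := k) (l := - k)) => //; first by rewrite addrN.
      exact: regular_zopen oV ru.
    * move=> phi psi aV bV EE p Vp; congr (_ * _).
      have [rq Eq] := quotP rs D oPV bV.
      apply: (quot_unique rs oPV aV rq) => // q Vq hq W s oW Wq Fs.
      by rewrite EE // (Eq q Vq hq W).
    * move=> phi psi aV bV p Vp /=; rewrite -mulrDr; congr (_ * _).
      have [rq Eq] := quotP rs D oPV aV; have [rq' Eq'] := quotP rs D oPV bV.
      have rr := regularD VP rq rq'.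
      apply: (quot_unique rs oPV _ rr) => //; last first.
        by move=> q Vq hq W s oW Wq Fs; rewrite (Eq q Vq hq W) // (Eq' q Vq hq W) // mulrDl.
      exact: is_altD.
    * move=> a phi ra aV p Vp; rewrite /= /be mulrCA; congr (_ * _).
      have [rq Eq] := quotP rs D oPV aV.
      have rr : regular (- k) V (fun q => a q * quot D V phi q).
        by apply: (regularM_deg (k := 0) (l := - k)) => //; rewrite add0r.
      apply: (quot_unique rs oPV _ rr) => //; first exact: is_altZ.
      by move=> q Vq hq W s oW Wq Fs; rewrite (Eq q Vq hq W) // mulrA.
    * by move=> W phi oW aV p Wp; congr (_ * _); apply: quot_sub Wp.
  + by move=> u v _ _ EE V phi oV _ p Vp; rewrite /be EE //; apply: zopen_sub oV Vp.
  + by move=> u v _ _ V phi oV _ p Vp; rewrite /be /= mulrDl.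
  + by move=> a u _ _ V phi oV _ p Vp; rewrite /be /= mulrA.
  + by [].
- move=> U Phi oU HPhi V phi oV aV p Vp; rewrite /be.
  have Pp := zopen_sub (zopen_trans oU oV) Vp; have Up := zopen_sub oV Vp.
  have [c pc] := P2_coord Pp.
  rewrite (PhiE U Phi V phi p c) // (alE U Phi p c) // mulrC -mulrA; congr (_ * (_ * _)).
  have [_ _ _ _ H] := HPhi _ (zopenX U c).
  apply/esym/H; [|exact: altc|by split=> //; rewrite mevalXU].
  have := zopen_trans oV (zopenX V c) => /zopen_narrow; apply.
    by move=> q [/(zopen_sub oV) Uq cq].
  by move=> q [].
- move=> U u oU ru p Up; rewrite /al /be.
  have Pp := zopen_sub oU Up; have pc := ccP p Pp.
  rewrite quot_vform_tw //.
  + by rewrite mulrCA -expfzDr // addrN expr0z mulr1.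
  + exact: zopen_trans oU (zopenX U _).
  + by move=> q; apply: chartX.
  + by split=> //; rewrite mevalXU.
Qed.

End FramedDegree.

Section FramedRank.
Variables (K : closedFieldType) (n r : nat) (k : int).
Variable F : (pt K -> Prop) -> (pt K -> 'rV[K]_n) -> Prop.
Hypothesis rs : row_subsheaf F.
Variable D : framed F r k.
Implicit Types (U V W : pt K -> Prop) (p q : pt K).

Let B := fmat D.
Let h := den D.

Lemma chart_nonempty (g : {mpoly K[3]}) : g != 0 ->
  exists p, chart (chart (@P2 K) g) 'X_ord0 p.
Proof.
move=> g0; have [p] := mpoly_neq0_eval (mulf_neq0 g0 (mpolyX_neq0 K ord0)).
rewrite mevalM mulf_eq0 negb_or => /andP [gp xp]; exists p; split=> //; split=> //.
by apply: (@coord_P2 _ _ ord0); rewrite -mevalXU.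
Qed.

Lemma framed_has_rank : has_rank (row_sheaf F) r.
Proof.
(* Off den = 0 the frame is a basis up to twists, and the nonvanishing coordinate makes the twists
   trivial. *)
pose U := chart (chart (@P2 K) h) 'X_ord0.
have oU : zopen (@P2 K) U.
  by apply: zopen_trans (zopen_den D _) (zopenX _ _).
exists U; split=> //; first exact: chart_nonempty (den_neq0 D).
have Vc V q : zopen U V -> V q -> q ord0 != 0.
  by move=> oV /(zopen_sub oV)/chartX.
have Vh V q : zopen U V -> V q -> h.@[q] != 0.
  by move=> oV /(zopen_sub oV) [[]].
exists (fun V s p => \row_j (fcoord (B p) (s p) j * p ord0 ^ fdeg D j)),
  (fun V t p => \sum_j t p 0 j *: fbasis D ord0 j p); split.
- move=> V oV; have oPV := zopen_trans oU oV.
  have VP q : V q -> P2 q by apply: zopen_sub oPV.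
  split.
  + move=> s Fs j; have [_ rB] := fmat_gen D oPV Fs.
    have rb : regular 0 V (fun q => fcoord (B q) (s q) j * q ord0 ^ fdeg D j).
      apply: (regularM_deg (k := - fdeg D j) (l := fdeg D j)) => //.
      - by rewrite addNr.
      - by apply: regular_sub (rB j) => q Vq; split=> //; apply: Vh oV Vq.
      - by apply: regular_coordX => q; apply: Vc.
    by apply: eq_regular rb => q Vq; rewrite mxE.
  + by move=> s t Fs Ft E p Vp; rewrite E.
  + by move=> s t Fs Ft p Vp; apply/rowP => j; rewrite !mxE fcoordD mulrDl.
  + by move=> c s rc Fs p Vp; apply/rowP => j; rewrite !mxE fcoordZ mulrA.
  + by [].
- move=> V oV; have oPV := zopen_trans oU oV.
  have VP q : V q -> P2 q by apply: zopen_sub oPV.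
  split.
  + move=> t rt; pose ev (y : pt K -> 'rV[K]_n) : K^o := 0.
    have Fb j : F V (fbasis D ord0 j) by apply: fmat_sec => // q; apply: Vc.
    have [] // := @section_sum K n V F K^o ev 0 r (fun j q => t q 0 j) (fbasis D ord0).
    * exact: rs_zero.
    * by move=> s s'; apply: rs_add.
    * by move=> c s; apply: rs_scale.
    * by move=> *; rewrite addr0.
    * by move=> *; rewrite scaler0.
  + by move=> s t Fs Ft E p Vp; apply: eq_bigr => j _; rewrite E.
  + move=> s t Fs Ft p Vp; rewrite /= -big_split; apply: eq_bigr => j _.
    by rewrite mxE scalerDl.
  + move=> c s rc Fs p Vp; rewrite /= scaler_sumr; apply: eq_bigr => j _.
    by rewrite mxE scalerA.
  + by [].
- move=> V s oV Fs p Vp; have oPV := zopen_trans oU oV.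
  have [sB _] := fmat_gen D oPV Fs.
  have hp := Vh V p oV Vp; rewrite -[RHS](fcoordK (sB p Vp hp)).
  apply: eq_bigr => j _; rewrite mxE /fbasis /twist_row scalerA -mulrA.
  by rewrite -expfzDr ?(Vc V) // addrN expr0z mulr1.
- move=> V t oV rt p Vp; apply/rowP => j; rewrite mxE.
  have -> : \sum_j t p 0 j *: fbasis D ord0 j p =
      \sum_j (t p 0 j * p ord0 ^ (- fdeg D j)) *: row j (B p).
    by apply: eq_bigr => i _; rewrite scalerA.
  rewrite fcoord_sum; last by apply: fmat_free; apply: Vh oV Vp.
  by rewrite -mulrA -expfzDr ?(Vc V) // addNr expr0z mulr1.
Qed.

Lemma framed_has_degree : has_degree (row_sheaf F) k.
Proof. by exists r; [exact: framed_has_rank | exact: framed_has_degree_iso]. Qed.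

Lemma framed_nonzero : (0 < r)%N -> nonzero_sheaf (row_sheaf F).
Proof.
move=> r0; have [p [[Pp hp] cp]] := chart_nonempty (den_neq0 D).
pose j := Ordinal r0.
have oV : zopen (@P2 K) (chart (@P2 K) 'X_ord0) by apply: zopenX.
exists (chart (@P2 K) 'X_ord0), (fbasis D ord0 j); split=> //.
  by apply: fmat_sec => // q; apply: chartX.
move=> /(_ p (conj Pp cp)) E.
have := coord_fbasis ord0 j j hp; rewrite E eqxx mulr1.
have -> : fcoord (fmat D p) (szero (row_sheaf F) p) j = 0.
  by rewrite /fcoord mul0mx mxE.
move/esym/eqP; apply/negP; rewrite expfz_neq0 //.
by rewrite mevalXU in cp.
Qed.

End FramedRank.

(** * Subsheaves of the syzygy bundle and their slopes *)

Definition prow (K : closedFieldType) n (g : 'I_n -> {mpoly K[3]}) (p : pt K) :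
  'rV[K]_n := \row_i (g i).@[p].

(** The image of the sum of the O(- m j) under the columns sg j. Being combinations only locally,
    these sections are closed under gluing. *)
Definition gen_sec (K : closedFieldType) n (J : finType)
    (sg : J -> 'I_n -> {mpoly K[3]}) (m : J -> nat)
    (U : pt K -> Prop) (s : pt K -> 'rV[K]_n) : Prop :=
  forall p, U p -> exists V (c : J -> pt K -> K),
    [/\ zopen U V, V p, forall j, regular (- (m j)%:Z) V (c j) &
        forall q, V q -> s q = \sum_j c j q *: prow (sg j) q].

Section SyzSheaf.
Variables (K : closedFieldType) (n : nat).
Variables (f : 'I_n -> {mpoly K[3]}) (d : 'I_n -> nat).
Implicit Types (U V W : pt K -> Prop) (p q : pt K).

Lemma syz_row_subsheaf : row_subsheaf (syz_sec f d).
Proof.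
split.
- move=> U V s oU oV [rs fs]; split; first by move=> i; apply: regular_zopen oV (rs i).
  by move=> p /(zopen_sub oV); apply: fs.
- move=> U s t oU E [rs fs]; split.
    by move=> i; apply: (eq_regular _ (rs i)) => p Up; rewrite E.
  by move=> p Up; rewrite -E //; apply: fs.
- move=> U oU; have UP p : U p -> P2 p by apply: zopen_sub oU.
  split=> [i|p Up].
    by apply: (eq_regular _ (regular0 _ UP)) => p Up; rewrite mxE.
  by rewrite big1 // => i _; rewrite mxE mulr0.
- move=> U s t oU [rs fs] [rt ft]; have UP p : U p -> P2 p by apply: zopen_sub oU.
  split=> [i|p Up].
    by apply: (eq_regular _ (regularD UP (rs i) (rt i))) => p Up; rewrite mxE.
  rewrite (eq_bigr (fun i => (f i).@[p] * s p 0 i + (f i).@[p] * t p 0 i)).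
    by rewrite big_split /= fs // ft // addr0.
  by move=> i _; rewrite mxE mulrDr.
- move=> U c s oU rc [rs fs]; have UP p : U p -> P2 p by apply: zopen_sub oU.
  split=> [i|p Up].
    have := regularM UP rc (rs i); rewrite add0r => rr.
    by apply: (eq_regular _ rr) => p Up; rewrite mxE.
  rewrite (eq_bigr (fun i => c p * ((f i).@[p] * s p 0 i))).
    by rewrite -mulr_sumr fs // mulr0.
  by move=> i _; rewrite mxE mulrCA.
Qed.

Variables (J : finType) (sg : J -> 'I_n -> {mpoly K[3]}) (m : J -> nat).
Hypothesis sg_homog : forall j i, zhomog ((m j)%:Z - (d i)%:Z) (sg j i).
Hypothesis sg_syz : forall j, \sum_i f i * sg j i = 0.

Lemma prow_syz j p : \sum_i (f i).@[p] * prow (sg j) p 0 i = 0.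
Proof.
transitivity ((\sum_i f i * sg j i).@[p]); last by rewrite sg_syz meval0.
by rewrite [RHS]raddf_sum; apply: eq_bigr => i _; rewrite mxE -mevalM.
Qed.

Lemma gen_sub_syz U s : zopen (@P2 K) U -> gen_sec sg m U s -> syz_sec f d U s.
Proof.
move=> oU gs; have UP p : U p -> P2 p by apply: zopen_sub oU.
split=> [i|p Up].
  apply: regular_local => // p Up; have [V [c [oV Vp rc Es]]] := gs p Up.
  exists V; split=> //; have VP q : V q -> P2 q by move=> /(zopen_sub oV)/UP.
  have : regular (- (d i)%:Z) V (fun q => \sum_j c j q * (sg j i).@[q]).
    apply: regular_sum => // j _.
    apply: (regularM_deg (k := - (m j)%:Z) (l := (m j)%:Z - (d i)%:Z)) => //.
      by rewrite addrA addNr add0r.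
    exact: regular_poly.
  apply: eq_regular => q Vq; rewrite Es // summxE.
  by apply: eq_bigr => j _; rewrite !mxE.
have [V [c [oV Vp rc Es]]] := gs p Up.
rewrite Es // (eq_bigr (fun i => \sum_j c j p * ((f i).@[p] * prow (sg j) p 0 i))).
  rewrite exchange_big big1 //= => j _; by rewrite -mulr_sumr prow_syz mulr0.
move=> i _; rewrite summxE mulr_sumr; apply: eq_bigr => j _.
by rewrite !mxE mulrCA.
Qed.

Lemma gen_row_subsheaf : row_subsheaf (gen_sec sg m).
Proof.
split.
- move=> U V s oU oV gs p Vp; have [W [c [oW Wp rc Es]]] := gs p (zopen_sub oV Vp).
  have sVU q : V q -> U q by apply: zopen_sub oV.
  exists (fun q => V q /\ W q), c; split=> //.
  + exact: zopen_cap oW sVU.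
  + by move=> j; apply: regular_sub (rc j) => q [].
  + by move=> q [_]; apply: Es.
- move=> U s t oU E gs p Up; have [W [c [oW Wp rc Es]]] := gs p Up.
  exists W, c; split=> // q Wq; rewrite -Es //; apply/esym/E; exact: zopen_sub oW Wq.
- move=> U oU p Up; exists U, (fun _ _ => 0); split=> //.
  + exact: zopen_refl.
  + by move=> j; apply: regular0 => q; apply: zopen_sub oU.
  + by move=> q _; rewrite big1 // => j _; rewrite scale0r.
- move=> U s t oU gs gt p Up; have [V [c [oV Vp rc Es]]] := gs p Up.
  have [W [c' [oW Wp rc' Et]]] := gt p Up.
  have oVW : zopen U (fun q => V q /\ W q).
    by apply: (zopen_trans oV); apply: (zopen_cap oW) => q; apply: zopen_sub.
  have VWP q : V q /\ W q -> P2 q by move=> /(zopen_sub oVW) /(zopen_sub oU).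
  exists (fun q => V q /\ W q), (fun j q => c j q + c' j q); split=> //.
  + move=> j; apply: regularD => //.
      by apply: regular_sub (rc j) => q [].
    by apply: regular_sub (rc' j) => q [].
  + move=> q [Vq Wq]; rewrite Es // Et // -big_split; apply: eq_bigr => j _.
    by rewrite scalerDl.
- move=> U a s oU ra gs p Up; have [V [c [oV Vp rc Es]]] := gs p Up.
  exists V, (fun j q => a q * c j q); split=> //.
  + move=> j; apply: (regularM_deg (k := 0) (l := - (m j)%:Z)) => //.
    * by rewrite add0r.
    * by move=> q /(zopen_sub oV) /(zopen_sub oU).
    * exact: regular_zopen oV ra.
  + move=> q Vq; rewrite Es // scaler_sumr; apply: eq_bigr => j _.
    by rewrite scalerA.
Qed.

Lemma gen_twist c V j : zopen (@P2 K) V -> (forall p, V p -> p c != 0) ->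
  gen_sec sg m V (fun p => p c ^ (- (m j)%:Z) *: prow (sg j) p).
Proof.
move=> oV Vc p Vp; exists V, (fun i q => if i == j then q c ^ (- (m j)%:Z) else 0).
split=> //; first exact: zopen_refl.
  move=> i; case: eqP => [->|_]; first exact: regular_coordX.
  by apply: regular0 => q; apply: zopen_sub oV.
move=> q Vq; rewrite (bigD1 j) //= eqxx big1 ?addr0 // => i /negPf ->.
by rewrite scale0r.
Qed.

Lemma gen_coherent : @coherent_subsheaf K (Syz f d) (gen_sec sg m).
Proof.
have gr := gen_row_subsheaf; split; [split|].
- move=> U oU; split.
  + by move=> s; apply: gen_sub_syz.
  + exact: rs_zero gr _ oU.
  + by move=> s t; apply: rs_add gr _ _ _ oU.
  + by move=> c s; apply: rs_scale gr _ _ _ oU.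
  + by move=> V s oV; apply: rs_sub gr _ _ _ oU oV.
- move=> U s oU _ H p Up; have [V [t [oV Vp gt E]]] := H p Up.
  have [W [c [oW Wp rc Et]]] := gt p Vp; exists W, c; split=> //.
    exact: zopen_trans oV oW.
  by move=> q Wq; rewrite -Et //; apply: E; apply: zopen_sub oW Wq.
- move=> p Pp; have [c pc] := P2_coord Pp.
  pose V := chart (@P2 K) 'X_c; have oV : zopen (@P2 K) V := zopenX _ c.
  have Vc q : V q -> q c != 0 by case=> _; rewrite mevalXU.
  pose j0 (i : 'I_#|J|) : J := enum_val i.
  exists V, #|J|, (fun i q => q c ^ (- (m (j0 i))%:Z) *: prow (sg (j0 i)) q).
  split=> //; first by split=> //; rewrite mevalXU.
    by move=> i; apply: gen_twist.
  move=> W t q oW gt Wq; have [W' [a [oW' W'q ra Et]]] := gt q Wq.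
  have W'c x : W' x -> x c != 0 by move=> /(zopen_sub oW')/(zopen_sub oW)/Vc.
  exists W', (fun i x => a (j0 i) x * x c ^ (m (j0 i))%:Z); split=> //.
    move=> i; apply: (regularM_deg (k := - (m (j0 i))%:Z) (l := (m (j0 i))%:Z)) => //.
    + by rewrite addNr.
    + by move=> x /W'c /coord_P2.
    + exact: regular_coordX.
  move=> x W'x; rewrite Et // (reindex _ (onW_bij _ (@enum_val_bij J))) /=.
  elim: (index_enum _) => [|i l IH]; first by rewrite !big_nil.
  rewrite !big_cons IH /=; congr (_ + _).
  by rewrite scalerA -mulrA -expfzDr ?W'c // addrN expr0z mulr1.
Qed.

End SyzSheaf.

(** * Koszul syzygies: minors, frames and degree *)

Section KoszulMinors.
Variables (K : fieldType) (m : nat) (phi : 'I_(1 + m) -> K).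
Let c0 : 'I_(1 + m) := lshift m 0.

Definition kosz_mx : 'M[K]_(m, 1 + m) :=
  row_mx (- \col_j phi (rshift 1 j)) (phi c0)%:M.

(** The determinant is the signed maximal minor of S without column i. *)
Definition with_unit_row (i : 'I_(1 + m)) (S : 'M[K]_(m, 1 + m)) : 'M[K]_(1 + m) :=
  col_mx (delta_mx 0 i) S.

Lemma det_with_unit_rowM i (C : 'M_m) (S : 'M[K]_(m, 1 + m)) :
  \det (with_unit_row i (C *m S)) = \det C * \det (with_unit_row i S).
Proof.
have -> : with_unit_row i (C *m S) = block_mx 1%:M 0 0 C *m with_unit_row i S.
  by rewrite /with_unit_row mul_block_col mul1mx !mul0mx addr0 add0r.
by rewrite det_mulmx det_ublock det1 mul1r.
Qed.

(** Multiplying on the right by a block triangular matrix with first column phi and determinant phi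
    c0 kills the lower left block. The extra factor phi c0 avoids the exponent m - 1. *)
Lemma det_kosz_mx i :
  \det (with_unit_row i kosz_mx) * phi c0 = phi i * phi c0 ^+ m.
Proof.
pose d : 'rV[K]_(1 + m) := delta_mx 0 i.
have -> : phi c0 = \det (block_mx (phi c0)%:M 0 (\col_j phi (rshift 1 j)) (1%:M : 'M_m)).
  by rewrite det_lblock det1 mulr1 det_scalar expr1.
rewrite -det_mulmx det_lblock det_scalar expr1 det1 mulr1.
rewrite /with_unit_row -/d -[d]hsubmxK -/(block_mx _ _ _ _) mulmx_block.
rewrite !mulmx0 !mulmx1 !mul_mx_scalar !mul_scalar_mx scalerN addNr.
rewrite !add0r det_ublock det_scalar; congr (_ * _).
rewrite [X in \det X](_ : _ = (phi i)%:M) ?det_scalar ?expr1 //.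
apply/matrixP => x y; rewrite !ord1 !mxE /= mulr1n.
rewrite (eq_bigr (fun j => (rshift 1 j == i)%:R * phi (rshift 1 j))); last first.
  by move=> j _; rewrite !mxE.
rewrite mulrC -/c0.
case: (split_ordP i) => [o ->|j ->].
  rewrite ord1 -/c0 eqxx mul1r big1 ?addr0 // => j _.
  by rewrite eq_sym eq_lrshift mul0r.
rewrite eq_lrshift mul0r add0r (bigD1 j) //= eqxx mul1r big1 ?addr0 // => l lj.
by rewrite (inj_eq (@rshift_inj 1 m)) (negPf lj) mul0r.
Qed.

End KoszulMinors.

Section KoszulFrame.
Variables (K : closedFieldType) (n r : nat).
Variables (f : 'I_n -> {mpoly K[3]}) (d : 'I_n -> nat).
Hypothesis f_homog : forall i, f i \is (d i).-homog.
Variable iota : 'I_(1 + r.+1) -> 'I_n.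
Hypothesis iota_inj : injective iota.
Implicit Types (U V W : pt K -> Prop) (p q : pt K).

Let c0 : 'I_(1 + r.+1) := lshift r.+1 0.

Definition koszul (a b : 'I_(1 + r.+1)) (p : pt K) : 'rV[K]_n :=
  (f (iota a)).@[p] *: delta_mx 0 (iota b) - (f (iota b)).@[p] *: delta_mx 0 (iota a).

Variable F : (pt K -> Prop) -> (pt K -> 'rV[K]_n) -> Prop.
Hypothesis rs : row_subsheaf F.
Hypothesis F_syz : forall V s, zopen (@P2 K) V -> F V s -> syz_sec f d V s.
Hypothesis F_supp : forall V s p i, zopen (@P2 K) V -> F V s -> V p ->
  (forall a, i != iota a) -> s p 0 i = 0.
Hypothesis F_koszul : forall c V a b, zopen (@P2 K) V ->
  (forall p, V p -> p c != 0) ->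
  F V (fun p => p c ^ (- (d (iota a) + d (iota b))%N%:Z) *: koszul a b p).
Hypothesis f0 : f (iota c0) != 0.
Hypothesis f_line : nozero_on_line (fun a => f (iota a)).

Definition kmat (p : pt K) : 'M[K]_(r.+1, n) :=
  \matrix_(j, i) koszul c0 (rshift 1 j) p 0 i.

(** Not only the pivot but every nonzero form must be invertible off [kden], as each of them serves
    as pivot of a test tuple. *)
Definition kden : {mpoly K[3]} := \prod_(a | f (iota a) != 0) f (iota a).

Definition restr_mx (s : 'I_r.+1 -> pt K -> 'rV[K]_n) (p : pt K) :
  'M[K]_(r.+1, 1 + r.+1) := \matrix_(a, b) s a p 0 (iota b).

Lemma row_kmat j p : row j (kmat p) = koszul c0 (rshift 1 j) p.
Proof. by apply/rowP => i; rewrite !mxE. Qed.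

Lemma koszulE a b p i : koszul a b p 0 i =
  (f (iota a)).@[p] * (i == iota b)%:R - (f (iota b)).@[p] * (i == iota a)%:R.
Proof. by rewrite !mxE !eqxx. Qed.

Lemma kden_neq0 a p : kden.@[p] != 0 -> f (iota a) != 0 -> (f (iota a)).@[p] != 0.
Proof. by move=> + fa; rewrite /kden (bigD1 a) //= mevalM mulf_eq0 negb_or => /andP []. Qed.

Lemma sum_iota (x : 'rV[K]_n) (g : 'I_n -> K) :
  (forall i, (forall a, i != iota a) -> x 0 i = 0) ->
  \sum_i g i * x 0 i = \sum_a g (iota a) * x 0 (iota a).
Proof.
move=> x0; rewrite (bigID (mem (codom iota))) /= [X in _ + X]big1 ?addr0; last first.
  move=> i /codomP ni; rewrite x0 ?mulr0 // => a; apply/eqP => E.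
  by apply: ni; exists a.
rewrite -(big_uniq _ (F := fun i => g i * x 0 i)) /=; last first.
  by rewrite map_inj_uniq ?enum_uniq.
by rewrite big_map big_enum.
Qed.

Lemma koszul_expand (x : 'rV[K]_n) p : (f (iota c0)).@[p] != 0 ->
  (forall i, (forall a, i != iota a) -> x 0 i = 0) ->
  \sum_i (f i).@[p] * x 0 i = 0 ->
  x = \sum_j (x 0 (iota (rshift 1 j)) / (f (iota c0)).@[p]) *: row j (kmat p).
Proof.
move=> fp x0 /eqP; rewrite (sum_iota _ x0) big_split_ord big_ord1 /=.
rewrite -/c0 addr_eq0 => /eqP E; apply/rowP => i; rewrite summxE.
rewrite [RHS](eq_bigr (fun j => x 0 (iota (rshift 1 j)) / (f (iota c0)).@[p] *
    ((f (iota c0)).@[p] * (i == iota (rshift 1 j))%:R -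
     (f (iota (rshift 1 j))).@[p] * (i == iota c0)%:R))); last first.
  by move=> j _; rewrite row_kmat mxE koszulE.
case: (classic (exists a, i = iota a)) => [[a ->]|ni]; last first.
  have ni' a : i != iota a by apply/eqP => E'; apply: ni; exists a.
  rewrite x0 // big1 // => j _.
  by rewrite !(negPf (ni' _)) !mulr0 subrr mulr0.
under [RHS]eq_bigr do rewrite !(inj_eq iota_inj).
case: (split_ordP a) => [o ->|l ->].
  rewrite ord1 -/c0.
  apply: (mulfI fp); rewrite E mulr_sumr -sumrN; apply: eq_bigr => j _.
  by rewrite eqxx mulr1 eq_lrshift mulr0 sub0r; field.
rewrite (bigD1 l) // eqxx [_ == c0]eq_sym eq_lrshift mulr0 subr0 mulr1 divfK //.
rewrite [X in _ = _ X]big1; first by rewrite /= addr0.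
by move=> j jl; rewrite (inj_eq (@rshift_inj 1 r.+1)) eq_sym (negPf jl) !mulr0 subrr mulr0.
Qed.

Lemma kmat_free p : (f (iota c0)).@[p] != 0 -> row_free (kmat p).
Proof.
move=> fp; apply/row_freeP.
exists (\matrix_(i, j) ((f (iota c0)).@[p]^-1 * (i == iota (rshift 1 j))%:R)).
apply/matrixP => j l; rewrite [LHS]mxE (bigD1 (iota (rshift 1 l))) //.
rewrite [X in _ _ X = _]big1 /=; last first.
  by move=> i /negPf il; rewrite [X in _ * X]mxE il !mulr0.
rewrite addr0 [kmat p j _]mxE koszulE !mxE eqxx !(inj_eq iota_inj).
rewrite [_ == c0]eq_sym eq_lrshift mulr0 subr0 mulr1.
rewrite (inj_eq (@rshift_inj 1 r.+1)) eq_sym.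
by case: eqP; rewrite ?mulr1 ?divff // mulr0 mul0r.
Qed.

Lemma fcoord_kmat (x : 'rV[K]_n) p j : (f (iota c0)).@[p] != 0 ->
  (forall i, (forall a, i != iota a) -> x 0 i = 0) ->
  \sum_i (f i).@[p] * x 0 i = 0 ->
  fcoord (kmat p) x j = x 0 (iota (rshift 1 j)) / (f (iota c0)).@[p].
Proof.
move=> fp x0 xs; rewrite {1}(koszul_expand fp x0 xs) fcoord_sum //.
exact: kmat_free.
Qed.

(** Cramer's rule: writing the syzygies in the Koszul basis factors their matrix through [kosz_mx],
    so the minor without column a is f (iota a) times a factor independent of a. This factor is the
    volume, whence the choice (f c0)^r for [vol]. *)
Lemma det_restr_mx (s : 'I_r.+1 -> pt K -> 'rV[K]_n) p (a : 'I_(1 + r.+1)) :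
  (f (iota c0)).@[p] != 0 ->
  (forall l i, (forall b, i != iota b) -> s l p 0 i = 0) ->
  (forall l, \sum_i (f i).@[p] * s l p 0 i = 0) ->
  \det (with_unit_row a (restr_mx s p)) =
  (f (iota a)).@[p] * (\det (stack kmat s p) * (f (iota c0)).@[p] ^+ r).
Proof.
move=> fp s0 ss; pose phi b := (f (iota b)).@[p].
have -> : restr_mx s p = stack kmat s p *m kosz_mx phi.
  apply/matrixP => l b; rewrite [LHS]mxE (koszul_expand fp (s0 l) (ss l)) summxE mxE.
  apply: eq_bigr => j _; rewrite [LHS]mxE row_kmat koszulE [X in _ = X * _]mxE.
  rewrite (fcoord_kmat _ fp (s0 l) (ss l)); congr (_ * _); rewrite !(inj_eq iota_inj) /kosz_mx.
  case: (split_ordP b) => [o ->|l' ->].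
    by rewrite ord1 row_mxEl !mxE -/c0 eqxx eq_lrshift mulr0 sub0r mulr1.
  rewrite row_mxEr !mxE [_ == c0]eq_sym eq_lrshift mulr0 subr0.
  rewrite (inj_eq (@rshift_inj 1 r.+1)) eq_sym -/c0.
  by case: eqP; rewrite ?mulr1 ?mulr1n ?mulr0 ?mulr0n.
rewrite det_with_unit_rowM; apply: (mulIf fp).
have := det_kosz_mx phi a; rewrite -/c0 -mulrA => ->.
rewrite exprS /phi; ring.
Qed.

Definition lift_mx (i : 'I_(1 + r.+1)) : 'M[K]_(r.+1, 1 + r.+1) :=
  \matrix_(l, b) (b == lift i l)%:R.

(** The matrix is a permutation matrix, hence orthogonal; the sign itself is never computed. *)
Lemma det_lift_mx i : \det (with_unit_row i (lift_mx i)) != 0.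
Proof.
set N := with_unit_row _ _.
suff E : N *m N^T = 1%:M.
  have := congr1 determinant E; rewrite det_mulmx det1 => /eqP.
  by apply: contraTneq => ->; rewrite mul0r eq_sym oner_eq0.
rewrite /N /with_unit_row tr_col_mx mul_col_row scalar_mx_block.
congr block_mx; apply/matrixP => x y; rewrite !mxE.
- rewrite !ord1 (bigD1 i) //= !mxE !eqxx mulr1 big1 ?addr0 // => b /negPf bi.
  by rewrite !mxE bi andbF mul0r.
- rewrite big1 // => b _; rewrite !mxE ord1 eqxx /=.
  by case: eqP => [->|]; rewrite ?mul0r // (negPf (neq_lift _ _)) mulr0.
- rewrite big1 // => b _; rewrite !mxE ord1 eqxx /= mulrC.
  by case: eqP => [->|]; rewrite ?mul0r // (negPf (neq_lift _ _)) mulr0.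
- rewrite (bigD1 (lift i x)) //= !mxE eqxx mul1r (inj_eq (@lift_inj _ i)).
  rewrite big1 ?addr0 // => b /negPf bi; by rewrite !mxE bi mul0r.
Qed.

Lemma det_restr_koszul i p :
  \det (with_unit_row i (restr_mx (fun l => koszul i (lift i l)) p)) =
  (f (iota i)).@[p] ^+ r.+1 * \det (with_unit_row i (lift_mx i)).
Proof.
pose g := (f (iota i)).@[p].
rewrite -[g ^+ _](_ : \det (block_mx (1%:M : 'M_1) 0
  (- \col_l (f (iota (lift i l))).@[p]) (g%:M : 'M_r.+1)) = _); last first.
  by rewrite det_lblock det1 mul1r det_scalar.
rewrite -det_mulmx; congr (\det _).
rewrite /with_unit_row mul_block_col mul1mx mul0mx addr0; congr col_mx.
apply/matrixP => l b; rewrite mul_scalar_mx mulNmx !mxE big_ord1 !mxE.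
rewrite !eqxx !(inj_eq iota_inj) /= /g addrC.
by [].
Qed.

(** The volume form is the minor without column a divided by f (iota a), for any a, so it extends by
    Hartogs. On the Koszul syzygies with pivot a it equals, up to sign, f (iota a)^r, and these
    values have no common zero on the line of [f_line]. *)
Definition koszul_frame : framed F r.+1 (- \sum_a (d (iota a))%:Z).
Proof.
have fc0 p : kden.@[p] != 0 -> (f (iota c0)).@[p] != 0.
  by move=> /kden_neq0; apply.
have supp V s p : zopen (@P2 K) V -> (forall l, F V (s l)) -> V p ->
    forall (l : 'I_r.+1) i, (forall b, i != iota b) -> s l p 0 i = 0.
  by move=> oV Fs Vp l i; apply: F_supp oV (Fs l) Vp.
have syz V s p : zopen (@P2 K) V -> (forall l, F V (s l)) -> V p ->
    forall (l : 'I_r.+1), \sum_i (f i).@[p] * s l p 0 i = 0.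
  by move=> oV Fs Vp l; have [_] := F_syz oV (Fs l); apply.
pose T : finType := {a : 'I_(1 + r.+1) | f (iota a) != 0}.
refine (@Framed K n F r.+1 _ kden
  (fun j => (d (iota c0) + d (iota (rshift 1 j)))%N%:Z) kmat
  (fun p => (f (iota c0)).@[p] ^+ r) T
  (fun t l => (d (iota (val t)) + d (iota (lift (val t) l)))%N%:Z)
  (fun t l => koszul (val t) (lift (val t) l))
  (fun t => \det (with_unit_row (val t) (lift_mx (val t))) *: f (iota (val t)) ^+ r)
  (fun t => (d (iota (val t)) * r)%N) _ _ _ _ _ _ _ _ _ _ _ _ _).
- exists (\sum_(a | f (iota a) != 0%R) d (iota a))%N.
  by apply: dhomog_bigprod => a _; apply: f_homog.
- by apply/prodf_neq0.
- by move=> p /fc0; apply: kmat_free.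
- move=> c V j oV Vc; have := F_koszul c0 (rshift 1 j) oV Vc.
  by apply: rs_eq rs _ _ _ oV _ => p Vp; rewrite row_kmat.
- move=> V s oV Fs; have [rsec ssyz] := F_syz oV Fs.
  have VP q : V q -> P2 q by apply: zopen_sub oV.
  split=> [p Vp /fc0 fp|j].
    have sp i : (forall b, i != iota b) -> s p 0 i = 0 by apply: F_supp oV Fs Vp.
    rewrite (koszul_expand fp sp (ssyz p Vp)).
    by apply: summx_sub => j _; apply: scalemx_sub; apply: row_sub.
  have WP q : chart V kden q -> P2 q by case=> /VP.
  have rr : regular (- (d (iota c0) + d (iota (rshift 1 j)))%N%:Z) (chart V kden)
      (fun p => s p 0 (iota (rshift 1 j)) * (f (iota c0)).@[p]^-1).
    apply: (regularM_deg (k := - (d (iota (rshift 1 j)))%:Z) (l := - (d (iota c0))%:Z)) => //.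
    - by rewrite PoszD; ring.
    - by apply: regular_sub (rsec _) => q [].
    - apply: regularV => //; first by move=> p [_ /fc0].
      by apply: regular_poly => //; apply: f_homog.
  apply: eq_regular rr => p [Vp /fc0 fp].
  have sp i : (forall b, i != iota b) -> s p 0 i = 0 by apply: F_supp oV Fs Vp.
  by rewrite (fcoord_kmat _ fp sp (ssyz p Vp)).
- by move=> p /fc0 fp; rewrite expf_neq0.
- move=> V s oV Fs; have VP q : V q -> P2 q by apply: zopen_sub oV.
  apply: (extends_quotient (h := fun a => f (iota a)) (delta := fun a => d (iota a))
    (u := fun a p => \det (with_unit_row a (restr_mx s p)))) => //.
  + by apply/prodf_neq0.
  + move=> a.
    (* Row degrees for [regular_det]: the unit row gets d (iota a), so that its entry 1 in column a
       has degree 0. *)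
    pose al (x : 'I_(1 + r.+1)) : int := if split x is inl _ then (d (iota a))%:Z else 0.
    have alL o : al (lshift r.+1 o) = (d (iota a))%:Z by rewrite /al (unsplitK (inl o)).
    have alR l : al (rshift 1 l) = 0 by rewrite /al (unsplitK (inr l)).
    have -> : - (\sum_b (d (iota b))%:Z) + (d (iota a))%:Z =
        \sum_x al x + \sum_b (- (d (iota b))%:Z).
      rewrite sumrN addrC; congr (_ + _).
      rewrite big_split_ord big_ord1 alL big1 /=; first by rewrite addr0.
      by move=> x _; exact: alR.
    apply: regular_det => // x b.
    case: (split_ordP x) => [o ->|l ->].
      rewrite alL; case: (eqVneq b a) => [->|ba].
        rewrite addrN; apply: (eq_regular _ (regular_const 1 VP)) => p _.
        by rewrite col_mxEu ord1 mxE !eqxx.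
      apply: (eq_regular _ (regular0 _ VP)) => p _.
      by rewrite col_mxEu ord1 mxE (negPf ba) andbF.
    rewrite alR add0r; have [rsec _] := F_syz oV (Fs l).
    apply: (eq_regular _ (rsec (iota b))) => p _.
    by rewrite col_mxEd mxE.
  + move=> a p Vp /fc0 fp; apply: det_restr_mx => //; [exact: supp Vp | exact: syz Vp].
  + by move=> p Vp /fc0 fp; exists c0.
- by move=> c V [a fa] l oV Vc; apply: F_koszul.
- move=> [a fa] p Pp hp; have fp := fc0 p hp; have fap := kden_neq0 hp fa.
  have [c pc] := P2_coord Pp; have oV := zopenX (@P2 K) c.
  pose s l := koszul a (lift a l).
  have sE l i : (forall b, i != iota b) -> s l p 0 i = 0.
    by move=> ni; rewrite koszulE !(negPf (ni _)) !mulr0 subrr.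
  have ss l : \sum_i (f i).@[p] * s l p 0 i = 0.
    rewrite sum_iota; last exact: sE.
    under eq_bigr do rewrite koszulE !(inj_eq iota_inj) mulrBr.
    rewrite sumrB (bigD1 (lift a l)) //= eqxx [X in _ + X - _]big1 ?addr0; last first.
      by move=> b /negPf ->; rewrite !mulr0.
    rewrite (bigD1 a) //= eqxx big1 ?addr0; first by rewrite !mulr1 mulrC subrr.
    by move=> b /negPf ->; rewrite !mulr0.
  apply: (mulfI fap); rewrite -(det_restr_mx a fp sE ss) det_restr_koszul.
  by rewrite /= mevalZ rmorphXn /= exprS; ring.
- by move=> [a fa] /=; apply: dhomogZ; apply: dhomogMn.
- move=> [a fa] /=; under eq_bigr do rewrite PoszD.
  rewrite big_split /= sumr_const card_ord.
  rewrite (bigD1_ord a) //= -mulr_natr PoszM; ring.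
- have [l l0 lz] := f_line; exists l => // p /lz [a fap].
  have fa : f (iota a) != 0 by apply: contraNneq fap => ->; rewrite meval0.
  exists (Sub a fa : T) => /=; rewrite mevalZ rmorphXn mulf_neq0 ?det_lift_mx //.
  exact: expf_neq0.
- move=> p Pp /fc0 fp; exists (Sub c0 f0 : T).
  by rewrite /= mevalZ rmorphXn mulf_neq0 ?det_lift_mx // expf_neq0.
Defined.

End KoszulFrame.

Lemma enum_with_first n (I : {set 'I_n}) i0 r : i0 \in I -> #|I| = r.+2 ->
  exists iota : 'I_(1 + r.+1) -> 'I_n, [/\ injective iota,
    iota (lshift r.+1 0) = i0 & forall i, i \in I <-> exists a, i = iota a].
Proof.
move=> i0I cI; have cI' : #|I :\ i0| = r.+1 by move: cI; rewrite (cardsD1 i0) i0I => -[].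
pose g (j : 'I_r.+1) := enum_val (cast_ord (esym cI') j).
have gI j : g j \in I :\ i0 by apply: enum_valP.
have ginj : injective g by move=> x y /enum_val_inj/cast_ord_inj.
pose iota (a : 'I_(1 + r.+1)) := if split a is inr j then g j else i0.
have iL o : iota (lshift r.+1 o) = i0 by rewrite /iota (unsplitK (inl o)).
have iR j : iota (rshift 1 j) = g j by rewrite /iota (unsplitK (inr j)).
have gi0 j : g j != i0 by have := gI j; rewrite !inE => /andP [].
exists iota; split=> //.
  move=> a b; case: (split_ordP a) => [o ->|j ->]; case: (split_ordP b) => [o' ->|j' ->];
    rewrite ?iL ?iR.
  - by rewrite !ord1.
  - by move=> E; have := gi0 j'; rewrite -E eqxx.
  - by move=> E; have := gi0 j; rewrite E eqxx.
  - by move=> /ginj ->.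
move=> i; split=> [iI|[a ->]]; last first.
  case: (split_ordP a) => [o ->|j ->]; rewrite ?iL ?iR //.
  by have := gI j; rewrite !inE => /andP [].
case: (eqVneq i i0) => [->|ii0]; first by exists (lshift r.+1 0); rewrite iL.
have iI' : i \in I :\ i0 by rewrite !inE ii0.
exists (rshift 1 (cast_ord cI' (enum_rank_in iI' i))).
by rewrite iR /g cast_ordK enum_rankK_in.
Qed.

(** * Slope inequalities from semistability *)

Section Slopes.
Variables (K : closedFieldType) (n : nat).
Variables (f : 'I_n -> {mpoly K[3]}) (d : 'I_n -> nat).
Hypothesis f_homog : forall i, f i \is (d i).-homog.

Definition kosz_poly (ab : 'I_n * 'I_n) (i : 'I_n) : {mpoly K[3]} :=
  f ab.1 *+ (i == ab.2) - f ab.2 *+ (i == ab.1).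

Lemma kosz_poly_homog ab i :
  zhomog ((d ab.1 + d ab.2)%N%:Z - (d i)%:Z) (kosz_poly ab i).
Proof.
apply: zhomogD; last apply: zhomogN.
  case: eqP => [->|_]; last exact: zhomog0.
  by rewrite PoszD addrK; apply: f_homog.
case: eqP => [->|_]; last exact: zhomog0.
by rewrite PoszD addrC addKr; apply: f_homog.
Qed.

Lemma kosz_poly_syz ab : \sum_i f i * kosz_poly ab i = 0.
Proof.
have S a (g : {mpoly K[3]}) : \sum_i f i * (g *+ (i == a)) = f a * g.
  rewrite (bigD1 a) //= eqxx big1 ?addr0 // => i /negPf ->.
  by rewrite mulr0n mulr0.
under eq_bigr do rewrite /kosz_poly mulrBr.
by rewrite sumrB !S mulrC subrr.
Qed.

Lemma prow_kosz_poly r (iota : 'I_(1 + r.+1) -> 'I_n) a b p :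
  prow (kosz_poly (iota a, iota b)) p = koszul f iota a b p.
Proof.
apply/rowP => i; rewrite koszulE mxE /kosz_poly mevalB /=.
by congr (_ - _); case: eqP => _; rewrite ?mulr1 ?mulr0 ?meval0.
Qed.

Hypothesis f_nozero : exists2 a : pt K, P2 a & forall p, line a p ->
  exists i, (f i).@[p] != 0.

Lemma nozero_iota (A : finType) (iota : A -> 'I_n) (a : pt K) (I : {set 'I_n}) :
  P2 a -> (forall i, i \in I -> exists x, i = iota x) ->
  (forall p, line a p -> exists2 i, i \in I & (f i).@[p] != 0) ->
  nozero_on_line (fun x => f (iota x)).
Proof.
move=> a0 Ii H; exists a => // p /H [i /Ii [x ->] fi]; by exists x.
Qed.

Lemma line_nonempty (a : pt K) : P2 a -> exists p, line a p.
Proof.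
move=> /P2_coord [c ac]; exists (lpt a c 1 0).
by apply: lpt_line => //; rewrite oner_eq0.
Qed.

Lemma syz_frame r : n = r.+2 -> exists k : framed (syz_sec f d) r.+1 (- \sum_i (d i)%:Z), True.
Proof.
move=> nE; have [a a0 az] := f_nozero.
have [p /az [i0 fp]] := line_nonempty a0.
have [iota [ii i0E Hi]] := @enum_with_first n [set: 'I_n] i0 r (in_setT _)
  (etrans (cardsT _) (etrans (card_ord n) nE)).
have SE : \sum_i (d i)%:Z = \sum_a (d (iota a))%:Z.
  rewrite (reindex iota) //; apply: onW_bij; apply: inj_card_bij => //.
  by rewrite !card_ord nE.
rewrite SE; unshelve eexists => //; apply: (koszul_frame f_homog ii) => //.
- exact: syz_row_subsheaf.
- move=> V s q i _ _ _ ni; have [/(_ (in_setT i)) [x E] _] := Hi i.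
  by have := ni x; rewrite E eqxx.
- move=> c V x y oV Vc.
  have G := @gen_twist _ _ _ kosz_poly (fun ab => d ab.1 + d ab.2)%N c V (iota x, iota y) oV Vc.
  have := gen_sub_syz kosz_poly_homog kosz_poly_syz oV G.
  by apply: rs_eq (syz_row_subsheaf f d) _ _ _ oV _ => q Vq; rewrite prow_kosz_poly.
- by rewrite i0E; apply: contraNneq fp => ->; rewrite meval0.
- apply: (@nozero_iota _ iota a [set: 'I_n]) => // [i|q /az [i fi]].
    by move=> iI; apply/Hi.
  by exists i => //; rewrite in_setT.
Qed.

Lemma syz_rank_degree r : n = r.+2 ->
  has_rank (Syz f d) r.+1 /\ has_degree (Syz f d) (- \sum_i (d i)%:Z).
Proof.
move=> nE; have [k _] := syz_frame nE.
have rs := syz_row_subsheaf f d.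
by split; [exact: framed_has_rank rs k | exact: framed_has_degree rs k].
Qed.

Hypothesis S_semistable : semistable (Syz f d).

Lemma semistable_framed (F : (pt K -> Prop) -> (pt K -> 'rV[K]_n) -> Prop) r r' k :
  n = r.+2 -> row_subsheaf F -> @coherent_subsheaf K (Syz f d) F ->
  framed F r'.+1 k -> k * (r.+1)%:Z <= - (\sum_i (d i)%:Z) * (r'.+1)%:Z.
Proof.
move=> nE rs cF D; have [rk dg] := syz_rank_degree nE.
have := S_semistable cF (framed_nonzero D isT) (framed_has_rank rs D)
  (framed_has_degree rs D) rk dg.
rewrite Num.Theory.ler_pdivlMr ?Num.Theory.ltr0n // mulrAC.
rewrite Num.Theory.ler_pdivrMr ?Num.Theory.ltr0n //.
by rewrite !pmulrn -!intrM ler_int.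
Qed.

(** The subsheaf is generated by the Koszul relations among the f i with i in I. Freedom from common
    zeros is required on one line only, since points of codimension two do not affect the degree. *)
Lemma semistable_subfamily r r' (I : {set 'I_n}) (a : pt K) : n = r.+2 ->
  #|I| = r'.+2 -> P2 a ->
  (forall p, line a p -> exists2 i, i \in I & (f i).@[p] != 0) ->
  - (\sum_(i in I) (d i)%:Z) * (r.+1)%:Z <= - (\sum_i (d i)%:Z) * (r'.+1)%:Z.
Proof.
move=> nE cI a0 az; have [p /az [i0 i0I fp]] := line_nonempty a0.
have [iota [ii i0E Hi]] := enum_with_first i0I cI.
pose J : finType := ('I_(1 + r'.+1) * 'I_(1 + r'.+1))%type.
pose sg (x : J) := kosz_poly (iota x.1, iota x.2).
pose m (x : J) := (d (iota x.1) + d (iota x.2))%N.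
have sgh x i : zhomog ((m x)%:Z - (d i)%:Z) (sg x i).
  exact: (kosz_poly_homog (iota x.1, iota x.2)).
have sgs x : \sum_i f i * sg x i = 0.
  exact: (kosz_poly_syz (iota x.1, iota x.2)).
have rs := gen_row_subsheaf sg m.
have SE : \sum_(i in I) (d i)%:Z = \sum_a (d (iota a))%:Z.
  have -> : I = [set iota a | a in 'I_(1 + r'.+1)].
    apply/setP => i; apply/idP/imsetP => [/Hi [x ->]|[x _ ->]]; first by exists x.
    by apply/Hi; exists x.
  by rewrite big_imset //= => x y _ _; apply: ii.
rewrite SE; apply: (semistable_framed (F := gen_sec sg m)) => //.
  exact: gen_coherent.
apply: (koszul_frame f_homog ii) => //.
- by move=> V s; apply: gen_sub_syz.
- move=> V s q i oV gs Vq ni; have [W [c [oW Wq rc ->]]] := gs q Vq => //.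
  rewrite summxE big1 // => x _; rewrite mxE prow_kosz_poly koszulE.
  by rewrite !(negPf (ni _)) !mulr0 subrr mulr0.
- move=> c V x y oV Vc.
  have G := @gen_twist _ _ _ sg m c V (x, y) oV Vc.
  by apply: rs_eq rs _ _ _ oV _ G => q Vq; rewrite prow_kosz_poly.
- by rewrite i0E; apply: contraNneq fp => ->; rewrite meval0.
- by apply: (@nozero_iota _ iota a I) => // i iI; apply/Hi.
Qed.

Section Rank1.
Variables (sg : 'I_n -> {mpoly K[3]}) (m : nat) (i0 : 'I_n).
Hypothesis sg_homog : forall i, zhomog (m%:Z - (d i)%:Z) (sg i).
Hypothesis sg_syz : \sum_i f i * sg i = 0.
Hypothesis sg0 : sg i0 != 0.

Let F := gen_sec (fun _ : unit => sg) (fun=> m).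
Let B (p : pt K) : 'M[K]_(1, n) := \matrix_(_, i) (sg i).@[p].

Lemma fcoord_rank1 (c : K) (p : pt K) j : (sg i0).@[p] != 0 ->
  fcoord (B p) (c *: prow sg p) j = c.
Proof.
move=> h; have E : prow sg p = row j (B p) by apply/rowP => i; rewrite !mxE.
rewrite E fcoordZ fcoord_row ?eqxx ?mulr1 //.
apply/row_freeP; exists (\matrix_(i, _) ((i == i0)%:R / (sg i0).@[p])).
apply/matrixP => x y; rewrite !ord1 mxE (bigD1 i0) //= big1 ?addr0.
  by rewrite !mxE eqxx mul1r divff.
by move=> i /negPf ii0; rewrite !mxE ii0 mul0r mulr0.
Qed.

Lemma rank1_free (p : pt K) : (sg i0).@[p] != 0 -> row_free (B p).
Proof.
move=> h; rewrite /row_free eqn_leq rank_leq_row lt0n mxrank_eq0.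
by apply: contraNneq h => /matrixP /(_ 0 i0); rewrite !mxE => ->.
Qed.

(** The multiples of a nonzero syzygy form a copy of O(- m), whatever the zeros of sg; the
    coefficient is itself the volume form, with test value 1 on sg. *)
Definition rank1_frame : framed F 1 (- m%:Z).
Proof.
have sh (u : unit) i : zhomog (m%:Z - (d i)%:Z) (sg i) by [].
have ss (u : unit) : \sum_i f i * sg i = 0 by [].
have hs : exists e, sg i0 \is e.-homog.
  by have [e _ he] := zhomogE (sg_homog i0) sg0; exists e.
have dB p : row 0 (B p) = prow sg p by apply/rowP => i; rewrite !mxE.
have loc V s q : F V s -> V q -> exists W c, [/\ zopen V W, W q,
    regular (- m%:Z) W c & forall q', W q' -> s q' = c q' *: prow sg q'].
  move=> Fs Vq; have [W [c [oW Wq rc Es]]] := Fs q Vq.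
  exists W, (c tt); split=> // q' Wq'; rewrite Es // (bigD1 tt) //= big1 ?addr0 // => -[].
refine (@Framed K n F 1 _ (sg i0) (fun=> m%:Z) B (fun=> 1) unit (fun _ _ => m%:Z)
  (fun _ _ => prow sg) (fun=> 1) (fun=> 0%N) _ _ _ _ _ _ _ _ _ _ _ _ _) => //.
- exact: rank1_free.
- move=> c V j oV Vc; have G := @gen_twist _ _ unit (fun=> sg) (fun=> m) c V tt oV Vc.
  by apply: rs_eq (gen_row_subsheaf _ _) _ _ _ oV _ G => q Vq; rewrite ord1 dB.
- move=> V s oV Fs; split=> [p Vp hp|j].
    have [W [c [oW Wp rc ->]]] := loc V s p Fs Vp => //.
    by rewrite -dB; apply: scalemx_sub; apply: row_sub.
  have oD : zopen V (chart V (sg i0)) by have [e he] := hs; apply: zopen_chart he.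
  apply: regular_local => [q [Vq _]|q [Vq hq]]; first exact: zopen_sub oV Vq.
  have [W [c [oW Wq rc Es]]] := loc V s q Fs Vq.
  exists (fun x => chart V (sg i0) x /\ W x); split=> //.
    by apply: zopen_cap oW _ => x [].
  apply: (@eq_regular _ _ _ c); last by apply: regular_sub rc => x [].
  by move=> x [[Vx hx] Wx]; rewrite Es // fcoord_rank1.
- by move=> p _; apply: oner_neq0.
- move=> V s oV Fs; apply: extends_local => // q Vq.
  have [W [c [oW Wq rc Es]]] := loc V (s 0) q (Fs 0) Vq.
  exists W; split=> //; exists c; split=> // x Wx hx.
  by rewrite mulr1 det_mx11 mxE Es // fcoord_rank1.
- by move=> c V u j oV Vc; apply: (@gen_twist _ _ unit (fun=> sg) (fun=> m) c V tt oV Vc).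
- move=> u p Pp hp; rewrite mulr1 det_mx11 mxE meval1.
  by rewrite -[prow sg p]scale1r fcoord_rank1.
- by move=> u; apply: dhomog1.
- by move=> u; rewrite big_ord1 subrr.
- have [a a0 az] := f_nozero; exists a => // p _; exists tt.
  by rewrite meval1 oner_neq0.
- by move=> p _ _; exists tt; rewrite meval1 oner_neq0.
Defined.

Lemma semistable_syzygy r : n = r.+2 -> - m%:Z * (r.+1)%:Z <= - \sum_i (d i)%:Z.
Proof.
move=> nE; rewrite -[X in _ <= X]mulr1.
apply: (semistable_framed nE (gen_row_subsheaf _ _) _ rank1_frame).
by apply: gen_coherent.
Qed.

End Rank1.
End Slopes.

(** * The syzygy bundle on a line *)

Section LineSections.
Variables (K : closedFieldType) (a : pt K) (c : 'I_3).
Hypothesis ac : a c != 0.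
Implicit Types (p q : pt K).

Lemma line_P2 p : line a p -> P2 p.
Proof. by case. Qed.

Lemma line_scaled p : line a p ->
  (exists2 x, x != 0 & p = [ffun k => x * lpt a c 0 1 k]) \/
  (exists t x, x != 0 /\ p = [ffun k => x * lpt a c 1 t k]).
Proof.
move=> lp; have Pp := line_P2 lp; have := line_lpt ac lp.
set s := p _; set t := p _ => E.
have key (x y s' t' : K) : lpt a c (x * s') (x * t') = [ffun k => x * lpt a c s' t' k].
  apply/ffunP => k; rewrite !ffunE; case: (i01P c k) => ->;
    rewrite ?lcoord_i0 ?lcoord_i1 // !lcoord_c /GRing.scale /=; ring.
case: (eqVneq s 0) => [s0|s0]; last first.
  right; exists (t / s), s; split=> //; rewrite -key // mulr1 mulrC divfK //.
left; exists t; last by rewrite -key // mulr1 mulr0 E s0.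
apply: contraNneq Pp => t0; rewrite E s0 t0; apply/eqP/ffunP => k; rewrite !ffunE.
by case: (i01P c k) => ->; rewrite ?lcoord_i0 ?lcoord_i1 // lcoord_c !scaler0 subrr.
Qed.

Lemma eval_scaled (h : {mpoly K[3]}) e x p : h \is e.-homog -> x != 0 ->
  (h.@[([ffun k => x * p k] : pt K)] != 0) = (h.@[p] != 0).
Proof.
move=> hh x0; rewrite (_ : h.@[_] = h.@[fun k => x * p k]).
  by rewrite (meval_dhomog_scale _ _ hh) mulf_eq0 expf_eq0 (negPf x0) andbF.
by apply: meval_eq => k; rewrite ffunE.
Qed.

(** Sections of O(k) on a line are forms of degree k: finitely many local fractions have
    denominators without common zero, and their common quotient is a binary form. *)
Lemma regular_line k u : regular k (line a) u ->
  exists2 g, zhomog k g & forall p, line a p -> u p = g.@[p].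
Proof.
move=> ru; have LP p : line a p -> P2 p by apply: line_P2.
pose pinf := lpt a c 0 1.
have linf : line a pinf by apply: lpt_line => //; rewrite oner_eq0 orbT.
have l1 t : line a (lpt a c 1 t) by apply: lpt_line => //; rewrite oner_eq0.
pose spec p (x : nat * nat * {mpoly K[3]} * {mpoly K[3]}) :=
  let: (eg, eh, g, h) := x in [/\ g \is eg.-homog /\ h \is eh.-homog,
    eg%:Z = eh%:Z + k, h.@[p] != 0 &
    forall q, line a q -> h.@[q] != 0 -> u q = g.@[q] / h.@[q]].
pose X p := epsilon (inhabits (0%N, 0%N, 0, 0)) (spec p).
have XP p : line a p -> spec p (X p).
  move=> lp; apply: epsilon_spec; have [eg [eh [g [h H]]]] := regularE LP ru lp.
  by exists (eg, eh, g, h).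
have [rs Ers] := closed_field_poly_normal (lrestr a c (X pinf).2).
(* The fraction at infinity fails only at the roots of its denominator; adding the fractions at
   these roots covers the line. *)
pose pts := pinf :: [seq lpt a c 1 t | t <- rs].
pose P (i : 'I_(size pts)) := nth pinf pts i.
have lP i : line a (P i).
  have : P i \in pts by apply: mem_nth.
  by rewrite inE => /orP [/eqP -> //|/mapP [t _ ->]].
pose g i := (X (P i)).1.2; pose h i := (X (P i)).2.
pose eg i := (X (P i)).1.1.1; pose eh i := (X (P i)).1.1.2.
have S i : [/\ g i \is (eg i).-homog /\ h i \is (eh i).-homog,
    (eg i)%:Z = (eh i)%:Z + k, (h i).@[P i] != 0 &
    forall q, line a q -> (h i).@[q] != 0 -> u q = (g i).@[q] / (h i).@[q]].
  by have := XP _ (lP i); rewrite /g /h /eg /eh; case: (X (P i)) => [[[? ?] ?] ?].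
have hinf0 : lrestr a c (h ord0) != 0.
  have [[_ hh] _ hp _] := S ord0; apply: contraNneq hp => r0.
  by have [_ <-] := lrestr_size_coef ac hh; rewrite r0 coef0.
have hroot t : exists i, (lrestr a c (h i)).[t] != 0.
  case: (boolP (t \in rs)) => [trs|trs].
    have ip : ((index t rs).+1 < size pts)%N by rewrite /= size_map ltnS index_mem.
    exists (Ordinal ip); rewrite lrestr_eval //.
    have [_ _ + _] := S (Ordinal ip); rewrite /P /= (nth_map 0) ?index_mem //.
    by rewrite nth_index.
  exists ord0; rewrite -[h ord0]/((X pinf).2) Ers hornerZ.
  rewrite mulf_neq0 ?lead_coef_eq0 ?hinf0 //.
  rewrite horner_prod prodf_seq_neq0; apply/allP => z zrs /=.
  by rewrite hornerXsubC subr_eq0; apply: contraNneq trs => ->.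
have cross i j : lrestr a c (g i) * lrestr a c (h j) = lrestr a c (g j) * lrestr a c (h i).
  have nz l : lrestr a c (h l) != 0.
    have [[_ hh] _ hp _] := S l; apply: contraNneq hp => r0.
    by have [H _] := line_lrestr ac (k := eh l) hh; rewrite (H r0).
  have [[hgi hhi] Ei _ Ui] := S i; have [[hgj hhj] Ej _ Uj] := S j.
  (* After multiplication by h i * h j the identity is trivial where a denominator vanishes, so it
     can be tested at every point of the line. *)
  apply: (mulIf (mulf_neq0 (nz i) (nz j))); rewrite -!rmorphM; apply/eqP.
  rewrite -subr_eq0 -rmorphB; apply/eqP.
  have hz1 : g i * h j * (h i * h j) \is ((eg i + eh j) + (eh i + eh j))%N.-homog.
    by do 3! apply: dhomogM => //.
  have hz2 : g j * h i * (h i * h j) \is ((eg i + eh j) + (eh i + eh j))%N.-homog.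
    have -> : (eg i + eh j = eg j + eh i)%N by lia.
    by do 3! apply: dhomogM => //.
  have hz : zhomog ((eg i + eh j) + (eh i + eh j))%N%:Z
      (g i * h j * (h i * h j) - g j * h i * (h i * h j)) by apply: rpredB.
  apply/(line_lrestr ac hz) => q lq; rewrite mevalB !mevalM.
  case: (eqVneq (h i).@[q] 0) => [->|hi]; first by rewrite !(mul0r, mulr0) subrr.
  case: (eqVneq (h j).@[q] 0) => [->|hj]; first by rewrite !(mul0r, mulr0) subrr.
  have := Ui q lq hi; rewrite Uj // => /eqP; rewrite eqr_div // => /eqP E.
  by rewrite -E subrr.
have [|||||q [sq Eq]] := @common_quotient_poly K 'I_(size pts)
  (fun i => lrestr a c (h i)) (fun i => lrestr a c (g i)) eh k.
- by move=> i; have [[_ hh] _ _ _] := S i; case: (lrestr_size_coef ac hh).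
- move=> i; have [[hg _] E _ _] := S i; apply: lrestr_sizez => //.
  by rewrite addrC -E.
- exact: hroot.
- exists ord0; have [[_ hh] _ hp _] := S ord0.
  by have [_ ->] := lrestr_size_coef ac hh.
- exact: cross.
have [w hw Ew] := lrestr_liftz ac sq.
exists w => // p lp.
have [i hi] : exists i, (h i).@[p] != 0.
  case: (line_scaled lp) => [[x x0 ->]|[t [x [x0 ->]]]].
    exists ord0; have [[_ hh] _ hp _] := S ord0; by rewrite (eval_scaled _ hh x0).
  have [i] := hroot t; rewrite lrestr_eval // => hi; exists i.
  by have [[_ hh] _ _ _] := S i; rewrite (eval_scaled _ hh x0).
have [[hg hh] E _ U] := S i; rewrite U //.
have hz : zhomog (eg i)%:Z (g i - h i * w).
  apply: zhomogD => //; apply: zhomogN; rewrite E; exact: zhomogM.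
have r0 : lrestr a c (g i - h i * w) = 0.
  by rewrite rmorphB rmorphM /= Ew Eq subrr.
have [H _] := line_lrestr ac hz; have := H r0 p lp.
rewrite mevalB mevalM => /eqP; rewrite subr_eq0 => /eqP ->.
by rewrite mulrAC divff // mul1r.
Qed.

End LineSections.

Section TwistHom.
Variables (K : closedFieldType) (n n' : nat) (X : pt K -> Prop).
Variable F : (pt K -> Prop) -> (pt K -> 'rV[K]_n) -> Prop.
Variable G : (pt K -> Prop) -> (pt K -> 'rV[K]_n') -> Prop.
Implicit Types (p q : pt K).
Hypothesis XP : forall p, X p -> P2 p.
Hypothesis F_sub : forall U V s, zopen X U -> zopen U V -> F U s -> F V s.
Hypothesis F_eq : forall U s t, zopen X U -> (forall p, U p -> s p = t p) ->
  F U s -> F U t.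
Variable phi : (pt K -> Prop) -> (pt K -> 'rV[K]_n) -> (pt K -> 'rV[K]_n').
Hypothesis phi_hom : @is_hom K X (row_sheaf F) (row_sheaf G) phi.

(* As the sheaves are not graded, a section of F(m) is handled through its
   products by X_c^(-m) on the charts; T is the image of s under phi(m). *)
Lemma twist_hom (m : int) s :
  (forall c, F (chart X 'X_c) (twist_row c m s)) ->
  exists T : pt K -> 'rV[K]_n', forall c p, X p -> p c != 0 ->
    T p = p c ^ m *: phi (chart X 'X_c) (twist_row c m s) p.
Proof.
move=> Fs.
pose cc (p : pt K) : 'I_3 := odflt ord0 [pick c | p c != 0].
have ccP p : X p -> p (cc p) != 0.
  move=> /XP /P2_coord [c pc]; rewrite /cc; case: pickP => [//|/(_ c)].
  by rewrite pc.
exists (fun p => p (cc p) ^ m *: phi (chart X 'X_(cc p)) (twist_row (cc p) m s) p).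
move=> c p Xp pc; move: (cc p) (ccP p Xp) => c' pc'.
pose W := chart (chart X 'X_c) 'X_c'.
have oC := zopenX X c; have oC' := zopenX X c'.
have oW : zopen (chart X 'X_c) W by apply: zopenX.
have oXW := zopen_trans oC oW.
have oW' : zopen (chart X 'X_c') W.
  have := oXW => /zopen_narrow; apply; first by move=> q [[Xq _] cq].
  by move=> q [].
have Wp : W p by split; [split=> //; rewrite mevalXU | rewrite mevalXU].
have [_ _ _ _ H1] := phi_hom oC; have [_ _ _ _ H2] := phi_hom oC'.
have [_ Heq _ Hsc _] := phi_hom oXW.
rewrite -(H1 W _ oW (Fs c) p Wp) -(H2 W _ oW' (Fs c') p Wp).
have Wc q : W q -> q c != 0 by case=> [[_]]; rewrite mevalXU.
have Wc' q : W q -> q c' != 0 by case=> _; rewrite mevalXU.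
have WP q : W q -> P2 q by move=> /(zopen_sub oXW)/XP.
have FW : F W (twist_row c m s) by apply: F_sub oW (Fs c).
have FW' : F W (twist_row c' m s) by apply: F_sub oW' (Fs c').
have rb : regular 0 W (fun q => q c ^ m * q c' ^ (- m)).
  apply: (regularM_deg (k := m) (l := - m)) => //; first by rewrite addrN.
    exact: regular_coordX.
  exact: regular_coordX.
have E : phi W (twist_row c' m s) p =
    (p c ^ m * p c' ^ (- m)) *: phi W (twist_row c m s) p.
  have EE q : W q -> twist_row c' m s q =
      (q c ^ m * q c' ^ (- m)) *: twist_row c m s q.
    move=> Wq; rewrite /twist_row scalerA; congr (_ *: _).
    by rewrite mulrAC -expfzDr ?Wc // addrN expr0z mul1r.
  have HS := Hsc _ _ rb FW p Wp; rewrite /= in HS; rewrite -HS.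
  apply: Heq => //; exact: F_eq EE FW'.
by rewrite E scalerA mulrCA -expfzDr // addrN expr0z mulr1.
Qed.

End TwistHom.

Section LineBasis.
Variables (K : closedFieldType) (a : pt K) (c0 : 'I_3).
Hypothesis ac : a c0 != 0.
Variables (n : nat) (f : 'I_n -> {mpoly K[3]}) (d : 'I_n -> nat).
Hypothesis f_homog : forall i, f i \is (d i).-homog.
Hypothesis f_nozero : forall p, line a p -> exists i, (f i).@[p] != 0.
Implicit Types (p q : pt K).

Let L := line a.

(** A tuple satisfying the relation on L lifts near p: the fractions of all entries but one are
    extended as they stand, and the entry at an i0 with f i0 nonzero at p is solved for. *)
Lemma syz_restr_secP V s : zopen L V -> sec (s := Syz_restr f d) V s <->
  (forall i, regular (- (d i)%:Z) V (fun p => s p 0 i)) /\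
  forall p, V p -> \sum_i (f i).@[p] * s p 0 i = 0.
Proof.
move=> oV; have VL p : V p -> L p by apply: zopen_sub oV.
have VP p : V p -> P2 p by move=> /VL; apply: line_P2.
split=> [H|[rs fs] p Vp].
  split=> [i|p Vp].
    apply: regular_local => // p Vp; have [U [t [oU Up [rt ft] E]]] := H p Vp.
    exists (fun q => V q /\ U q); split=> //; first exact: zopen_cap oU VP.
    apply: (@eq_regular _ _ _ (fun q => t q 0 i)); first by move=> q [Vq Uq]; rewrite E.
    by apply: regular_sub (rt i) => q [].
  have [U [t [oU Up [rt ft] E]]] := H p Vp.
  by rewrite E //; apply: ft.
have [i0 fp] := f_nozero (VL p Vp).
have [eg /fin_all_exists [eh /fin_all_exists [g /fin_all_exists [h S]]]] :=
  fin_all_exists (fun i => regularE VP (rs i) Vp).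
pose hh := f i0 * \prod_i h i.
have hhom : hh \is (d i0 + \sum_i eh i)%N.-homog.
  by apply: dhomogM => //; apply: dhomog_bigprod => i _; case: (S i) => -[].
pose U := chart (@P2 K) hh.
have oU : zopen (@P2 K) U by apply: zopen_chart hhom.
have UP q : U q -> P2 q by case.
have Uf q : U q -> (f i0).@[q] != 0.
  by case=> _; rewrite mevalM mulf_eq0 negb_or => /andP [].
have Uh q i : U q -> (h i).@[q] != 0.
  case=> _; rewrite mevalM mulf_eq0 negb_or => /andP [_].
  by rewrite rmorph_prod => /prodf_neq0; apply.
pose t0 i q := (g i).@[q] / (h i).@[q].
have rt0 i : regular (- (d i)%:Z) U (t0 i).
  have [[hg hhi] E _ _] := S i.
  have -> : - (d i)%:Z = (eg i)%:Z + - (eh i)%:Z by rewrite E; ring.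
  apply: regularM => //; first exact: regular_poly.
  by apply: regularV => // [q Uq|]; [exact: Uh | exact: regular_poly].
pose t q : 'rV[K]_n := \row_i if i == i0 then
  - (\sum_(j | j != i0) (f j).@[q] * t0 j q) / (f i0).@[q] else t0 i q.
exists U, t; split=> //.
- split=> //; first exact: VP.
  rewrite mevalM mulf_neq0 // rmorph_prod; apply/prodf_neq0 => i _.
  by case: (S i).
- split=> [i|q Uq].
    case: (eqVneq i i0) => [->|ii0].
      apply: (@eq_regular _ _ _ (fun q => - (\sum_(j | j != i0) (f j).@[q] * t0 j q) *
          ((f i0).@[q])^-1)); first by move=> q Uq; rewrite mxE eqxx.
      apply: (regularM_deg (k := 0) (l := - (d i0)%:Z)) => //; first by rewrite add0r.
        apply: regularN => //; apply: regular_sum => // j _.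
        apply: (regularM_deg (k := (d j)%:Z) (l := - (d j)%:Z)) => //.
          by rewrite addrN.
        by apply: regular_poly => //; apply: f_homog.
      by apply: regularV => //; apply: regular_poly => //; exact: f_homog.
    by apply: eq_regular (rt0 i) => q Uq; rewrite mxE (negPf ii0).
  rewrite (bigD1 i0) //= mxE eqxx mulrC divfK ?Uf //.
  rewrite [X in _ + X](eq_bigr (fun j => (f j).@[q] * t0 j q)) ?addNr //.
  by move=> j /negPf ji0; rewrite mxE ji0.
- move=> q Vq Uq; apply/rowP => i; rewrite mxE.
  have St j : s q 0 j = t0 j q by have [_ _ _ ->] := S j => //; apply: Uh.
  case: eqP => [->|_]; last exact: St.
  have := fs q Vq; rewrite (bigD1 i0) //= => /eqP; rewrite addr_eq0 => /eqP E.
  apply: (mulfI (Uf q Uq)); rewrite E mulrC divfK ?Uf //; congr (- _).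
  by apply: eq_bigr => j _; rewrite St.
Qed.

Variables (N : nat) (b : 'I_N -> int).
Hypothesis L_iso : isom L (Syz_restr f d) (Osum K b).

(** The sg j form a homogeneous basis, in degrees - b j, of the syzygies modulo the equation of L.
    They are the images of the standard basis of the split bundle, glued over charts into sections
    on the whole line and then written as forms. *)
Lemma line_basis : exists sg : 'I_N -> 'I_n -> {mpoly K[3]},
  [/\ forall j i, zhomog (- b j - (d i)%:Z) (sg j i),
      forall j p, L p -> \sum_i (f i).@[p] * (sg j i).@[p] = 0,
      forall (m : int) (x : 'I_n -> {mpoly K[3]}),
        (forall i, zhomog (m - (d i)%:Z) (x i)) ->
        (forall p, L p -> \sum_i (f i).@[p] * (x i).@[p] = 0) ->
        exists2 ga : 'I_N -> {mpoly K[3]}, forall j, zhomog (m + b j) (ga j) &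
          forall p i, L p -> (x i).@[p] = \sum_j (ga j).@[p] * (sg j i).@[p] &
      forall (m : int) (ga : 'I_N -> {mpoly K[3]}),
        (forall j, zhomog (m + b j) (ga j)) ->
        (forall p i, L p -> \sum_j (ga j).@[p] * (sg j i).@[p] = 0) ->
        forall p j, L p -> (ga j).@[p] = 0].
Proof.
have LP p : L p -> P2 p by apply: line_P2.
case: L_iso => phi [psi [phi_hom psi_hom psiK phiK]].
pose S := Syz_restr f d; pose O := Osum K b.
have S_sub U V s : zopen L U -> zopen U V -> sec (s := S) U s -> sec (s := S) V s.
  move=> oU oV; have oLV := zopen_trans oU oV.
  move=> /(syz_restr_secP _ oU) [rs fs]; apply/(syz_restr_secP _ oLV); split.
    by move=> i; apply: regular_zopen oV (rs i).
  by move=> p /(zopen_sub oV); apply: fs.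
have S_eq U s t : zopen L U -> (forall p, U p -> s p = t p) ->
    sec (s := S) U s -> sec (s := S) U t.
  move=> oU E /(syz_restr_secP _ oU) [rs fs]; apply/(syz_restr_secP _ oU); split.
    by move=> i; apply: (eq_regular _ (rs i)) => p Up; rewrite E.
  by move=> p Up; rewrite -E //; apply: fs.
have O_sub U V s : zopen L U -> zopen U V -> sec (s := O) U s -> sec (s := O) V s.
  by move=> oU oV rs i; apply: regular_zopen oV (rs i).
have O_eq U s t : zopen L U -> (forall p, U p -> s p = t p) ->
    sec (s := O) U s -> sec (s := O) U t.
  by move=> oU E rs i; apply: (eq_regular _ (rs i)) => p Up; rewrite E.
pose ee j : pt K -> 'rV[K]_N := fun=> delta_mx 0 j.
(* The unit vector e_j is a section of the twist by - b j; multiplied by X_c^(b j) it becomes a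
   section of the sum. *)
have ee_sec c j : sec (s := O) (chart L 'X_c) (twist_row c (- b j) (ee j)).
  have CP q : chart L 'X_c q -> P2 q by case=> /LP.
  move=> i; case: (eqVneq i j) => [->|ij].
    apply: (@eq_regular _ _ _ (fun q => q c ^ b j)).
      by move=> p _; rewrite !mxE !eqxx mulr1 opprK.
    by apply: regular_coordX => q; apply: chartX.
  by apply: (eq_regular _ (regular0 _ CP)) => p _; rewrite !mxE (negPf ij) andbF mulr0.
have Tex j := @twist_hom K N n L _ _ LP O_sub O_eq psi psi_hom (- b j) (ee j)
  (fun c => ee_sec c j).
have [T ET] := fin_all_exists Tex.
have psiE c r q : sec (s := O) (chart L 'X_c) r -> chart L 'X_c q ->
    psi (chart L 'X_c) r q = \sum_j r q 0 j *: T j q.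
  move=> rr Vq; set V := chart L 'X_c in rr Vq *.
  have oV : zopen L V by apply: zopenX.
  have VP p : V p -> P2 p by case=> /LP.
  have Vc p : V p -> p c != 0 := @chartX _ L c p.
  have [_ psi_eq psi_add psi_scale _] := psi_hom _ oV.
  pose co j p := r p 0 j * p c ^ (- b j).
  have rco j : regular 0 V (co j).
    apply: (regularM_deg (k := b j) (l := - b j)) => //; first by rewrite addrN.
    exact: regular_coordX.
  have O0 : sec (s := O) V (fun=> 0).
    by move=> i; apply: (eq_regular _ (regular0 _ VP)) => p _; rewrite mxE.
  have OD s t : sec (s := O) V s -> sec (s := O) V t -> sec (s := O) V (fun p => s p + t p).
    move=> Hs Ht i; apply: (eq_regular _ (regularD VP (Hs i) (Ht i))) => p _.
    by rewrite mxE.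
  have OZ x s : regular 0 V x -> sec (s := O) V s -> sec (s := O) V (fun p => x p *: s p).
    move=> rx Hs i; have := regularM VP rx (Hs i); rewrite add0r => rm.
    by apply: (eq_regular _ rm) => p _; rewrite mxE.
  have evZ x s : regular 0 V x -> sec (s := O) V s ->
      psi V (fun p => x p *: s p) q = x q *: psi V s q.
    by move=> rx Hs; apply: (psi_scale x s).
  have ev0 : psi V (fun=> 0) q = 0.
    have -> : (fun=> 0) = (fun p : pt K => (0 : K) *: (0 : 'rV[K]_N)) :> (pt K -> 'rV[K]_N).
      by apply: functional_extensionality => p; rewrite scale0r.
    by rewrite (evZ (fun=> 0) (fun=> 0)) ?scale0r //; apply: regular0.
  have evD s t : sec (s := O) V s -> sec (s := O) V t ->
      psi V (fun p => s p + t p) q = psi V s q + psi V t q.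
    by move=> Hs Ht; apply: (psi_add s t).
  have [FS ES] := @section_sum K N V (sec (s := O)) 'rV[K]_n (fun s => psi V s q) q N
    co (fun j => twist_row c (- b j) (ee j)) O0 OD OZ ev0 evD evZ rco
    (fun j => ee_sec c j).
  transitivity (\sum_j co j q *: psi V (twist_row c (- b j) (ee j)) q).
    rewrite -ES; apply: psi_eq => // p Vp.
    apply/rowP => i; rewrite summxE (bigD1 i) //= big1 ?addr0.
      by rewrite !mxE !eqxx opprK mulr1 /co -mulrA -expfzDr ?Vc // addNr expr0z mulr1.
    by move=> j ji; rewrite !mxE eq_sym (negPf ji) andbF !mulr0.
  apply: eq_bigr => j _; rewrite (ET j c q).
  - by rewrite scalerA.
  - by case: Vq.
  - exact: Vc.
have Treg j i : regular (- b j - (d i)%:Z) L (fun p => T j p 0 i).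
  apply: regular_local => // p Lp; have [c pc] := P2_coord (LP p Lp).
  have oV := zopenX L c; exists (chart L 'X_c); split=> //.
    by split=> //; rewrite mevalXU.
  have [Hs _ _ _ _] := psi_hom _ oV.
  have /(syz_restr_secP _ oV) [rs _] := Hs _ (ee_sec c j).
  have CP q : chart L 'X_c q -> P2 q by case=> /LP.
  have rm := regularM CP (regular_coordX (- b j) (@chartX _ L c)) (rs i).
  apply: (eq_regular _ rm) => q Vq; rewrite (ET j c q); [|by case: Vq|exact: chartX Vq].
  by rewrite mxE.
have Tsyz j p : L p -> \sum_i (f i).@[p] * T j p 0 i = 0.
  move=> Lp; have [c pc] := P2_coord (LP p Lp).
  have oV := zopenX L c; have Vp : chart L 'X_c p by split=> //; rewrite mevalXU.
  have [Hs _ _ _ _] := psi_hom _ oV.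
  have /(syz_restr_secP _ oV) [_ fs] := Hs _ (ee_sec c j).
  rewrite (ET j c p) //.
  transitivity (p c ^ (- b j) * \sum_i (f i).@[p] *
    psi (chart L 'X_c) (twist_row c (- b j) (ee j)) p 0 i).
    by rewrite mulr_sumr; apply: eq_bigr => i _; rewrite mxE mulrCA.
  by rewrite fs // mulr0.
have [sg Hsg] : exists sg : 'I_N -> 'I_n -> {mpoly K[3]}, forall j i,
    zhomog (- b j - (d i)%:Z) (sg j i) /\ forall p, L p -> T j p 0 i = (sg j i).@[p].
  have H j i : exists g, zhomog (- b j - (d i)%:Z) g /\
      forall p, L p -> T j p 0 i = g.@[p].
    by have [g hg Eg] := regular_line ac (Treg j i); exists g.
  exact: (fin_all_exists (fun j => fin_all_exists (H j))).
exists sg; split.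
- by move=> j i; case: (Hsg j i).
- move=> j p Lp; rewrite -[RHS](Tsyz j p Lp); apply: eq_bigr => i _.
  by have [_ ->] := Hsg j i.
- move=> m x hx fx.
  pose s p : 'rV[K]_n := \row_i (x i).@[p].
  have s_sec c : sec (s := S) (chart L 'X_c) (twist_row c m s).
    have CP q : chart L 'X_c q -> P2 q by case=> /LP.
    apply/(syz_restr_secP _ (zopenX L c)); split=> [i|p [Lp _]].
      have rm := regularM CP (regular_coordX (- m) (@chartX _ L c))
        (regular_poly CP (hx i)).
      rewrite addrA addNr add0r in rm; apply: (eq_regular _ rm) => q _.
      by rewrite !mxE.
    transitivity (p c ^ (- m) * \sum_i (f i).@[p] * (x i).@[p]).
      by rewrite mulr_sumr; apply: eq_bigr => i _; rewrite !mxE mulrCA.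
    by rewrite fx // mulr0.
  have [R ER] := @twist_hom K n N L _ _ LP S_sub S_eq phi phi_hom m s s_sec.
  have Rreg j : regular (m + b j) L (fun p => R p 0 j).
    apply: regular_local => // p Lp; have [c pc] := P2_coord (LP p Lp).
    have oV := zopenX L c; exists (chart L 'X_c); split=> //.
      by split=> //; rewrite mevalXU.
    have [Hs _ _ _ _] := phi_hom _ oV.
    have CP q : chart L 'X_c q -> P2 q by case=> /LP.
    have rm := regularM CP (regular_coordX m (@chartX _ L c)) (Hs _ (s_sec c) j).
    apply: (eq_regular _ rm) => q Vq; rewrite (ER c q); [|by case: Vq|exact: chartX Vq].
    by rewrite mxE.
  have [ga Hga] : exists ga : 'I_N -> {mpoly K[3]}, forall j,
      zhomog (m + b j) (ga j) /\ forall p, L p -> R p 0 j = (ga j).@[p].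
    have H j : exists g, zhomog (m + b j) g /\ forall p, L p -> R p 0 j = g.@[p].
      by have [g hg Eg] := regular_line ac (Rreg j); exists g.
    exact: (fin_all_exists H).
  exists ga => [j|p i Lp]; first by case: (Hga j).
  have [c pc] := P2_coord (LP p Lp).
  have oV := zopenX L c; have Vp : chart L 'X_c p by split=> //; rewrite mevalXU.
  have [Hs _ _ _ _] := phi_hom _ oV.
  have := psiK _ _ oV (s_sec c) p Vp; rewrite psiE //; last exact: Hs.
  move=> /(congr1 (fun v : 'rV[K]_n => p c ^ m * v 0 i)); rewrite summxE !mxE.
  rewrite mulrA -expfzDr // addrN expr0z mul1r => <-.
  rewrite mulr_sumr; apply: eq_bigr => j _; rewrite mxE mulrA.
  have [_ <- //] := Hga j; have [_ <- //] := Hsg j i.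
  by rewrite (ER c p) // mxE.
- move=> m ga hga gs p j Lp; have [c pc] := P2_coord (LP p Lp).
  have oV := zopenX L c; have Vp : chart L 'X_c p by split=> //; rewrite mevalXU.
  set V := chart L 'X_c in oV Vp.
  have VP q : V q -> P2 q by case=> /LP.
  have Vc q : V q -> q c != 0 := @chartX _ L c q.
  pose r q : 'rV[K]_N := \row_j (q c ^ (- m) * (ga j).@[q]).
  have rr : sec (s := O) V r.
    move=> i; have rm := regularM VP (regular_coordX (- m) Vc) (regular_poly VP (hga i)).
    rewrite addrA addNr add0r in rm; apply: (eq_regular _ rm) => q _.
    by rewrite mxE.
  have [Hs _ _ _ _] := psi_hom _ oV.
  have [_ phi_eq _ phi_scale _] := phi_hom _ oV.
  have Fz : sec (s := S) V (psi V r) := Hs _ rr.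
  have r0 : regular 0 V (fun=> 0 : K) := regular0 0 VP.
  have Fz0 : sec (s := S) V (fun q => (0 : K) *: psi V r q).
    move: Fz => /(syz_restr_secP _ oV) [r1 _]; apply/(syz_restr_secP _ oV); split.
      by move=> i; apply: (eq_regular _ (regular0 _ VP)) => q _; rewrite scale0r mxE.
    by move=> q _; rewrite big1 // => i _; rewrite scale0r mxE mulr0.
  (* The relation makes psi r vanish. To see that phi kills it, the zero section is written as 0
     times a section and linearity is applied. *)
  have E1 : phi V (psi V r) p = phi V (fun q => (0 : K) *: psi V r q) p.
    apply: phi_eq => // q Vq; rewrite scale0r psiE //.
    apply/rowP => i; rewrite summxE mxE.
    transitivity (q c ^ (- m) * \sum_j (ga j).@[q] * (sg j i).@[q]).
      rewrite mulr_sumr; apply: eq_bigr => l _; rewrite !mxE mulrA.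
      by have [_ ->] := Hsg l i; [|case: Vq].
    by rewrite gs ?mulr0 //; case: Vq.
  have E2 := phi_scale (fun=> 0) (psi V r) r0 Fz p Vp; rewrite /= in E2.
  move: (phiK _ _ oV rr p Vp); rewrite E1 E2 scale0r => /rowP /(_ j).
  rewrite !mxE => /esym/eqP; rewrite mulf_eq0 expfz_eq0 (negPf pc) andbF /=.
  by move/eqP.
Qed.

End LineBasis.

(** * Dimension counts for binary forms *)

Section PolyFamilies.
Variables (K : fieldType) (I : finType) (e : I -> nat).

(** Coefficient vectors of families of polynomials of size at most e i: a finite-dimensional space,
    so that rank and kernel dimension are available. *)
Definition pfam := {ffun {i : I & 'I_(e i)} -> K^o}.

Definition pfam_poly (x : pfam) (i : I) : {poly K} :=
  \sum_(k < e i) x (Tagged (fun i => 'I_(e i)) k) *: 'X^k.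

Lemma pfam_poly_linear a (x y : pfam) i :
  pfam_poly (a *: x + y) i = a *: pfam_poly x i + pfam_poly y i.
Proof.
rewrite /pfam_poly scaler_sumr -big_split; apply: eq_bigr => k _.
by rewrite !ffunE scalerDl scalerA.
Qed.

Lemma coef_pfam_poly x i (k : 'I_(e i)) :
  (pfam_poly x i)`_k = x (Tagged (fun i => 'I_(e i)) k).
Proof.
rewrite coef_sum (bigD1 k) //= coefZ coefXn eqxx mulr1 big1 ?addr0 // => l lk.
by rewrite coefZ coefXn (_ : (k == l :> nat) = false) ?mulr0 // eq_sym; apply/negbTE.
Qed.

Lemma size_pfam_poly x i : (size (pfam_poly x i) <= e i)%N.
Proof.
apply: (leq_trans (size_sum _ _ _)); apply/bigmax_leqP => k _.
by apply: (leq_trans (size_scale_leq _ _)); rewrite size_polyXn.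
Qed.

Lemma pfam_polyP (c : I -> {poly K}) : (forall i, size (c i) <= e i)%N ->
  exists x, forall i, pfam_poly x i = c i.
Proof.
move=> sc; exists [ffun t : {i : I & 'I_(e i)} => (c (tag t))`_(tagged t)] => i.
rewrite /pfam_poly (eq_bigr (fun k : 'I_(e i) => (c i)`_k *: 'X^k)).
  rewrite -poly_def; apply/polyP => k; rewrite coef_poly.
  by case: ltnP => // ek; rewrite nth_default //; apply: leq_trans ek.
by move=> k _; rewrite ffunE.
Qed.

Lemma pfam_poly_inj (x : pfam) : (forall i, pfam_poly x i = 0) -> x = 0.
Proof.
move=> x0; apply/ffunP => -[i k]; rewrite [RHS]ffunE.
by rewrite -[LHS]/(x (Tagged (fun i => 'I_(e i)) k)) -coef_pfam_poly x0 coef0.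
Qed.

Lemma dim_pfam : \dim {:pfam} = (\sum_i e i)%N.
Proof.
rewrite dimvf /dim /= muln1 card_tagged sumnE big_map big_enum /=.
by apply: eq_bigr => i _; rewrite card_ord.
Qed.

End PolyFamilies.

Lemma linear_lfun (K : fieldType) (V W : vectType K) (h : V -> W) :
  linear h -> exists H : 'Hom(V, W), H =1 h.
Proof.
move=> hl; pose hb := GRing.isLinear.Build K V W _ h hl.
pose h' : {linear V -> W} := HB.pack h hb.
by exists (linfun h') => x; rewrite lfunE.
Qed.

(* Dimension count for an exact sequence
   0 -> (+)_j K[t]_{<g j} -> (+)_i K[t]_{<e i} -> K[t]_{<M}. *)
Lemma exact_dim (K : fieldType) (n N M : nat) (e : 'I_n -> nat) (g : 'I_N -> nat)
    (A : 'I_N -> 'I_n -> {poly K}) (B : 'I_n -> {poly K}) :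
  (forall i (x : {poly K}), (size x <= e i)%N -> (size (B i * x)%R <= M)%N) ->
  (forall j i (x : {poly K}), (size x <= g j)%N -> (size (x * A j i)%R <= e i)%N) ->
  (forall j, \sum_i B i * A j i = 0) ->
  (forall y : 'I_N -> {poly K}, (forall j, size (y j) <= g j)%N ->
     (forall i, \sum_j y j * A j i = 0) -> forall j, y j = 0) ->
  (forall x : 'I_n -> {poly K}, (forall i, size (x i) <= e i)%N ->
     \sum_i B i * x i = 0 ->
     exists2 y : 'I_N -> {poly K}, forall j, (size (y j) <= g j)%N &
       forall i, x i = \sum_j y j * A j i) ->
  exists rho, [/\ (rho <= M)%N, (\sum_i e i = \sum_j g j + rho)%N &
    rho = M <-> forall z : {poly K}, (size z <= M)%N ->
      exists2 x : 'I_n -> {poly K}, forall i, (size (x i) <= e i)%N &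
        z = \sum_i B i * x i].
Proof.
move=> sB sA BA injA exA.
pose E := pfam K e; pose G := pfam K g.
pose al (y : G) : E := 
    [ffun t : {i : 'I_n & 'I_(e i)} => (\sum_j pfam_poly y j * A j (tag t))`_(tagged t)].
pose be (x : E) : pfam K (fun _ : 'I_1 => M) :=
  [ffun t : {i : 'I_1 & 'I_M} => (\sum_i B i * pfam_poly x i)`_(tagged t)].
have al_lin : linear al.
  move=> a x y; apply/ffunP => t; rewrite !ffunE.
  rewrite (eq_bigr (fun j => a *: (pfam_poly x j * A j (tag t)) + pfam_poly y j * A j (tag t))).
    by rewrite big_split -scaler_sumr coefD coefZ.
  by move=> j _; rewrite pfam_poly_linear mulrDl scalerAl.
have be_lin : linear be.
  move=> a x y; apply/ffunP => t; rewrite !ffunE.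
  rewrite (eq_bigr (fun i => a *: (B i * pfam_poly x i) + B i * pfam_poly y i)).
    by rewrite big_split -scaler_sumr coefD coefZ.
  by move=> j _; rewrite pfam_poly_linear mulrDr scalerAr.
have alE y i : pfam_poly (al y) i = \sum_j pfam_poly y j * A j i.
  have sz : (size (\sum_j pfam_poly y j * A j i)%R <= e i)%N.
    by apply: (leq_trans (size_sum _ _ _)); apply/bigmax_leqP => j _; apply/sA/size_pfam_poly.
  apply/polyP => k; case: (ltnP k (e i)) => ki.
    by rewrite (coef_pfam_poly _ (Ordinal ki)) ffunE.
  by rewrite !nth_default //; [apply: leq_trans sz ki | apply: leq_trans (size_pfam_poly _ _) ki].
have beE x : pfam_poly (be x) 0 = \sum_i B i * pfam_poly x i.
  have sz : (size (\sum_i B i * pfam_poly x i)%R <= M)%N.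
    by apply: (leq_trans (size_sum _ _ _)); apply/bigmax_leqP => j _; apply/sB/size_pfam_poly.
  apply/polyP => k; case: (ltnP k M) => ki.
    by rewrite (@coef_pfam_poly _ _ (fun _ : 'I_1 => M) _ _ (Ordinal ki)) ffunE.
  rewrite !nth_default //; [exact: leq_trans sz ki |].
  exact: leq_trans (@size_pfam_poly _ _ (fun _ : 'I_1 => M) _ _) ki.
have [fa faE] := linear_lfun al_lin; have [fb fbE] := linear_lfun be_lin.
have ka : lker fa = 0%VS.
  apply/eqP/lker0P => x y; rewrite !faE => Exy; apply/eqP; rewrite -subr_eq0.
  apply/eqP; apply: pfam_poly_inj => j; move: j; apply: injA => [j|i].
    exact: size_pfam_poly.
  rewrite -alE (_ : al (x - y) = 0).
    by rewrite /pfam_poly big1 // => k _; rewrite ffunE scale0r.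
  by rewrite -faE linearB /= !faE Exy subrr.
have iab : limg fa = lker fb.
  apply/vspaceP => x; rewrite memv_ker; apply/idP/eqP => [/memv_imgP [y _ ->]|].
    rewrite faE fbE; apply: pfam_poly_inj => i; rewrite ord1 beE.
    under eq_bigr do rewrite alE mulr_sumr.
    rewrite exchange_big big1 //= => j _.
    rewrite (eq_bigr (fun i => pfam_poly y j * (B i * A j i))).
      by rewrite -mulr_sumr BA mulr0.
    by move=> l _; rewrite mulrCA.
  rewrite fbE => bx0; have [|y sy Ey] := exA (pfam_poly x) (size_pfam_poly x).
    by rewrite -beE bx0 /pfam_poly big1 // => k _; rewrite ffunE scale0r.
  have [w Ew] := pfam_polyP sy; apply/memv_imgP; exists w; first exact: memvf.
  rewrite faE; apply/eqP; rewrite -subr_eq0; apply/eqP/pfam_poly_inj => i.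
  have := pfam_poly_linear (-1) (al w) x i; rewrite scaleN1r addrC => ->.
  rewrite alE Ey scaleN1r addrC; under [X in _ - X]eq_bigr do rewrite Ew.
  by rewrite subrr.
have dG : \dim (limg fa) = (\sum_j g j)%N.
  by have := limg_ker_dim fa fullv; rewrite ka capv0 dimv0 add0n dim_pfam.
have dE : (\dim (lker fb) + \dim (limg fb) = \sum_i e i)%N.
  by have := limg_ker_dim fb fullv; rewrite capfv dim_pfam.
have dM : \dim {:pfam K (fun _ : 'I_1 => M)} = M by rewrite dim_pfam big_ord1.
exists (\dim (limg fb)); split.
- by rewrite -[X in (_ <= X)%N]dM; apply/dimvS/subvf.
- by rewrite -dE -iab dG.
- split=> [rM z sz|surj].
    have fullb : limg fb = fullv by apply/eqP; rewrite eqEdim subvf rM -[X in (_ <= X)%N]dM leqnn.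
    have [z' Ez] := @pfam_polyP K _ (fun _ : 'I_1 => M) (fun=> z) (fun=> sz).
    have : z' \in limg fb by rewrite fullb memvf.
    case/memv_imgP => x _; rewrite fbE => Ex; exists (pfam_poly x).
      exact: size_pfam_poly.
    by rewrite -(Ez 0) Ex beE.
  rewrite -[RHS]dM; congr (\dim _); apply/vspaceP => z; rewrite memvf.
  have [x sx Ex] := surj (pfam_poly z 0) (@size_pfam_poly K _ (fun _ : 'I_1 => M) z 0).
  have [w Ew] := pfam_polyP sx; apply/memv_imgP; exists w; first exact: memvf.
  rewrite fbE; apply/eqP; rewrite -subr_eq0; apply/eqP/pfam_poly_inj => i; rewrite ord1.
  have := pfam_poly_linear (-1) (be w) z 0; rewrite scaleN1r addrC => ->.
  rewrite beE Ex scaleN1r addrC; under [X in _ - X]eq_bigr do rewrite Ew.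
  by rewrite subrr.
Qed.

(** The positive part; [posz (k + 1)] is the dimension of the binary forms of degree k. *)
Definition posz (k : int) : nat := if k is Posz e then e else 0%N.

Section Hilbert.
Variables (K : closedFieldType) (n : nat).
Variables (f : 'I_n -> {mpoly K[3]}) (d : 'I_n -> nat).
Hypothesis f_homog : forall i, f i \is (d i).-homog.
Implicit Types (p q : pt K) (a : pt K).

Lemma in_ideal_zhomog k y : zhomog k y -> in_ideal f y ->
  exists2 x : 'I_n -> {mpoly K[3]}, forall i, zhomog (k - (d i)%:Z) (x i) &
    y = \sum_i f i * x i.
Proof.
case: k => [m|m] hy [x Ey]; last first.
  exists (fun=> 0) => [i|]; first exact: zhomog0.
  by rewrite [y]hy big1 // => i _; rewrite mulr0.
exists (fun i => if (d i <= m)%N then pihomog mdeg (m - d i) (x i) else 0).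
  move=> i; case: leqP => dm; last exact: zhomog0.
  by rewrite subzn //; apply: pihomogP.
rewrite -[LHS](pihomog_dE (hy : y \is m.-homog)) Ey raddf_sum /=.
apply: eq_bigr => i _; rewrite mulrC (@pihomogM _ _ _ (x i) _ m (f_homog i)).
by case: leqP; rewrite ?mulr0.
Qed.

Lemma size_posz (G : {poly K}) k :
  (G = 0 \/ (size G)%:Z <= k + 1) <-> (size G <= posz (k + 1))%N.
Proof.
split=> [[->|]|]; first by rewrite size_poly0.
  by case: (k + 1) => e /=; lia.
by case: (k + 1) => e /= sG; [right; rewrite lez_nat | left; apply/eqP; rewrite -size_poly_eq0 -leqn0].
Qed.

(** This is (A/lA)_m = 0, stated through values on the line. *)
Definition restricts_onto a (m : nat) : Prop :=
  forall y : {mpoly K[3]}, y \is m.-homog ->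
  exists2 x : 'I_n -> {mpoly K[3]}, forall i, zhomog (m%:Z - (d i)%:Z) (x i) &
    forall p, line a p -> y.@[p] = \sum_i (f i).@[p] * (x i).@[p].

Lemma meval_sum_mul (I : finType) (g h : I -> {mpoly K[3]}) p :
  (\sum_i g i * h i).@[p] = \sum_i (g i).@[p] * (h i).@[p].
Proof. by rewrite raddf_sum; apply: eq_bigr => i _; rewrite /= mevalM. Qed.

Section OnLine.
Variables (a : pt K) (c : 'I_3).
Hypothesis ac : a c != 0.
Let res := lrestr a c.

Lemma line_vanish k g : zhomog k g -> (forall p, line a p -> g.@[p] = 0) ->
  exists2 g', zhomog (k - 1) g' & g = linform a * g'.
Proof. by move=> hg /(line_lrestr ac hg); apply: lrestr_eq0. Qed.

Lemma zhomog_sum_f k x : (forall i, zhomog (k - (d i)%:Z) (x i)) ->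
  zhomog k (\sum_i f i * x i).
Proof.
move=> hx; apply: zhomog_sum => i _.
have -> : k = (d i)%:Z + (k - (d i)%:Z) by ring.
by apply: zhomogM => //; apply: f_homog.
Qed.

Lemma res_lift (G : {poly K}) k : (size G <= posz (k + 1))%N ->
  exists2 g, zhomog k g & res g = G.
Proof. by move/size_posz; apply: lrestr_liftz. Qed.

Lemma res_size k g : zhomog k g -> (size (res g) <= posz (k + 1))%N.
Proof. by move=> hg; apply/size_posz; apply: lrestr_sizez. Qed.

Lemma res_eq k g h : zhomog k g -> zhomog k h ->
  (res g = res h <-> forall p, line a p -> g.@[p] = h.@[p]).
Proof.
move=> hg hh; have := line_lrestr ac (zhomogD hg (zhomogN hh)).
rewrite rmorphB => H; split=> [E p lp|E].
  by apply/eqP; rewrite -subr_eq0 -mevalB; apply/eqP; apply: (iffLR H) lp; rewrite -/res E subrr.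
apply/eqP; rewrite -subr_eq0; apply/eqP/H => p lp.
by rewrite mevalB E // subrr.
Qed.

Lemma res_sum (I : finType) (g h : I -> {mpoly K[3]}) :
  res (\sum_i g i * h i) = \sum_i res (g i) * res (h i).
Proof. by rewrite raddf_sum; apply: eq_bigr => i _; apply: rmorphM. Qed.

Lemma restricts_ontoP m : restricts_onto a m <->
  forall z : {poly K}, (size z <= m.+1)%N ->
    exists2 x : 'I_n -> {poly K}, forall i, (size (x i) <= m.+1 - d i)%N &
      z = \sum_i res (f i) * x i.
Proof.
have pE i : posz (m%:Z - (d i)%:Z + 1) = (m.+1 - d i)%N.
  by case: (leqP (d i) m.+1) => H; [rewrite (_ : _ + 1 = (m.+1 - d i)%N%:Z) //; lia |
    case E: (_ + 1) => [e|e] /=; lia].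
split=> [H z sz|H y hy].
  have sz' : (size z <= posz (m%:Z + 1))%N by rewrite -PoszD addn1.
  have [y hy <-] := res_lift sz'.
  have [x hx Ex] := H y hy; exists (fun i => res (x i)) => [i|].
    by rewrite -pE; apply: res_size.
  have hs := zhomog_sum_f hx.
  have -> : res y = res (\sum_i f i * x i).
    by apply/(res_eq (k := m) hy hs) => p lp; rewrite meval_sum_mul Ex.
  exact: res_sum.
have [|x sx Ex] := H (res y); first by have := res_size (k := m) hy; rewrite -PoszD addn1.
have [X HX] : exists X : 'I_n -> {mpoly K[3]}, forall i,
    zhomog (m%:Z - (d i)%:Z) (X i) /\ res (X i) = x i.
  have HX i : exists g, zhomog (m%:Z - (d i)%:Z) g /\ res g = x i.
    by have := sx i; rewrite -pE => /res_lift [g hg rg]; exists g.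
  exact: (fin_all_exists HX).
exists X => [i|p lp]; first by case: (HX i).
have hs : zhomog m (\sum_i f i * X i).
  by apply: zhomog_sum_f => i; case: (HX i).
rewrite -meval_sum_mul; apply: (iffLR (res_eq (k := m) hy hs)) => //.
rewrite Ex res_sum; apply: eq_bigr => i _.
by have [_ ->] := HX i.
Qed.

(** On the line a form of degree m+1 is X0 * y0 + X1 * y1 with y0, y1 of degree m: the constant
    coefficient in t goes to y0, the others to y1. *)
Lemma restricts_onto_S m : restricts_onto a m -> restricts_onto a m.+1.
Proof.
move=> H y hy.
have r0 : res 'X_(lift c (0 : 'I_2)) = 1 by rewrite /res /= mmapX mmap1U lcoord_i0.
have r1 : res 'X_(lift c (1 : 'I_2)) = 'X by rewrite /res /= mmapX mmap1U lcoord_i1.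
have sy : (size (res y) <= m.+2)%N.
  by have := res_size (k := m.+1) hy; rewrite -PoszD addn1.
have [y0 hy0 E0] := @lrestr_lift K a c (take_poly 1 (res y)) m
  (leq_trans (size_take_poly _ _) (ltn0Sn m)).
have [y1 hy1 E1] : exists2 y1, y1 \is m.-homog & res y1 = drop_poly 1 (res y).
  by apply: lrestr_lift; rewrite size_drop_poly; lia.
have [x0 hx0 Ex0] := H y0 hy0; have [x1 hx1 Ex1] := H y1 hy1.
pose X0 : {mpoly K[3]} := 'X_(lift c (0 : 'I_2)).
pose X1 : {mpoly K[3]} := 'X_(lift c (1 : 'I_2)).
have hm : m.+1%:Z = 1 + m%:Z by lia.
exists (fun i => X0 * x0 i + X1 * x1 i) => [i|p lp].
  rewrite hm -addrA; apply: zhomogD; apply: zhomogM => //; exact: dhomogXi.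
have E : y.@[p] = (X0 * y0 + X1 * y1).@[p].
  have hz : zhomog m.+1 (X0 * y0 + X1 * y1).
    rewrite hm; apply: zhomogD; apply: zhomogM => //; exact: dhomogXi.
  apply: (iffLR (res_eq (k := m.+1) hy hz)) => //.
  rewrite rmorphD !rmorphM /= -/res [res X0]r0 [res X1]r1 E1 [res y0]E0 mul1r mulrC.
  by rewrite -[LHS](poly_take_drop 1) expr1.
rewrite E mevalD !mevalM Ex0 // Ex1 // !mulr_sumr -big_split.
by apply: eq_bigr => i _; rewrite mevalD !mevalM /=; ring.
Qed.

Lemma surjective_restricts_onto m :
  mul_surjective f (linform a) m -> restricts_onto a m.+1.
Proof.
move=> H y hy; have [x hx Ix] := H y hy.
have lh := linform_homog a.
have hz : zhomog m.+1 (linform a * x - y).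
  by apply: rpredB => //; apply: (dhomogM lh hx).
have [z hz' Ez] := in_ideal_zhomog hz Ix.
exists (fun i => - z i) => [i|p lp]; first exact: zhomogN.
have := congr1 (fun g => g.@[p]) Ez; rewrite meval_sum_mul mevalB mevalM.
case: lp => _ ->; rewrite mul0r sub0r => /(congr1 -%R); rewrite opprK => ->.
by rewrite -sumrN; apply: eq_bigr => i _; rewrite mevalN mulrN.
Qed.

Lemma restricts_onto_surjective m :
  restricts_onto a m.+1 -> mul_surjective f (linform a) m.
Proof.
move=> H y hy; have [x hx Ex] := H y hy.
have hs := zhomog_sum_f hx.
have [|w hw Ew] := @line_vanish m.+1 (y - \sum_i f i * x i)
    (zhomogD (hy : zhomog m.+1 y) (zhomogN hs)).
  by move=> p lp; rewrite mevalB meval_sum_mul Ex // subrr.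
exists w; first by move: hw; rewrite (_ : m.+1%:Z - 1 = m) //; lia.
exists (fun i => - x i); rewrite -Ew addrAC subrr sub0r -sumrN.
by apply: eq_bigr => i _; rewrite mulNr mulrC.
Qed.

Hypothesis f_nozero : forall p, line a p -> exists i, (f i).@[p] != 0.
Variables (N : nat) (b : 'I_N -> int).
Hypothesis L_iso : isom (line a) (Syz_restr f d) (Osum K b).

(** Here rho is the dimension of the degree m part of the ideal restricted to the line, so m+1 - rho
    is the dimension of (A/lA)_m. *)
Lemma hilbert_line (m : nat) : exists rho : nat,
  [/\ (rho <= m.+1)%N,
      (\sum_i (m.+1 - d i) = \sum_j posz (m%:Z + b j + 1) + rho)%N &
      rho = m.+1 <-> restricts_onto a m].
Proof.
have [sg [hsg sg_syz sg_gen sg_free]] := line_basis ac f_homog f_nozero L_iso.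
have pE i : posz (m%:Z - (d i)%:Z + 1) = (m.+1 - d i)%N.
  by case: (leqP (d i) m.+1) => H; [rewrite (_ : _ + 1 = (m.+1 - d i)%N%:Z) //; lia |
    case E: (_ + 1) => [e|e] /=; lia].
have pM : posz (m%:Z + 1) = m.+1 by rewrite -PoszD addn1.
have lifts (I : finType) (k : I -> int) (y : I -> {poly K}) :
    (forall i, size (y i) <= posz (k i + 1))%N ->
    exists Y : I -> {mpoly K[3]}, forall i, zhomog (k i) (Y i) /\ res (Y i) = y i.
  move=> sy; have HX i : exists g, zhomog (k i) g /\ res g = y i.
    by have [g hg rg] := res_lift (sy i); exists g.
  exact: (fin_all_exists HX).
have sgM j i g : zhomog (m%:Z + b j) g -> zhomog (m%:Z - (d i)%:Z) (g * sg j i).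
  move=> hg; have -> : m%:Z - (d i)%:Z = (m%:Z + b j) + (- b j - (d i)%:Z) by ring.
  exact: zhomogM.
have [|||||rho [r1 r2 r3]] := @exact_dim K n N m.+1 (fun i => m.+1 - d i)%N
    (fun j => posz (m%:Z + b j + 1)) (fun j i => res (sg j i)) (fun i => res (f i)).
- move=> i x; rewrite -pE => /res_lift [g hg <-]; rewrite -rmorphM -pM.
  apply: res_size; have -> : m%:Z = (d i)%:Z + (m%:Z - (d i)%:Z) by ring.
  by apply: zhomogM => //; apply: f_homog.
- move=> j i x /res_lift [g hg <-]; rewrite -rmorphM -pE.
  by apply: res_size; apply: sgM.
- move=> j; rewrite -res_sum.
  apply/(line_lrestr ac (k := - b j)); first exact: zhomog_sum_f.
  by move=> p lp; rewrite meval_sum_mul sg_syz.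
- move=> y sy Ey j; have [Y HY] := lifts _ (fun j => m%:Z + b j) y sy.
  have hY j' : zhomog (m%:Z + b j') (Y j') by case: (HY j').
  have [_ <-] := HY j; apply/(line_lrestr ac (hY j)) => p lp.
  apply: (sg_free m Y hY _ p j lp) => q i lq.
  rewrite -meval_sum_mul; move: q lq.
  apply: (iffLR (line_lrestr ac (k := m%:Z - (d i)%:Z) _)).
    by apply: zhomog_sum => l _; apply: sgM.
  rewrite -/res res_sum -[RHS](Ey i); apply: eq_bigr => l _.
  by have [_ ->] := HY l.
- move=> x sx Ex.
  have sx' i : (size (x i) <= posz (m%:Z - (d i)%:Z + 1))%N by rewrite pE.
  have [X HX] := lifts _ (fun i => m%:Z - (d i)%:Z) x sx'.
  have hX i : zhomog (m%:Z - (d i)%:Z) (X i) by case: (HX i).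
  have [p lp|ga hga Ega] := sg_gen m X hX.
    rewrite -meval_sum_mul; move: p lp.
    apply: (iffLR (line_lrestr ac (k := m) _)); first exact: zhomog_sum_f.
    rewrite -/res res_sum -[RHS]Ex; apply: eq_bigr => i _.
    by have [_ ->] := HX i.
  exists (fun j => res (ga j)) => [j|i]; first exact: res_size.
  have [_ <-] := HX i; rewrite -res_sum.
  have hs : zhomog (m%:Z - (d i)%:Z) (\sum_j ga j * sg j i).
    by apply: zhomog_sum => j _; apply: sgM.
  by apply/(res_eq (hX i) hs) => p lp; rewrite meval_sum_mul Ega.
exists rho; split=> //.
by rewrite r3; apply: iff_sym; apply: restricts_ontoP.
Qed.

End OnLine.
End Hilbert.

(** * The weak Lefschetz property *)

Section Primary.
Variables (K : closedFieldType) (n : nat) (f : 'I_n -> {mpoly K[3]}).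
Hypothesis f_primary : Rplus_primary f.

Lemma in_ideal0 : in_ideal f 0.
Proof. by exists (fun=> 0); rewrite big1 // => i _; rewrite mul0r. Qed.

Lemma in_idealD x y : in_ideal f x -> in_ideal f y -> in_ideal f (x + y).
Proof.
move=> [u ->] [v ->]; exists (fun i => u i + v i).
by rewrite -big_split; apply: eq_bigr => i _; rewrite mulrDl.
Qed.

Lemma in_idealM z x : in_ideal f x -> in_ideal f (z * x).
Proof.
move=> [u ->]; exists (fun i => z * u i).
by rewrite mulr_sumr; apply: eq_bigr => i _; rewrite mulrA.
Qed.

Lemma primary_powX c : exists m, in_ideal f ('X_c ^+ m).
Proof.
apply/f_primary; exists (fun i => (i == c)%:R).
rewrite (bigD1 c) //= eqxx mul1r big1 ?addr0 // => i /negPf ->.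
by rewrite mul0r.
Qed.

Lemma primary_nozero (p : pt K) : P2 p -> exists i, (f i).@[p] != 0.
Proof.
move=> /P2_coord [c pc]; have [m [u E]] := primary_powX c.
apply: NNPP => H; have := congr1 (fun g => g.@[p]) E.
rewrite rmorphXn /= mevalXU raddf_sum /= big1.
  by move/eqP; rewrite expf_eq0 (negPf pc) andbF.
move=> i _; rewrite mevalM (_ : (f i).@[p] = 0) ?mulr0 //.
by apply/eqP; apply: contraT => fi; case: H; exists i.
Qed.

(** Pigeonhole: a monomial of degree at least the sum of the N c contains some X_c^(N c), a power in
    the ideal. *)
Lemma primary_large : exists M, forall m y, (M <= m)%N -> y \is m.-homog -> in_ideal f y.
Proof.
have [N HN] := fin_all_exists primary_powX.
exists (\sum_c N c)%N => m y Mm /dhomogP hy.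
rewrite [y]mpolyE big_seq; elim/big_ind: _ => [|x z|mm /hy mE].
- exact: in_ideal0.
- exact: in_idealD.
have [c Nc] : exists c, (N c <= mm c)%N.
  apply: NNPP => H; have : (\sum_c mm c < \sum_c N c)%N.
    rewrite !big_ord_recl !big_ord0.
    have lt c : (mm c < N c)%N by rewrite ltnNge; apply/negP => ?; apply: H; exists c.
    have := lt ord0; have := lt (lift ord0 ord0); have := lt (lift ord0 (lift ord0 ord0)).
    by lia.
  by rewrite -mdegE mE ltnNge Mm.
rewrite -mul_mpolyC; apply: in_idealM; rewrite mpolyXE_id (bigD1 c) //= mulrC.
apply: in_idealM; rewrite -(subnK Nc) exprD; apply: in_idealM; exact: HN.
Qed.

Lemma primary_proper : ~ in_ideal f 1.
Proof.
move=> I1; have [H _] := f_primary 1.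
have [u E] : in_ideal (fun i : 'I_3 => 'X_i : {mpoly K[3]}) 1.
  by apply: H; exists 1%N; rewrite expr1.
have := congr1 (fun g => g.@[(0 : pt K)]) E; rewrite meval1 raddf_sum big1.
  by move/eqP; rewrite oner_eq0.
by move=> i _; rewrite /= mevalM mevalXU ffunE mulr0.
Qed.

(** The weak Lefschetz property speaks of degrees below a given top degree, so one has to be
    produced before the property can be used. *)
Lemma top_degree_exists k x : x \is k.-homog -> ~ in_ideal f x ->
  exists2 s, top_degree f s & (k <= s)%N.
Proof.
move=> hx Nx; have [M HM] := primary_large.
pose nz s := exists2 x : {mpoly K[3]}, x \is s.-homog & ~ in_ideal f x.
have : forall t, (exists s, nz s /\ (M - t <= s)%N) ->
    exists2 s, nz s & forall s', nz s' -> (s' <= s)%N.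
  elim=> [[s [[y hy Ny] Ms]]|t IH [s [nzs ts]]].
    by case: Ny; apply: HM hy; lia.
  case: (classic (exists s, nz s /\ (M - t <= s)%N)) => [/IH //|H].
  exists s => // s' nzs'; rewrite leqNgt; apply/negP => ss'.
  by apply: H; exists s'; split=> //; lia.
move=> /(_ M) [|s nzs smax]; first by exists k; split; [exists x | lia].
exists s; last by apply: smax; exists x.
split=> // m y sm hy; apply: NNPP => Ny.
by have := smax m (ex_intro2 _ _ y hy Ny); lia.
Qed.

End Primary.

Lemma zopen_aopen (K : closedFieldType) (W : pt K -> Prop) :
  zopen (@P2 K) W -> aopen W.
Proof.
case=> G _ HW; exists (fun g => exists g' c, G g' /\ g = g' * 'X_c) => p.
split=> [/HW [/P2_coord [c pc] [g Gg gp]]|[_ [g [c [Gg ->]]]]].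
  by exists (g * 'X_c); [exists g, c | rewrite mevalM mevalXU mulf_neq0].
rewrite mevalM mevalXU mulf_eq0 negb_or => /andP [gp pc].
by apply/HW; split; [apply: coord_P2 pc | exists g].
Qed.

Lemma aopen_meet (K : closedFieldType) (V W : pt K -> Prop) :
  aopen V -> aopen W -> (exists p, V p) -> (exists p, W p) -> exists p, V p /\ W p.
Proof.
move=> [G HV] [G' HW] [p /HV [g Gg gp]] [q /HW [g' Gg' gq]].
have g0 : g != 0 by apply: contraNneq gp => ->; rewrite meval0.
have g0' : g' != 0 by apply: contraNneq gq => ->; rewrite meval0.
have [x] := mpoly_neq0_eval (mulf_neq0 g0 g0').
rewrite mevalM mulf_eq0 negb_or => /andP [gx gx'].
by exists x; split; [apply/HV; exists g | apply/HW; exists g'].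
Qed.

Section Main.
Variables (K : closedFieldType) (n : nat).
Variables (f : 'I_n -> {mpoly K[3]}) (d : 'I_n -> nat).
Hypothesis f_homog : forall i, f i \is (d i).-homog.
Hypothesis f_primary : Rplus_primary f.

Lemma line_nozero (a p : pt K) : line a p -> exists i, (f i).@[p] != 0.
Proof. by move=> /line_P2; apply: primary_nozero. Qed.

Lemma in_ideal_restricts_onto a m :
  (forall y, y \is m.-homog -> in_ideal f y) -> restricts_onto f d a m.
Proof.
move=> H y hy; have [x hx Ex] := in_ideal_zhomog f_homog (k := m) hy (H y hy).
by exists x => // p lp; rewrite Ex meval_sum_mul.
Qed.

Section Splitting.
Variables (a : pt K) (c : 'I_3) (b : 'I_n.-1 -> int).
Hypothesis ac : a c != 0.
Hypothesis L_iso : isom (line a) (Syz_restr f d) (Osum K b).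

Lemma hilbert_large : exists m : nat,
  [/\ forall i, (d i <= m)%N, forall j, 0 <= m%:Z + b j &
      (\sum_i (m.+1 - d i) = \sum_j posz (m%:Z + b j + 1) + m.+1)%N].
Proof.
have [M HM] := primary_large f_primary.
pose m := (M + \sum_i d i + \sum_j absz (b j))%N.
exists m; split.
- by move=> i; rewrite /m (bigD1 i) //=; lia.
- by move=> j; rewrite /m (bigD1 j) //=; move: (\sum_i d i)%N (\sum_(i | _) _)%N; lia.
have [rho [_ -> E]] := hilbert_line f_homog ac (@line_nozero a) L_iso m.
congr (_ + _)%N; apply/E/in_ideal_restricts_onto => y; apply: HM.
by rewrite /m -addnA leq_addr.
Qed.

Lemma n_gt0 : (0 < n)%N.
Proof.
have [m [_ _]] := hilbert_large; rewrite lt0n; case: eqP => // n0.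
rewrite [LHS]big1; first by lia.
by move=> i; exfalso; have := ltn_ord i; lia.
Qed.

Lemma sum_splitting : \sum_j b j = - \sum_i (d i)%:Z.
Proof.
have [m [hd hb]] := hilbert_large => /(congr1 Posz).
rewrite PoszD !(big_morph Posz PoszD (erefl _)).
rewrite (eq_bigr (fun i => m.+1%:Z - (d i)%:Z)); last first.
  by move=> i _; rewrite subzn // leqW.
rewrite [in X in _ = X -> _](eq_bigr (fun j => m.+1%:Z + b j)); last first.
  move=> j _; have := hb j; rewrite /posz; have -> : m.+1%:Z = m%:Z + 1 by lia.
  by case E: (_ + 1) => [e|e] h; lia.
rewrite sumrB big_split /= !sumr_const !card_ord.
have En : n%:Z = n.-1%:Z + 1 by have := n_gt0; lia.
rewrite -[m.+1%:Z *+ n]mulr_natr -[m.+1%:Z *+ n.-1]mulr_natr !natz En mulrDr mulr1.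
move: (m.+1%:Z * _) (\sum_i (d i)%:Z) (\sum_j b j) => x y z; lia.
Qed.

(** The terms with b j are not truncated, and truncating the terms with d i only increases their
    sum; hence rho >= m+1. *)
Lemma onto_of_ge m : (forall j, -1 <= m%:Z + b j) -> restricts_onto f d a m.
Proof.
move=> hb; have [rho [r1 E H]] := hilbert_line f_homog ac (@line_nozero a) L_iso m.
apply/H; apply/eqP; rewrite eqn_leq r1 /=.
move/(congr1 Posz): E; rewrite PoszD !(big_morph Posz PoszD (erefl _)).
rewrite [in X in _ = X -> _](eq_bigr (fun j => m.+1%:Z + b j)); last first.
  move=> j _; have := hb j; rewrite /posz; have -> : m.+1%:Z = m%:Z + 1 by lia.
  by case E: (_ + 1) => [e|e] h; lia.
rewrite big_split /= sum_splitting sumr_const card_ord.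
have : \sum_(i < n) (m.+1%:Z - (d i)%:Z) <= \sum_(i < n) (m.+1 - d i)%N%:Z.
  by apply: Num.Theory.ler_sum => i _; lia.
rewrite sumrB sumr_const card_ord.
have En : n%:Z = n.-1%:Z + 1 by have := n_gt0; lia.
rewrite -[m.+1%:Z *+ n]mulr_natr -[m.+1%:Z *+ n.-1]mulr_natr !natz En mulrDr mulr1.
move=> h E; move: h; rewrite [X in _ <= X]E.
move: (m.+1%:Z * _) (\sum_i (d i)%:Z) => x y; lia.
Qed.

(** The coefficients of l x - l y restrict to a syzygy on the line, so they vanish there and are
    divisible by l, which then cancels. *)
Lemma injective_of_lt m : (forall j, m.+1%:Z + b j < 0) ->
  mul_injective f (linform a) m.
Proof.
move=> hb x y hx hy Ixy.
have lh := linform_homog a.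
have hz : zhomog m.+1 (linform a * x - linform a * y).
  by rewrite -mulrBr; apply: (dhomogM lh); apply: rpredB.
have [u hu Eu] := in_ideal_zhomog f_homog hz Ixy.
have [sg [hsg sg_syz sg_gen sg_free]] := line_basis ac f_homog (@line_nozero a) L_iso.
have [p lp|ga hga Ega] := sg_gen m.+1 u hu.
  by rewrite -meval_sum_mul -Eu mevalB !mevalM; case: lp => _ ->; rewrite !mul0r subrr.
have Hv i : exists v, u i = linform a * v.
  have [p lp|v _ ->] := line_vanish ac (hu i); last by exists v.
  rewrite Ega // big1 // => j _.
  have := hga j; have := hb j; case: (_ + b j) => // e _ ->.
  by rewrite meval0 mul0r.
have [v Ev] := fin_all_exists Hv.
exists v; apply: (mulfI (linform_neq0 ac)); rewrite mulrBr Eu mulr_sumr.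
by apply: eq_bigr => i _; rewrite Ev; ring.
Qed.

End Splitting.

Lemma balanced_weak_lefschetz (a0 : int) (s : nat) :
  on_generic_line (fun L : pt K -> Prop => isom L (Syz_restr f d)
    (Osum K (fun i : 'I_n.-1 => if (i < s)%N then a0 + 1 else a0))) ->
  weak_lefschetz f.
Proof.
case=> W [oW neW HW]; exists W; split=> //; first exact: zopen_aopen.
move=> a Wa _ m _ _; have [c ac] := P2_coord (zopen_sub oW Wa).
have L_iso := HW a Wa.
(* If m+1+a0 <= -2, then m+1+(a0+1) is still negative: the two cases meet because the exponents
   differ by at most 1. *)
case: (boolP (-1 <= m.+1%:Z + a0)) => h.
  right; apply: (restricts_onto_surjective f_homog ac).
  by apply: (onto_of_ge ac L_iso) => j; case: ifP => _; lia.
by left; apply: (injective_of_lt ac L_iso) => j; case: ifP => _; lia.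
Qed.

End Main.

Section Unbalanced.
Variables (K : closedFieldType) (n : nat).
Variables (f : 'I_n -> {mpoly K[3]}) (d : 'I_n -> nat).
Hypothesis f_homog : forall i, f i \is (d i).-homog.
Hypothesis f_primary : Rplus_primary f.
Variables (a : pt K) (c : 'I_3) (b : 'I_n.-1 -> int).
Hypothesis ac : a c != 0.
Hypothesis L_iso : isom (line a) (Syz_restr f d) (Osum K b).

Let hilbert m := hilbert_line f_homog ac (fun p => @line_nozero K n f f_primary a p) L_iso m.

(** For n = 1 the gap in (2) would compare a 1 with the meaningless a 0. In that case the
    large-degree count gives d i0 = 0, and the count in degree 0 then puts 1 in the ideal. *)
Lemma rank_gt0 : (0 < n.-1)%N.
Proof.
have n0 := n_gt0 f_homog f_primary ac L_iso.
rewrite lt0n; apply/negP => /eqP n1; pose i0 := Ordinal n0.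
have all0 (i : 'I_n) : i = i0 by apply: val_inj; have := ltn_ord i; rewrite /=; lia.
have sum1 (F : 'I_n -> nat) : (\sum_i F i = F i0)%N.
  by rewrite (bigD1 i0) //= big1 ?addn0 // => i; rewrite [i]all0 eqxx.
have sum0 (F : 'I_n.-1 -> nat) : (\sum_j F j = 0)%N.
  by rewrite big1 // => j; exfalso; have := ltn_ord j; lia.
have [m [hd _]] := hilbert_large f_homog f_primary ac L_iso.
rewrite sum1 sum0 => E; have d0 : d i0 = 0%N by have := hd i0; lia.
have [rho [_ E0 H0]] := hilbert 0%N.
have : restricts_onto f d a 0 by apply/H0; rewrite sum1 sum0 d0 in E0.
have h1 : (1 : {mpoly K[3]}) \is 0.-homog by apply: dhomog1.
move=> /(_ 1 h1) [x hx Ex]; apply: (primary_proper f_primary).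
have hs := zhomog_sum_f f_homog hx.
have [p lp|w hw Ew] := line_vanish ac (zhomogD (h1 : zhomog 0 1) (zhomogN hs)).
  by rewrite mevalB meval_sum_mul Ex // subrr.
exists x; apply/eqP; rewrite -subr_eq0; apply/eqP.
rewrite [w]hw mulr0 in Ew; rewrite -[RHS]Ew; congr (_ - _).
by apply: eq_bigr => i _; rewrite mulrC.
Qed.

Hypothesis S_semistable : semistable (Syz f d).
Hypothesis wl : forall s m, top_degree f s -> (m < s)%N ->
  mul_injective f (linform a) m \/ mul_surjective f (linform a) m.
Variables j0 j1 : 'I_n.-1.
Hypothesis b_max : forall j, b j <= b j0.
Hypothesis b_gap : b j1 <= b j0 - 2.

Let r := n.-2.
Lemma nE : n = r.+2.
Proof. by have := rank_gt0; rewrite /r; lia. Qed.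

Lemma f_nozero_line : exists2 a : pt K, P2 a & forall p, line a p ->
  exists i, (f i).@[p] != 0.
Proof.
by exists a; [exact: coord_P2 ac | move=> p /line_P2; apply: primary_nozero].
Qed.

Lemma sum_b_lt : \sum_j b j < (r.+1)%:Z * b j0.
Proof.
rewrite (bigD1 j1) //=.
have : \sum_(j | j != j1) b j <= \sum_(j | j != j1) b j0.
  by apply: Num.Theory.ler_sum => j _; apply: b_max.
have : \sum_(j < n.-1) b j0 = b j0 + \sum_(j | j != j1) b j0 by rewrite (bigD1 j1).
rewrite sumr_const card_ord -[b j0 *+ _]mulr_natr natz.
have nr : n.-1%:Z = r.+1 by have := nE; lia.
rewrite nr mulrC; move: b_gap (\sum_(j | j != j1) b j0) (\sum_(j | j != j1) b j).
by move: (_ * _) => z; lia.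
Qed.

(* A syzygy on P^2 in the lowest degree of the splitting would destabilize. *)
Lemma no_low_syzygy (mu : nat) (g : 'I_n -> {mpoly K[3]}) : mu%:Z = - b j0 ->
  (forall i, zhomog (mu%:Z - (d i)%:Z) (g i)) -> \sum_i f i * g i = 0 ->
  forall i, g i = 0.
Proof.
move=> muE hg sg i; apply/eqP; apply: contraT => gi.
have := semistable_syzygy f_homog f_nozero_line S_semistable hg sg gi nE.
rewrite -(sum_splitting f_homog f_primary ac L_iso) muE opprK.
by have := sum_b_lt; move: (\sum_j b j); lia.
Qed.

(* Restriction to the line creates a syzygy, so multiplication into degree
   - b j0 is not injective; it must then be surjective. *)
Lemma low_degree_onto : exists2 mu : nat, mu%:Z = - b j0 &
  restricts_onto f d a mu.
Proof.
have [sg [hsg sg_syz _ sg_free]] := line_basis ac f_homog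
  (fun p => @line_nozero K n f f_primary a p) L_iso.
pose ga j : {mpoly K[3]} := (j == j0)%:R.
have hga j : zhomog (- b j0 + b j) (ga j).
  rewrite /ga; case: eqP => [->|_]; last exact: zhomog0.
  by rewrite addNr; apply: dhomog1.
have ga_sum p i : \sum_j (ga j).@[p] * (sg j i).@[p] = (sg j0 i).@[p].
  rewrite (bigD1 j0) //= /ga eqxx meval1 mul1r big1 ?addr0 // => j /negPf ->.
  by rewrite meval0 mul0r.
have [i [p [lp sgp]]] : exists i p, line a p /\ (sg j0 i).@[p] != 0.
  apply: NNPP => H; have [p lp] := line_nonempty (coord_P2 ac).
  have Z : (ga j0).@[p] = 0.
    apply: (sg_free (- b j0) ga hga _ p j0 lp) => q i lq; rewrite ga_sum.
    by apply/eqP; apply: contraT => nz; case: H; exists i, q.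
  by move/eqP: Z; rewrite /ga eqxx meval1 oner_eq0.
have [e eE _] : exists2 e : nat, - b j0 - (d i)%:Z = e & sg j0 i \is e.-homog.
  by apply: (zhomogE (hsg j0 i)); apply: contraNneq sgp => ->; rewrite meval0.
have [mu muE] : exists mu : nat, mu%:Z = - b j0 by exists (e + d i)%N; lia.
have hsg0 l : zhomog (mu%:Z - (d l)%:Z) (sg j0 l) by rewrite muE.
exists mu => //.
have [q lq|h hh Eh] := line_vanish ac (zhomog_sum_f f_homog hsg0).
  by rewrite meval_sum_mul sg_syz.
(* If h = sum f_l x_l, then sg j0 - l x is a syzygy of degree mu on P^2, hence zero, although sg j0
   does not vanish at p on the line. *)
have Nh : ~ in_ideal f h.
  move=> Ih; have [x hx Ex] := in_ideal_zhomog f_homog hh Ih.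
  have lh : zhomog 1 (linform a) := linform_homog a.
  pose g l := sg j0 l - linform a * x l.
  have hg l : zhomog (mu%:Z - (d l)%:Z) (g l).
    apply: zhomogD => //; apply: zhomogN.
    have -> : mu%:Z - (d l)%:Z = 1 + (mu%:Z - 1 - (d l)%:Z) by ring.
    exact: zhomogM.
  have g_syz : \sum_l f l * g l = 0.
    under eq_bigr do rewrite mulrBr.
    rewrite sumrB Eh Ex mulr_sumr -sumrB big1 // => l _; ring.
  have g0 := no_low_syzygy muE hg g_syz.
  have := congr1 (fun g => g.@[p]) (g0 i).
  rewrite mevalB mevalM; case: (lp) => _ ->; rewrite mul0r subr0 meval0.
  exact/eqP.
case: mu => [|mu] in muE hsg0 hh Eh *.
  by case: Nh; rewrite [h]hh; apply: in_ideal0.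
have hh' : h \is mu.-homog.
  by move: hh; rewrite (_ : mu.+1%:Z - 1 = mu) //; lia.
have [s top_s mus] := top_degree_exists f_primary hh' Nh.
(* If the degree of h is already the top degree, the next graded piece of A is zero and there is
   nothing to prove. *)
case: (ltnP mu s) => mus'; last first.
  apply: (in_ideal_restricts_onto f_homog) => y hy.
  by case: top_s => _; apply; last exact: hy; lia.
case: (wl top_s mus') => [inj|surj].
  have h0 : (0 : {mpoly K[3]}) \is mu.-homog by apply: dhomog0.
  case: Nh; have := inj h 0 hh' h0; rewrite mulr0 !subr0 -Eh; apply.
  exists (sg j0); by apply: eq_bigr => l _; rewrite mulrC.
exact: (surjective_restricts_onto f_homog).
Qed.

Lemma unbalanced_false : False.
Proof.
have [mu muE onto] := low_degree_onto.
have [rho [_ E1 H1]] := hilbert mu; have [rho' [_ E2 H2]] := hilbert mu.+1.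
have onto' := restricts_onto_S ac onto.
rewrite (iffRL H1 onto) in E1; rewrite (iffRL H2 onto') in E2.
(* Exactly these i can contribute in the degrees mu and mu+1; the bound mu+1 makes the differences
   mu+1 - d i exact on I. *)
pose I := [set i | (d i <= mu.+1)%N].
pose q1 j := posz (mu%:Z + b j + 1).
(* As mu = - b j0 and b j0 is maximal, q1 marks the j with b j = b j0, and q2 those with b j >= b j0
   - 1. *)
pose q2 j := nat_of_bool (-1 <= mu%:Z + b j).
have Eq2 j : posz (mu.+1%:Z + b j + 1) = (q1 j + q2 j)%N.
  have := b_max j; rewrite /q1 /q2 => bj.
  case E: (mu%:Z + b j + 1) => [x|x] /=; case F: (mu.+1%:Z + b j + 1) => [y|y] /=;
    case: (boolP (-1 <= mu%:Z + b j)) => G /=; lia.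
have IE x : (x <= mu.+2)%N -> (mu.+1 <= x)%N ->
    (\sum_i (x - d i) = \sum_(i in I) (x - d i))%N.
  move=> x2 x1; rewrite [RHS]big_mkcond; apply: eq_bigr => i _.
  by rewrite inE; case: leqP => // di; apply/eqP; rewrite subn_eq0; lia.
have I1 : (\sum_(i in I) (mu.+2 - d i) = \sum_(i in I) (mu.+1 - d i) + #|I|)%N.
  rewrite -sum1_card -big_split; apply: eq_bigr => i; rewrite inE /=; lia.
have I2 : (\sum_(i in I) (mu.+1 - d i) + \sum_(i in I) d i = #|I| * mu.+1)%N.
  rewrite -big_split -sum_nat_const; apply: eq_bigr => i; rewrite inE /=; lia.
rewrite IE ?leqnn ?leqnSn // in E1; rewrite IE ?leqnn ?leqnSn // in E2.
pose Q := (\sum_j q2 j)%N; pose r0 := (\sum_j q1 j)%N.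
have E2' : (\sum_j posz (mu.+1%:Z + b j + 1) = r0 + Q)%N.
  by rewrite -big_split; apply: eq_bigr => j _; apply: Eq2.
(* Difference of the two counts: the left side grows by the cardinal of I, the right side by Q +
   1. *)
have cI : #|I| = Q.+1 by move: E1 E2; rewrite E2' I1 -/r0; lia.
have q1j0 : q1 j0 = 1%N by rewrite /q1 (_ : _ + 1 = 1) //; lia.
have r0_gt0 : (0 < r0)%N by rewrite /r0 (bigD1 j0) //= q1j0.
have q2_1 j : (q2 j <= 1)%N by rewrite /q2; case: (_ <= _).
have Q_gt0 : (0 < Q)%N.
  rewrite /Q (bigD1 j0) //= {1}/q2; have -> : -1 <= mu%:Z + b j0 by lia.
  by [].
have Q_lt : (Q < r.+1)%N.
  rewrite /Q (bigD1 j1) //= {1}/q2.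
  have -> : (-1 <= mu%:Z + b j1) = false by apply/negbTE; move: b_gap; lia.
  have : (\sum_(j | j != j1) q2 j <= \sum_(j | j != j1) 1)%N by apply: leq_sum.
  by rewrite sum1_card cardC1 card_ord add0n ltnS.
have cI' : #|I| = Q.-1.+2 by rewrite cI prednK.
(* On the line X_k^mu is a combination of the f i, in which those outside I have coefficients of
   negative degree, that is, zero. *)
have Iz p : line a p -> exists2 i, i \in I & (f i).@[p] != 0.
  move=> lp; have [k pk] := P2_coord (line_P2 lp).
  have [x hx Ex] := onto _ (dhomogXn K k mu).
  apply: NNPP => H; have := Ex p lp; rewrite rmorphXn /= mevalXU big1.
    by move/eqP; rewrite expf_eq0 (negPf pk) andbF.
  move=> i _; case: (boolP (i \in I)) => iI.
    rewrite (_ : (f i).@[p] = 0) ?mul0r //.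
    by apply/eqP; apply: contraT => fi; case: H; exists i.
  have := hx i; rewrite inE -ltnNge in iI.
  by case E: (_ - _) => [e|e] => [_|->]; [lia | rewrite meval0 mulr0].
have := semistable_subfamily f_homog f_nozero_line S_semistable nE cI' (coord_P2 ac) Iz.
have S1 : \sum_(i in I) (d i)%:Z = (\sum_(i in I) d i)%N.
  by rewrite (big_morph Posz PoszD (erefl _)).
have S2 : ((n - #|I|) * mu.+2 <= \sum_(i | i \notin I) d i)%N.
  have -> : (n - #|I|)%N = #|[pred i | i \notin I]|.
    have C1 := max_card (mem I); have C2 := cardC I; rewrite card_ord in C1 C2.
    by apply: (@addnI #|I|); rewrite subnKC ?C2.
  rewrite -sum_nat_const; apply: leq_sum => i; rewrite !inE; lia.
have S3 : \sum_i (d i)%:Z = (\sum_(i in I) d i + \sum_(i | i \notin I) d i)%N.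
  by rewrite PoszD !(big_morph Posz PoszD (erefl _)) [LHS](bigID (mem I)).
rewrite S1 S3 prednK // => SS.
have nn := nE; rewrite cI in S2.
move: E1; rewrite -/r0; move: I2 S2 SS; rewrite cI.
move: (\sum_(i in I) (mu.+1 - d i))%N (\sum_(i in I) d i)%N (\sum_(i | i \notin I) d i)%N.
move=> t s1 s2 I2 S2 SS E1.
(* The count in degree mu, with Q + 1 indices in I, gives the sum of the d i over I. *)
have s1E : (s1 + r0 = Q * mu.+1)%N by nia.
have J1 : exists J, (J = r.+1 - Q /\ 0 < J)%N by exists (r.+1 - Q)%N; lia.
case: J1 => J [JE J0].
have rE : r.+1 = (Q + J)%N by lia.
have S2' : (J * mu.+2 <= s2)%N by move: S2; have -> : (n - Q.+1 = J)%N by lia.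
have SS' : (s2 * Q <= s1 * J)%N by move: SS; rewrite rE; nia.
(* Q J (mu+2) <= Q s2 <= J s1 = J (Q (mu+1) - r0), which is impossible as Q and J are positive. *)
nia.
Qed.

End Unbalanced.

Theorem theorem2p2 (K : closedFieldType) (charK : [pchar K] =i pred0)
  (n : nat) (f : 'I_n -> {mpoly K[3]}) (d : 'I_n -> nat)
  (f_homog : forall i, f i \is (d i).-homog)
  (f_primary : Rplus_primary f)
  (S_semistable : semistable (Syz f d)) :
  (forall (a : int) (s : nat), (s <= n.-1)%N ->
     on_generic_line (fun L : pt K -> Prop =>
       isom L (Syz_restr f d)
         (Osum K (fun i : 'I_n.-1 => if (i < s)%N then a + 1 else a))) ->
     weak_lefschetz f)
  /\
  (forall a : nat -> int,
     (forall i j : nat, (1 <= i <= j)%N -> (j <= n.-1)%N -> a j <= a i) ->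
     2 <= a 1%N - a n.-1 ->
     on_generic_line (fun L : pt K -> Prop =>
       isom L (Syz_restr f d) (Osum K (fun i : 'I_n.-1 => a i.+1))) ->
     ~ weak_lefschetz f).
Proof.
split=> [a0 s _|a a_decr a_gap [W [oW neW HW]] [W' [oW' neW' HW']]].
  exact: balanced_weak_lefschetz.
have [l [Wl Wl']] := aopen_meet (zopen_aopen oW) oW' neW neW'.
have [c lc] := P2_coord (zopen_sub oW Wl).
have N0 := rank_gt0 f_homog f_primary lc (HW l Wl).
(* The exponents are numbered from 1 and the ordinals from 0, so a (n-1) sits at index n-2. *)
have j1P : (n.-2 < n.-1)%N by lia.
apply: (unbalanced_false f_homog f_primary lc (HW l Wl) S_semistable (HW' l Wl')
  (j0 := Ordinal N0) (j1 := Ordinal j1P)) => /= [j|].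
  by apply: a_decr => //=; apply: ltn_ord.
by rewrite prednK //; lia.
Qed.
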